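(* Let $W\subset GL(V)$ be a finite complex reflection group. The map $k\mapsto\mathrm{kz}_k$ is a homomorphism from the additive group of integral multiplicities to the group of permutations of $\mathrm{Irr}(W)$; that is, $\mathrm{kz}_k\circ\mathrm{kz}_{k'}=\mathrm{kz}_{k+k'}$ for all integral $k,k'$.
   Context: Let $V$ be a finite-dimensional complex vector space and $W\subset GL(V)$ a finite group generated by complex reflections; $\mathrm{Irr}(W)$ is the set of isomorphism classes of irreducible complex representations. $\mathcal{A}$ is the set of reflection hyperplanes; for $H\in\mathcal{A}$, $W_H$ is the pointwise stabilizer (cyclic of order $n_H$), $\alpha_H\in V^*$ has kernel $H$, and $e_{H,i}=\frac{1}{n_H}\sum_{w\in W_H}(\det w)^{-i}w\in\mathbb{C}W$, where $\det$ is the determinant character of $W$ on $V$. $V_{\mathrm{reg}}=V\setminus\bigcup_{H\in\mathcal{A}}H$. An integral multiplicity is a collection $k=\{k_{H,i}\}$ of integers, $H\in\mathcal{A}$, $0\le i\le n_H-1$, with $k_{H,i}$ depending only on $i$ and the $W$-orbit of $H$; they form an additive group $\mathbb{Z}^{\sum_{C\in\mathcal{A}/W}n_C}$ ($n_C=n_H$ for $H\in C$). KZ twists: for integral $k$ and $\tau\in\mathrm{Irr}(W)$, consider the Knizhnik–Zamolodchikov (KZ) system for $\tau$-valued functions $y$ on $V_{\mathrm{reg}}$: $\partial_\xi y+\sum_{H\in\mathcal{A}}\frac{\alpha_H(\xi)}{\alpha_H}\sum_{i=0}^{n_H-1}n_Hk_{H,i}\,e_{H,i}(y)=0$ for all $\xi\in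 V$ (with $e_{H,i}$ acting on the values of $y$). For integral $k$ all local solutions extend to global ones in $\mathbb{C}[V_{\mathrm{reg}}]\otimes\tau$; the global solutions form a space of dimension $\dim\tau$ on which $W$ acts by $({}^wy)(x)=w\,(y(w^{-1}x))$ (this is the monodromy of the system on $V_{\mathrm{reg}}/W$), and this representation is irreducible. Its class is denoted $\mathrm{kz}_k(\tau)$; $\mathrm{kz}_k$ is a permutation of $\mathrm{Irr}(W)$. *)

(* Defs.v *)
From HB Require Import structures.
From mathcomp Require Import all_boot all_order all_algebra.
From mathcomp Require Import all_fingroup all_character.
From mathcomp Require Import boolp classical_sets reals topology normedtype derive.
From mathcomp Require mpoly.
From mathcomp Require Import complex.

Set Implicit Arguments.
Unset Strict Implicit.
Unset Printing Implicit Defensive.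

Import GRing.Theory Num.Theory.
Import numFieldNormedType.Exports.

Local Open Scope ring_scope.

(* V is the space of column vectors 'cV[C]_n, and W acts on it on the left
   through rV: w sends x to rV w *m x.  A finite subgroup of GL(V) is given as
   a finite group W together with a faithful representation rV, so that det w
   is \det (rV w). *)

Section ReflectionGroup.

Variables (C : numClosedFieldType) (gT : finGroupType) (W : {group gT}).
Variables (n : nat) (rV : mx_representation C W n).

Definition act_lfun (w : gT) : 'End('cV[C]_n) := linfun (mulmx (rV w)).

Definition is_reflection (w : gT) : bool :=
  (\dim (fixedSpace (act_lfun w))).+1 == n.

Definition reflections : {set gT} := [set w in W | is_reflection w].

Definition complex_reflection_group : Prop :=
  mx_faithful rV /\ <<reflections>>%g = W.

Definition hyperplanes : seq {vspace 'cV[C]_n} :=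
  undup [seq fixedSpace (act_lfun w) | w <- enum reflections].

Definition pt_stab (H : {vspace 'cV[C]_n}) : {set gT} :=
  [set w in W | (H <= fixedSpace (act_lfun w))%VS].

Definition n_ (H : {vspace 'cV[C]_n}) : nat := #|pt_stab H|.

Definition Vreg : {pred 'cV[C]_n} :=
  [pred x | all (fun H : {vspace 'cV[C]_n} => x \notin H) hyperplanes].

(* Only the values k H i with H \in hyperplanes and i < n_ H are meaningful;
   nothing below depends on the other ones. *)
Definition integral_multiplicity (k : {vspace 'cV[C]_n} -> nat -> int) : Prop :=
  forall (H : {vspace 'cV[C]_n}) (w : gT) (i : nat),
    H \in hyperplanes -> w \in W -> (i < n_ H)%N ->
    k (act_lfun w @: H)%VS i = k H i.

Definition addmult (k k' : {vspace 'cV[C]_n} -> nat -> int) :=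
  fun H i => k H i + k' H i.

Definition is_hyperplane_forms
    (alpha : {vspace 'cV[C]_n} -> 'Hom('cV[C]_n, C^o)) : Prop :=
  forall H, H \in hyperplanes -> lker (alpha H) = H.

Section KZ.

Variable alpha : {vspace 'cV[C]_n} -> 'Hom('cV[C]_n, C^o).

(* Elements of C[V_reg] (x) C^d are represented by functions on V, of which
   only the restriction to V_reg matters. *)
Definition regular_on_Vreg (d : nat) (y : 'cV[C]_n -> 'cV[C]_d) : Prop :=
  forall j : 'I_d, exists (P : mpoly.mpoly n C) (N : nat),
    forall x, x \in Vreg ->
      y x j 0 = mpoly.meval (fun i => x i 0) P
                / (\prod_(H <- hyperplanes) (alpha H x : C)) ^+ N.

Section Twist.

Variables (d : nat) (tau : mx_representation C W d).

Definition e_ (H : {vspace 'cV[C]_n}) (i : nat) : 'M[C]_d :=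
  (n_ H)%:R^-1 *: \sum_(w in pt_stab H) (\det (rV w)) ^- i *: tau w.

Definition KZ_solution (k : {vspace 'cV[C]_n} -> nat -> int)
    (y : 'cV[C]_n -> 'cV[C]_d) : Prop :=
  regular_on_Vreg y /\
  forall xi x : 'cV[C]_n, x \in Vreg ->
    'D_xi y x
    + \sum_(H <- hyperplanes)
        ((alpha H xi : C) / (alpha H x : C)) *:
        \sum_(i < n_ H) ((n_ H)%:R * (k H i)%:~R) *: (e_ H i *m y x) = 0.

Definition act_sol (w : gT) (y : 'cV[C]_n -> 'cV[C]_d) :=
  fun x => tau w *m y (rV w^-1%g *m x).

(* Phi is a W-equivariant linear isomorphism from the representation space of
   sigma onto the space of global solutions of the KZ system. *)
Definition KZ_iso (k : {vspace 'cV[C]_n} -> nat -> int)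
    (m : nat) (sigma : mx_representation C W m)
    (Phi : 'cV[C]_m -> 'cV[C]_n -> 'cV[C]_d) : Prop :=
  [/\ forall v, KZ_solution k (Phi v),
      forall (a : C) u v,
        {in Vreg, forall x, Phi (a *: u + v) x = a *: Phi u x + Phi v x},
      forall v, {in Vreg, forall x, Phi v x = 0} -> v = 0,
      forall y, KZ_solution k y -> exists v, {in Vreg, y =1 Phi v} &
      forall w v, w \in W -> {in Vreg, Phi (sigma w *m v) =1 act_sol w (Phi v)}].

End Twist.

(* The elements of sT : irrType C W index the isomorphism classes of
   irreducible representations of W over C, irr_repr sigma being a
   representative of sigma.  For an integral multiplicity k exactly one sigma
   is picked; elsewhere kz takes the arbitrary value of the trivial
   representation (not tau, so that kz could not degenerate to the identity). *)
Definition kz (sT : irrType C W) (k : {vspace 'cV[C]_n} -> nat -> int)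
    (tau : sT) : sT :=
  odflt (principal_comp sT)
    [pick sigma : sT | `[< exists Phi, KZ_iso (irr_repr tau) k (irr_repr sigma) Phi >]].

End KZ.

End ReflectionGroup.

(* Main.v *)
Require Import Defs.
From mathcomp Require Import all_boot all_order all_algebra.
From mathcomp Require Import all_fingroup all_character.
From mathcomp Require Import reals complex.
From HB Require Import structures.

Local Open Scope ring_scope.
Local Open Scope complex_scope.

(* The KZ connection nabla(k) is studied algebraically, over the field K of
   rational functions on V.  A twist is a nonzero W-equivariant matrix G over
   K, regular on V_reg, whose columns are horizontal for nabla(k) on tau; its
   columns span the solution space, so that kz_k(tau) is the representation
   sigma appearing in act w G = G sigma(w).

   Twists are obtained by deformation.  For a multiplicity kappa and a scalar
   s, the Dunkl operators with parameter s kappa + k on the values and s kappa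
   on the diagonal action preserve the module of the regular functions all of
   whose iterated local Dunkl derivatives have bounded poles along the
   hyperplanes; integrality of k puts delta^B C^d inside this module.  The
   Euler operator acts on its graded pieces, up to sum_i x_i T_i, by a |W| x |W|
   matrix which is polynomial in s and generically invertible, except in the
   single degree of the common kernel of the T_i.  Hence for almost all s this
   kernel contains a basis of K^d, that is, an intertwiner from nabla(s kappa)
   on some sigma to nabla(s kappa + k) on tau.

   Having no nonzero solution of bounded degree is an open condition on s, so
   intertwiners can be specialised.  With kappa = - k two generic intertwiners
   compose to an endomorphism that specialises to a constant one, whence sigma
   has the dimension of tau.  Specialising at s = 1 and composing with a twist
   for kappa gives kz_k o kz_k' = kz_(k + k'); bijectivity follows. *)

(** On a graded piece the Euler operator has the form q + s Z, where q is the degree plus the scalar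
    by which the residues of nabla(k) sum up. At s = 0 it is the scalar q, so its determinant is a
    nonzero polynomial in s as soon as q is nonzero; this is the source of genericity. Nothing
    guarantees invertibility at s = 1, the value that the composition law needs, which is why
    intertwiners are built for generic s and then specialised. Commutation of the Dunkl operators
    does not enter: a kernel vector is recognised by its degree, since the T_i lower degrees by one
    and the pieces of the module below the kernel degree vanish. Only the flatness of nabla is used,
    and it too comes from homogeneity, a curvature without poles being polynomial of degree -2. The
    constant B bounds n_H |k_{H,i}|. It is both the order of vanishing from which local Dunkl
    derivatives start and the order of the poles that they can reach. Analysis enters only to
    identify the derivative of a rational function with the formal one. *)

Module RationalDerivative.
From mathcomp Require Import boolp classical_sets topology normedtype derive ring.
Set Implicit Arguments.
Unset Strict Implicit.
Unset Printing Implicit Defensive.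
Import GRing.Theory Num.Theory.
Import numFieldNormedType.Exports.
Local Open Scope classical_set_scope.

(** * Differentiating a rational function along a line *)

Section RationalDerivative.
Variables (C : numClosedFieldType) (n d : nat).

Lemma poly_factor0 (p : {poly C}) : p.[0] = 0 -> exists S, p = S * 'X.
Proof. by move/eqP/factor_theorem => [S ->]; exists S; rewrite subr0. Qed.

Lemma horner_continuous (p : {poly C}) : continuous (horner p).
Proof.
move=> t; elim/poly_ind: p => [|p c IH].
  have -> : horner (0 : {poly C}) = fun=> 0 by apply: funext => s; rewrite horner0.
  exact: cst_continuous.
have -> : horner (p * 'X + c%:P) = fun s => p.[s] * s + c.
  by apply: funext => s; rewrite !hornerE.
have h1 : id @ t --> t by exact: cvg_id.
have h2 : (fun _ : C => c) @ t --> c by exact: (cst_continuous).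
exact: (cvgD (cvgM IH h1) h2).
Qed.

Definition dir_der (y : 'cV[C]_n -> 'cV[C]_d) (x xi : 'cV[C]_n) : 'cV[C]_d := 'D_xi y x.

(** The numerator q(0) p_j - p_j(0) q of the difference quotient vanishes at 0. Dividing it by X
    leaves S_j / (q q(0)), which is continuous at 0, and differentiating the division identity gives
    S_j(0). Values of y are prescribed only where q is nonzero, since a solution is constrained only
    on V_reg. *)
Lemma derive_rational (y : 'cV[C]_n -> 'cV[C]_d) (x xi : 'cV[C]_n)
    (p : 'I_d -> {poly C}) (q : {poly C}) : q.[0] != 0 ->
  (forall h, q.[h] != 0 -> y (x + h *: xi) = \col_j ((p j).[h] / q.[h])) ->
  dir_der y x xi = \col_j (((p j)^`().[0] * q.[0] - (p j).[0] * q^`().[0]) / q.[0] ^+ 2).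
Proof.
move=> q0 yE.
have [S SE] : exists S : 'I_d -> {poly C}, forall j, q.[0] *: p j - (p j).[0] *: q = S j * 'X.
  suff h j : exists S : {poly C}, q.[0] *: p j - (p j).[0] *: q = S * 'X.
    by have [S hS] := choice h; exists S.
  by apply: poly_factor0; rewrite hornerD hornerN !hornerZ mulrC subrr.
have S0 j : (S j).[0] = (p j)^`().[0] * q.[0] - (p j).[0] * q^`().[0].
  have := congr1 (fun r : {poly C} => r^`().[0]) (SE j).
  rewrite derivD derivN !derivZ derivM derivX mulr1 !hornerE => <-.
  by rewrite mulrC.
pose F (h : C) : 'cV[C]_d := \sum_j ((S j).[h] / (q.[h] * q.[0])) *: delta_mx j 0.
have -> : \col_j (((p j)^`().[0] * q.[0] - (p j).[0] * q^`().[0]) / q.[0] ^+ 2) = F 0.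
  apply/matrixP => i j; rewrite ord1 mxE summxE (bigD1 i) //= !mxE !eqxx mulr1 S0 expr2.
  by rewrite big1 ?addr0 // => l li; rewrite !mxE eq_sym (negPf li) mulr0.
rewrite /dir_der /derive; apply: cvg_lim; first exact: norm_hausdorff.
have hc (r : {poly C}) : horner r @ (0 : C)^' --> r.[0].
  by apply/continuous_withinNx; apply: horner_continuous.
have nq : \forall h \near (0 : C)^', q.[h] != 0 by apply: cvgr_neq0 (hc q) q0.
apply: (@cvg_trans _ (F @ (0 : C)^')).
  apply: near_eq_cvg; near=> h.
  have h0 : h != 0 by near: h; exact: nbhs_dnbhs_neq.
  have qh : q.[h] != 0 by near: h.
  have -> : (y \o shift x) (h *: xi) = y (x + h *: xi) by rewrite /= addrC.
  have -> : y x = y (x + 0 *: xi) by rewrite scale0r addr0.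
  rewrite !yE // /F; apply/matrixP => i j; rewrite ord1 summxE !mxE (bigD1 i) //= !mxE !eqxx mulr1.
  rewrite big1 ?addr0 => [|l li]; last by rewrite !mxE eq_sym (negPf li) mulr0.
  have := congr1 (fun r : {poly C} => r.[h]) (SE i); rewrite !hornerE => e.
  apply: (mulfI h0); rewrite mulVKf //.
  rewrite mulrA [h * _]mulrC -e.
  by move: q0 qh => q0 qh; field; rewrite q0 qh.
have hS j : (fun h => ((S j).[h] / (q.[h] * q.[0])) *: (delta_mx j 0 : 'cV[C]_d)) @ (0 : C)^' -->
    ((S j).[0] / (q.[0] * q.[0])) *: (delta_mx j 0 : 'cV[C]_d).
  have h2 : (fun _ : C => q.[0]) @ (0 : C)^' --> q.[0].
    by apply/continuous_withinNx; apply: cst_continuous.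
  have qq0 : q.[0] * q.[0] != 0 by rewrite mulf_neq0.
  exact: (cvgZr_tmp (cvgM (hc (S j)) (cvgV qq0 (cvgM (hc q) h2)))).
have h3 : (fun _ : C => (0 : 'cV[C]_d)) @ (0 : C)^' --> (0 : 'cV[C]_d).
  by apply/continuous_withinNx; apply: cst_continuous.
rewrite /F; elim: (index_enum _) => [|j r IH].
  under eq_fun do rewrite big_nil.
  rewrite big_nil; apply: (h3).
under eq_fun do rewrite big_cons.
by rewrite big_cons; exact: (cvgD (hS j) IH).
Unshelve. all: by end_near.
Qed.
End RationalDerivative.

(** Confines the limit that defines derivatives to [dir_der]; the algebraic part evaluates it only
    through [derive_rational]. *)
Lemma KZ_solutionE (C : numClosedFieldType) (gT : finGroupType) (W : {group gT}) n
    (rV : mx_representation C W n) (alpha : {vspace 'cV[C]_n} -> 'Hom('cV[C]_n, C^o))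
    d (tau : mx_representation C W d) k (y : 'cV[C]_n -> 'cV[C]_d) :
  KZ_solution rV alpha tau k y <-> regular_on_Vreg rV alpha y /\
  forall xi x : 'cV[C]_n, x \in Vreg rV ->
    dir_der y x xi + \sum_(H <- hyperplanes rV)
        ((alpha H xi : C) / (alpha H x : C)) *:
        \sum_(i < n_ rV H) ((n_ rV H)%:R * (k H i)%:~R) *: (e_ rV tau H i *m y x) = 0.
Proof. by []. Qed.
End RationalDerivative.

Module KZ.
From mathcomp Require boolp.
From mathcomp Require Import cyclic pgroup mpoly ring zify.
Set Implicit Arguments.
Unset Strict Implicit.
Unset Printing Implicit Defensive.
Import GRing.Theory Num.Theory.
Import RationalDerivative.

(** * The field of rational functions, with substitutions and derivations *)

Module RationalFunctions.

Notation "x %:F" := (@FracField.tofrac _ x).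

Lemma sub_div (F : fieldType) (a b c d : F) : b != 0 -> d != 0 ->
  a / b - c / d = (a * d - c * b) / (b * d).
Proof. by move=> b0 d0; field; rewrite ?b0 ?d0. Qed.

Lemma mul_div (F : fieldType) (a b c d : F) : a / b * (c / d) = (a * c) / (b * d).
Proof. by rewrite invfM mulrACA. Qed.

(** Makes the quotient rule independent of the chosen fraction: the last hypothesis is the
    derivative of a d = c b. *)
Lemma quotient_rule_unique (F : fieldType) (a b c d a' b' c' d' : F) :
  b != 0 -> d != 0 -> a * d = c * b -> a' * d + a * d' = c' * b + c * b' ->
  (c' * d - c * d') / d ^+ 2 = (a' * b - a * b') / b ^+ 2.
Proof.
move=> b0 d0 e1 e2.
have ec : c = a * d / b by rewrite e1 mulfK.
have ec' : c' = (a' * d + a * d' - c * b') / b by rewrite e2 addrK mulfK.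
by rewrite ec' ec; field; rewrite ?b0 ?d0.
Qed.

Lemma quotient_rule_add (F : fieldType) (a b c d a' b' c' d' : F) :
  b != 0 -> d != 0 ->
  ((a' * d + a * d' + (c' * b + c * b')) * (b * d) -
     (a * d + c * b) * (b' * d + b * d')) / (b * d) ^+ 2 =
  (a' * b - a * b') / b ^+ 2 + (c' * d - c * d') / d ^+ 2.
Proof. by move=> b0 d0; field; rewrite ?b0 ?d0. Qed.

Lemma quotient_rule_mul (F : fieldType) (a b c d a' b' c' d' : F) :
  b != 0 -> d != 0 ->
  ((a' * c + a * c') * (b * d) - (a * c) * (b' * d + b * d')) / (b * d) ^+ 2 =
  (a' * b - a * b') / b ^+ 2 * (c / d) + a / b * ((c' * d - c * d') / d ^+ 2).
Proof. by move=> b0 d0; field; rewrite ?b0 ?d0. Qed.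

Lemma add_div (F : fieldType) (a b c d : F) : b != 0 -> d != 0 ->
  a / b + c / d = (a * d + c * b) / (b * d).
Proof. by move=> b0 d0; field; rewrite ?b0 ?d0. Qed.

Section FractionLift.
Variable R : idomainType.
Local Notation K := {fraction R}.

(** Computed on a chosen representative of [f]; independence of that choice, which rests on the
    injectivity of [phi], is [frac_mapE]. *)
Definition frac_map (phi : R -> R) (f : K) : K :=
  (phi (frac (generic_quotient.repr f)).1)%:F / (phi (frac (generic_quotient.repr f)).2)%:F.

Definition frac_der (D : R -> R) (f : K) : K :=
  let a := (frac (generic_quotient.repr f)).1 in let b := (frac (generic_quotient.repr f)).2 in
  ((D a)%:F * b%:F - a%:F * (D b)%:F) / b%:F ^+ 2.

Lemma repr_frac (f : K) :
  f = (frac (generic_quotient.repr f)).1%:F / (frac (generic_quotient.repr f)).2%:F /\ (frac (generic_quotient.repr f)).2 != 0.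
Proof.
split; last exact: denom_ratioP.
have b0 : ((frac (generic_quotient.repr f)).2)%:F != 0 :> K by rewrite tofrac_eq0 denom_ratioP.
apply: (mulIf b0); rewrite divfK //.
rewrite -{1}(reprK f).
unlock FracField.tofrac; rewrite -[LHS]FracField.pi_mul.
apply/eqmodP; rewrite /= FracField.equivfE /FracField.mulf.
by rewrite !numden_Ratio ?mulr1 ?oner_eq0 ?denom_ratioP // mulrC.
Qed.

Lemma tofrac_div_eq (a b c d : R) : b != 0 -> d != 0 ->
  a%:F / b%:F = c%:F / d%:F :> K -> a * d = c * b.
Proof.
move=> b0 d0 /eqP; rewrite eqr_div ?tofrac_eq0 // -!tofracM tofrac_eq => /eqP.
by [].
Qed.

Lemma fracP (f : K) : exists a b : R, b != 0 /\ f = a%:F / b%:F.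
Proof.
by have [e b0] := repr_frac f; exists (frac (generic_quotient.repr f)).1, (frac (generic_quotient.repr f)).2.
Qed.

Section Map.
Variable phi : {rmorphism R -> R}.
Hypothesis phi_inj : injective phi.

Let phi_neq0 b : b != 0 -> (phi b)%:F != 0 :> K.
Proof. by move=> b0; rewrite tofrac_eq0 -(rmorph0 phi) (inj_eq phi_inj). Qed.

Lemma frac_mapE a b : b != 0 -> frac_map phi (a%:F / b%:F) = (phi a)%:F / (phi b)%:F.
Proof.
move=> b0; rewrite /frac_map; case: (repr_frac (a%:F / b%:F)) => e c0.
have := tofrac_div_eq b0 c0 e => {}e.
apply/eqP; rewrite eqr_div ?phi_neq0 // -!tofracM -!rmorphM e.
by [].
Qed.

Lemma frac_map_tofrac a : frac_map phi a%:F = (phi a)%:F.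
Proof.
by have := frac_mapE a (oner_neq0 R); rewrite !rmorph1 !divr1.
Qed.

Lemma frac_map_zmod : zmod_morphism (frac_map phi).
Proof.
move=> f g; have [a [b [b0 ->]]] := fracP f; have [c [d [d0 ->]]] := fracP g.
rewrite sub_div ?tofrac_eq0 // -!tofracM -tofracB.
rewrite !frac_mapE ?mulf_neq0 // sub_div ?phi_neq0 //.
by rewrite -!tofracM -tofracB -!rmorphM -rmorphB.
Qed.

Lemma frac_map_monoid : monoid_morphism (frac_map phi).
Proof.
split; first by rewrite -tofrac1 frac_map_tofrac rmorph1.
move=> f g; have [a [b [b0 ->]]] := fracP f; have [c [d [d0 ->]]] := fracP g.
rewrite mul_div -!tofracM !frac_mapE ?mulf_neq0 // mul_div.
by rewrite -!tofracM -!rmorphM.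
Qed.

End Map.

Section Der.
Variable D : R -> R.
Hypothesis DD : {morph D : x y / x + y}.
Hypothesis DM : forall x y, D (x * y) = D x * y + x * D y.

Lemma frac_derE a b : b != 0 ->
  frac_der D (a%:F / b%:F) = ((D a)%:F * b%:F - a%:F * (D b)%:F) / b%:F ^+ 2.
Proof.
move=> b0; rewrite /frac_der; case: (repr_frac (a%:F / b%:F)).
move: (frac (generic_quotient.repr _)).1 (frac (generic_quotient.repr _)).2 => c d e d0.
have e1 := tofrac_div_eq b0 d0 e.
have e2 : D a * d + a * D d = D c * b + c * D b by rewrite -!DM e1.
apply: quotient_rule_unique; rewrite ?tofrac_eq0 -?tofracM -?tofracD ?e1 ?e2 //.
Qed.

Lemma der1 : D 1 = 0.
Proof. by apply: (addIr (D 1)); rewrite add0r -[in RHS](mul1r 1) DM !mulr1 mul1r. Qed.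

Lemma frac_der_tofrac a : frac_der D a%:F = (D a)%:F.
Proof.
have := frac_derE a (oner_neq0 R).
by rewrite tofrac1 divr1 der1 tofrac0 mulr0 subr0 mulr1 expr1n divr1.
Qed.

Lemma frac_derD : {morph frac_der D : f g / f + g}.
Proof.
move=> f g; have [a [b [b0 ->]]] := fracP f; have [c [d [d0 ->]]] := fracP g.
rewrite add_div ?tofrac_eq0 // -!tofracM -tofracD.
rewrite !frac_derE ?mulf_neq0 // !(DD, DM) !(tofracM, tofracD).
by rewrite quotient_rule_add ?tofrac_eq0.
Qed.

Lemma frac_derM f g : frac_der D (f * g) = frac_der D f * g + f * frac_der D g.
Proof.
have [a [b [b0 ->]]] := fracP f; have [c [d [d0 ->]]] := fracP g.
rewrite mul_div -!tofracM.
rewrite !frac_derE ?mulf_neq0 // !(DD, DM) !(tofracM, tofracD).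
by rewrite quotient_rule_mul ?tofrac_eq0.
Qed.

End Der.

End FractionLift.

Section FractionMorphism.
Variables (R : idomainType) (phi : {rmorphism R -> R}) (phi_inj : injective phi).

(** The injectivity proof is an argument because only injective morphisms extend to fractions; the
    ring morphism structure attaches to this applied form. *)
Definition frac_rmorph of injective phi := frac_map phi.

HB.instance Definition _ := GRing.isZmodMorphism.Build {fraction R} {fraction R}
  (frac_rmorph phi_inj) (frac_map_zmod phi_inj).
HB.instance Definition _ := GRing.isMonoidMorphism.Build {fraction R} {fraction R}
  (frac_rmorph phi_inj) (frac_map_monoid phi_inj).

End FractionMorphism.

Section PolynomialCalculus.
Variables (C : numFieldType) (n : nat).
Local Notation S := {mpoly C[n]}.
Implicit Types (A B : 'M[C]_n) (xi eta x : 'cV[C]_n) (P Q : S).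

Lemma mpoly_alg_ind (Pr : S -> Prop) :
  (forall c, Pr c%:MP) -> (forall i, Pr 'X_i) ->
  (forall P Q, Pr P -> Pr Q -> Pr (P + Q)) ->
  (forall P Q, Pr P -> Pr Q -> Pr (P * Q)) -> forall P, Pr P.
Proof.
move=> hC hX hD hM; have h1 : Pr 1 by rewrite -mpolyC1; apply: hC.
have hXe i e : Pr ('X_i ^+ e).
  by elim: e => [|e IH]; rewrite ?expr0 // exprS; apply: hM.
have hXm m : Pr 'X_[m] by rewrite mpolyXE_id; apply: (big_ind Pr).
elim/mpolyind => [|c m P _ _ IH]; first by rewrite -mpolyC0; apply: hC.
by apply: hD => //; rewrite -mul_mpolyC; apply: hM.
Qed.

Lemma rmorph_mpoly_ext (L : comNzRingType) (f g : {rmorphism S -> L}) :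
  (forall c, f c%:MP = g c%:MP) -> (forall i, f 'X_i = g 'X_i) -> f =1 g.
Proof.
move=> hC hX; apply: mpoly_alg_ind => // P Q eP eQ; first by rewrite !rmorphD eP eQ.
by rewrite !rmorphM eP eQ.
Qed.

Definition subst A : S -> S := comp_mpoly [tuple \sum_j A i j *: 'X_j | i < n].
HB.instance Definition _ A := GRing.RMorphism.on (subst A).

Lemma substC A c : subst A c%:MP = c%:MP.
Proof. exact: comp_mpolyC. Qed.

Lemma substZ A c P : subst A (c *: P) = c *: subst A P.
Proof. exact: comp_mpolyZ. Qed.

Lemma substX A i : subst A 'X_i = \sum_j A i j *: 'X_j.
Proof. by rewrite /subst comp_mpolyXU -tnth_nth tnth_mktuple. Qed.

Lemma subst_comp A B P : subst A (subst B P) = subst (B *m A) P.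
Proof.
move: P; apply: (rmorph_mpoly_ext (f := subst A \o subst B)) => [c|i] /=.
  by rewrite !substC.
rewrite !substX rmorph_sum /=.
under eq_bigr => j _ do rewrite substZ substX scaler_sumr.
rewrite exchange_big /=; apply: eq_bigr => k _.
by rewrite mxE scaler_suml; apply: eq_bigr => j _; rewrite scalerA.
Qed.

Lemma subst1 P : subst 1%:M P = P.
Proof.
move: P; apply: (rmorph_mpoly_ext (g := idfun)) => [c|i] /=; first exact: substC.
rewrite substX (bigD1 i) //= mxE eqxx scale1r big1 ?addr0 // => j ji.
by rewrite mxE eq_sym (negPf ji) scale0r.
Qed.

Lemma subst_inj A : A \in unitmx -> injective (subst A).
Proof.
by move=> uA; apply: (can_inj (g := subst (invmx A))) => P;
  rewrite subst_comp mulmxV // subst1.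
Qed.

Lemma meval_subst A P x :
  (subst A P).@[fun i => x i 0] = P.@[fun i => (A *m x) i 0].
Proof.
rewrite comp_mpoly_meval; apply: meval_eq => i.
rewrite tnth_mktuple raddf_sum mxE /=; apply: eq_bigr => j _.
by rewrite mevalZ mevalXU.
Qed.

Definition pder xi P : S := \sum_i xi i 0 *: P^`M(i).

Lemma pderD xi : {morph pder xi : P Q / P + Q}.
Proof.
by move=> P Q; rewrite /pder -big_split; apply: eq_bigr => i _; rewrite mderivD scalerDr.
Qed.

Lemma pderM xi P Q : pder xi (P * Q) = pder xi P * Q + P * pder xi Q.
Proof.
rewrite /pder mulr_suml mulr_sumr -big_split; apply: eq_bigr => i _ /=.
by rewrite mderivM scalerDr scalerAl scalerAr.
Qed.

Lemma pderC xi c : pder xi c%:MP = 0.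
Proof. by rewrite /pder big1 // => i _; rewrite mderivC scaler0. Qed.

Lemma pderX xi i : pder xi 'X_i = (xi i 0)%:MP.
Proof.
rewrite /pder (bigD1 i) //= big1 => [|j ji]; rewrite mderivX mnm1E.
  have -> : (U_(i) - U_(i))%MM = 0%MM :> 'X_{1..n}.
    by apply/mnmP => k; rewrite mnmBE subnn mnm0E.
  by rewrite eqxx scale1r addr0 mpolyX0 -mul_mpolyC mulr1.
by rewrite eq_sym (negPf ji) scale0r scaler0.
Qed.

Lemma pder_comm xi eta P : pder xi (pder eta P) = pder eta (pder xi P).
Proof.
have pderE z Q : pder z Q = \sum_i z i 0 *: Q^`M(i) by [].
have e (z t : 'cV[C]_n) : pder z (pder t P) =
    \sum_i \sum_j (z i 0 * t j 0) *: P^`M(j)^`M(i).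
  rewrite pderE; apply: eq_bigr => i _.
  rewrite pderE (raddf_sum (mderiv i)) scaler_sumr; apply: eq_bigr => j _ /=.
  by rewrite linearZ scalerA.
rewrite !e exchange_big /=; apply: eq_bigr => j _; apply: eq_bigr => i _.
by rewrite mderiv_comm mulrC.
Qed.

Lemma pder_lin (a : C) xi eta P : pder (a *: xi + eta) P = a *: pder xi P + pder eta P.
Proof.
rewrite /pder scaler_sumr -big_split; apply: eq_bigr => i _ /=.
by rewrite !mxE scalerDl scalerA.
Qed.

Lemma pder_subst A xi P : pder xi (subst A P) = subst A (pder (A *m xi) P).
Proof.
move: P; apply: mpoly_alg_ind => [c|i|P Q eP eQ|P Q eP eQ].
- by rewrite substC !pderC rmorph0.
- rewrite substX pderX substC mxE raddf_sum /=.
  rewrite (big_morph _ (pderD xi) (id1 := 0)); last by rewrite -mpolyC0 pderC.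
  apply: eq_bigr => j _.
  by rewrite -mul_mpolyC pderM pderC mul0r add0r pderX mpolyCM.
- by rewrite rmorphD !pderD eP eQ rmorphD.
- by rewrite rmorphM !pderM eP eQ rmorphD !rmorphM.
Qed.

End PolynomialCalculus.

(* [sK A] is the substitution f |-> f o A and [dK xi] the derivative along xi. *)
Record ratfield (C : numFieldType) (n : nat) := Ratfield {
  rat_sort :> fieldType;
  toK : {rmorphism {mpoly C[n]} -> rat_sort};
  toK_eq0 : forall P, (toK P == 0) = (P == 0);
  toK_frac : forall f : rat_sort, exists P Q, Q != 0 /\ f = toK P / toK Q;
  sK : 'M[C]_n -> {rmorphism rat_sort -> rat_sort};
  sKE : forall A P, A \in unitmx -> sK A (toK P) = toK (subst A P);
  dK : 'cV[C]_n -> rat_sort -> rat_sort;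
  dKD : forall xi, {morph dK xi : f g / f + g};
  dKM : forall xi f g, dK xi (f * g) = dK xi f * g + f * dK xi g;
  dKE : forall xi P, dK xi (toK P) = toK (pder xi P) }.

Arguments toK {C n} r.
Arguments sK {C n} r A.
Arguments dK {C n} r xi f.

Section RatfieldExists.
Variables (C : numFieldType) (n : nat).

(** Composition with a singular matrix kills some denominators and does not extend to fractions; the
    identity is the default value there. *)
Definition subst_frac (A : 'M[C]_n) : {rmorphism {fraction {mpoly C[n]}} -> {fraction {mpoly C[n]}}} :=
  if (A \in unitmx) =P true is ReflectT uA then frac_rmorph (subst_inj uA) else idfun.

Lemma subst_fracE A P : A \in unitmx -> subst_frac A P%:F = (subst A P)%:F.
Proof.
rewrite /subst_frac; case: eqP => // uA _.
exact: (frac_map_tofrac (subst_inj uA)).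
Qed.

Lemma ratfield_exists : ratfield C n.
Proof.
exact (@Ratfield C n {fraction {mpoly C[n]}} (@FracField.tofrac {mpoly C[n]}) (@tofrac_eq0 {mpoly C[n]}) (@fracP {mpoly C[n]}) subst_frac subst_fracE _
  (fun xi => frac_derD (@pderD C n xi) (@pderM C n xi))
  (fun xi => frac_derM (@pderM C n xi))
  (fun xi => frac_der_tofrac (@pderM C n xi))).
Qed.

End RatfieldExists.

End RationalFunctions.
Import RationalFunctions.

(** * Reflection hyperplanes and their pointwise stabilizers *)

Module Hyperplanes.

(** The two block matrices have a triangular product in either order, and both products have the
    same determinant. *)
Lemma det_rank1_update (F : fieldType) n (u : 'cV[F]_n) (l : 'rV[F]_n) :
  \det (1%:M + u *m l) = 1 + (l *m u) 0 0.
Proof.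
pose M : 'M[F]_(1 + n) := block_mx 1%:M l (- u) 1%:M.
pose L : 'M[F]_(1 + n) := block_mx 1%:M 0 u 1%:M.
have dL : \det L = 1 by rewrite det_lblock !det1 mulr1.
have e1 : L *m M = block_mx 1%:M l 0 (1%:M + u *m l).
  rewrite mulmx_block !mul1mx !mul0mx !mulmx1 !addr0; congr block_mx => //.
    by rewrite addrN.
  by rewrite addrC.
have e2 : M *m L = block_mx (1%:M + l *m u) l 0 1%:M.
  rewrite mulmx_block !mulmx1 !mulmx0 !mul1mx !add0r; congr block_mx => //.
  by rewrite addNr.
have /(congr1 determinant) := e1; rewrite det_ublock det1 mul1r => <-.
rewrite det_mulmx mulrC -det_mulmx e2 det_ublock det1 mulr1.
by rewrite det_mx11 !mxE eqxx.
Qed.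

Section Geometry.
Variables (C : numClosedFieldType) (gT : finGroupType) (W : {group gT}).
Variables (n : nat) (rV : mx_representation C W n).
Variable alpha : {vspace 'cV[C]_n} -> 'Hom('cV[C]_n, C^o).
Hypothesis faithful : mx_faithful rV.
Hypothesis formsP : is_hyperplane_forms rV alpha.

Implicit Types (H : {vspace 'cV[C]_n}) (w g : gT) (x xi : 'cV[C]_n).

Local Notation hyps := (hyperplanes rV).

Lemma act_lfunE w x : act_lfun rV w x = rV w *m x.
Proof. by rewrite lfunE. Qed.

Lemma rVK w x : w \in W -> rV w^-1%g *m (rV w *m x) = x.
Proof. by move=> wW; rewrite mulmxA -repr_mxM ?groupV // mulVg repr_mx1 mul1mx. Qed.

Lemma rVKV w x : w \in W -> rV w *m (rV w^-1%g *m x) = x.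
Proof. by move=> wW; rewrite mulmxA -repr_mxM ?groupV // mulgV repr_mx1 mul1mx. Qed.

Lemma mem_fixedSpace w x : (x \in fixedSpace (act_lfun rV w)) = (rV w *m x == x).
Proof. by rewrite -act_lfunE; apply/fixedSpaceP/eqP. Qed.

Lemma hyps_uniq : uniq hyps. Proof. exact: undup_uniq. Qed.

Lemma hypsP H :
  reflect (exists2 w, w \in reflections rV & H = fixedSpace (act_lfun rV w)) (H \in hyps).
Proof.
rewrite mem_undup; apply: (iffP mapP) => [] [w wR ->]; exists w => //.
  by rewrite mem_enum in wR.
by rewrite mem_enum.
Qed.

Lemma hyps_dim H : H \in hyps -> (\dim H).+1 = n.
Proof. by case/hypsP => w; rewrite inE => /andP[_ /eqP e] ->. Qed.

Lemma mem_hyp H x : H \in hyps -> (x \in H) = (alpha H x == 0).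
Proof. by move=> HH; rewrite -{1}(formsP HH) memv_ker. Qed.

Lemma alpha_neq0 H : H \in hyps -> exists x, alpha H x = 1.
Proof.
move=> HH; have [i /= ai|a0] := pickP [pred i | alpha H (delta_mx i 0) != 0 :> C].
  exists ((alpha H (delta_mx i 0))^-1 *: delta_mx i 0).
  by rewrite linearZ /=; apply: mulVf.
have HT : forall x, x \in H.
  move=> x'; rewrite mem_hyp //; have -> : x' = \sum_i x' i 0 *: delta_mx i 0.
    by rewrite {1}[x']matrix_sum_delta; apply: eq_bigr => i _; rewrite big_ord1.
  rewrite linear_sum big1 // => i _; rewrite linearZ /=.
  by have /negbFE/eqP -> := a0 i; rewrite scaler0.
have HE : H = fullv by apply/vspaceP => v; rewrite HT memvf.
by have := hyps_dim HH; rewrite HE dimvf /dim /= muln1 => /eqP; rewrite eqn_leq ltnn.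
Qed.

Lemma forms_proportional H H' (f : 'cV[C]_n -> C) :
  H \in hyps -> (forall a x y, f (a *: x + y) = a * f x + f y) ->
  (forall x, x \in H -> f x = 0) -> exists c, forall x, f x = c * alpha H x.
Proof.
move=> HH fl fH; have [v av] := alpha_neq0 HH; exists (f v) => x.
have : x - alpha H x *: v \in H.
  by rewrite mem_hyp // linearB linearZ /= av /GRing.scale /= mulr1 subrr.
move/fH; rewrite addrC -scaleNr fl mulNr mulrC addrC => /eqP.
by rewrite subr_eq0 => /eqP.
Qed.

Lemma hyps_incl H H' : H \in hyps -> H' \in hyps ->
  (forall x, x \in H -> alpha H' x = 0) -> H = H'.
Proof.
move=> HH HH' i; apply/eqP; rewrite eqEdim; apply/andP; split.
  by apply/subvP => x xH; rewrite mem_hyp // i.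
by have [->] := etrans (hyps_dim HH) (esym (hyps_dim HH')).
Qed.

Definition hmove w H := (act_lfun rV w @: H)%VS.

Lemma hmoveP w H x : w \in W -> (x \in hmove w H) = (rV w^-1%g *m x \in H).
Proof.
move=> wW; apply/memv_imgP/idP => [[y yH ->]|xH]; first by rewrite act_lfunE rVK.
by exists (rV w^-1%g *m x) => //; rewrite act_lfunE rVKV.
Qed.

Lemma hmoveM w g H : w \in W -> g \in W -> hmove (w * g)%g H = hmove w (hmove g H).
Proof.
move=> wW gW; apply/vspaceP => x; rewrite !hmoveP ?groupM //.
by rewrite invMg repr_mxM ?groupV // mulmxA.
Qed.

Lemma hmove1 H : hmove 1%g H = H.
Proof. by apply/vspaceP => x; rewrite hmoveP // invg1 repr_mx1 mul1mx. Qed.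

Lemma fixedSpace_conj w g : w \in W -> g \in W ->
  fixedSpace (act_lfun rV (w ^ g)%g) = hmove g^-1%g (fixedSpace (act_lfun rV w)).
Proof.
move=> wW gW; have gV : (g^-1)%g \in W by rewrite groupV.
apply/vspaceP => x; rewrite (hmoveP _ _ gV) invgK !mem_fixedSpace.
rewrite conjgE !repr_mxM ?groupV ?groupM // -!mulmxA.
apply/eqP/eqP => [e|->]; last by rewrite rVK.
by rewrite -{2}e rVKV.
Qed.

Lemma hmove_dim w H : w \in W -> \dim (hmove w H) = \dim H.
Proof.
move=> wW; apply: limg_dim_eq; apply/vspaceP => x; rewrite memv0 memv_cap memv_ker.
rewrite act_lfunE; apply/idP/idP => [/andP[_ /eqP e]|/eqP ->]; last first.
  by rewrite mem0v mulmx0 eqxx.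
by rewrite -(rVK x wW) e mulmx0.
Qed.

Lemma hmove_hyps w H : w \in W -> H \in hyps -> hmove w H \in hyps.
Proof.
move=> wW /hypsP[g]; rewrite inE => /andP[gW rg] ->; apply/hypsP.
have wV : (w^-1)%g \in W by rewrite groupV.
have e := fixedSpace_conj gW wV; rewrite invgK in e.
exists (g ^ w^-1)%g; last by rewrite e.
by apply/setIdP; split; [exact: groupJ | rewrite /is_reflection e hmove_dim].
Qed.

Lemma hmove_perm w : w \in W -> perm_eq [seq hmove w H | H <- hyps] hyps.
Proof.
move=> wW.
have inj : {in hyps &, injective (hmove w)}.
  move=> H H' _ _ e; rewrite -[H]hmove1 -[H']hmove1 -(mulVg w).
  by rewrite !hmoveM ?groupV // e.
apply: uniq_perm; rewrite ?map_inj_in_uniq ?hyps_uniq // => H.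
apply/mapP/idP => [[H' HH ->]|HH]; first exact: hmove_hyps.
exists (hmove w^-1%g H); first by rewrite hmove_hyps ?groupV.
by rewrite -hmoveM ?groupV // mulgV hmove1.
Qed.

Lemma hmove_sum (M : nmodType) (F : {vspace 'cV[C]_n} -> M) w : w \in W ->
  \sum_(H <- hyps) F (hmove w H) = \sum_(H <- hyps) F H.
Proof.
by move=> wW; rewrite -(big_map (hmove w) predT F); apply: perm_big; apply: hmove_perm.
Qed.

(** The forms are chosen separately for each hyperplane, so W permutes them only up to nonzero
    factors. *)
Lemma alpha_hmove w H : w \in W -> H \in hyps ->
  exists2 c, c != 0 & forall x, alpha H (rV w^-1%g *m x) = c * alpha (hmove w H) x.
Proof.
move=> wW HH; have HH' := hmove_hyps wW HH.
have [|x xH|c cE] := forms_proportional H (f := fun x => alpha H (rV w^-1%g *m x)) HH'.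
- by move=> a x y; rewrite mulmxDr -scalemxAr linearP.
- by apply/eqP; rewrite -mem_hyp // -hmoveP.
exists c => //; apply/eqP => c0; have [x ax] := alpha_neq0 HH.
have := cE (rV w *m x); rewrite c0 mul0r rVK // ax; apply/eqP/oner_neq0.
Qed.

Lemma pt_stabP H w :
  reflect (w \in W /\ forall x, x \in H -> rV w *m x = x) (w \in pt_stab rV H).
Proof.
rewrite inE; apply: (iffP andP) => [] [wW] h; split=> //.
  by move=> x /(subvP h); rewrite mem_fixedSpace => /eqP.
by apply/subvP => x xH; rewrite mem_fixedSpace h.
Qed.

Lemma pt_stab_group_set H : group_set (pt_stab rV H).
Proof.
apply/group_setP; split=> [|g h /pt_stabP[gW gH] /pt_stabP[hW hH]].
  by apply/pt_stabP; split=> // x _; rewrite repr_mx1 mul1mx.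
apply/pt_stabP; split=> [|x xH]; first exact: groupM.
by rewrite repr_mxM // -mulmxA hH // gH.
Qed.
Canonical pt_stab_group H := Group (pt_stab_group_set H).

Lemma pt_stab_sub H w : w \in pt_stab rV H -> w \in W.
Proof. by case/pt_stabP. Qed.

Lemma n_gt0 H : (0 < n_ rV H)%N. Proof. exact: cardG_gt0. Qed.

Lemma pt_stab_hmove g H w : g \in W ->
  ((w ^ g^-1)%g \in pt_stab rV (hmove g H)) = (w \in pt_stab rV H).
Proof.
move=> gW.
have half g' w' H' : g' \in W -> w' \in pt_stab rV H' ->
    (w' ^ g'^-1)%g \in pt_stab rV (hmove g' H').
  move=> g'W /pt_stabP[wW h]; apply/pt_stabP; split=> [|x]; first by rewrite groupJ ?groupV.
  rewrite hmoveP // => xH; rewrite conjgE invgK !repr_mxM ?groupM ?groupV //.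
  by rewrite -!mulmxA h // rVKV.
apply/idP/idP; last exact: half.
move/(half g^-1%g); rewrite groupV => /(_ gW).
by rewrite invgK conjgKV -hmoveM ?groupV // mulVg hmove1.
Qed.

Lemma n_hmove g H : g \in W -> n_ rV (hmove g H) = n_ rV H.
Proof.
move=> gW; rewrite /n_ -(card_imset (pt_stab rV H) (conjg_inj g^-1%g)).
congr #|pred_of_set _|; apply/setP => w.
rewrite -[w](conjgK g) (pt_stab_hmove H (w ^ g) gW).
by rewrite (mem_imset (pt_stab rV H) (w ^ g)%g (conjg_inj g^-1%g)).
Qed.

Lemma det_conj g w : g \in W -> w \in W -> \det (rV (w ^ g)%g) = \det (rV w).
Proof.
move=> gW wW; rewrite conjgE !repr_mxM ?groupV ?groupM // !det_mulmx mulrCA mulrA.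
rewrite -mulrA -[in RHS](mulr1 (\det (rV w))); congr (_ * _).
by rewrite -det_mulmx -repr_mxM ?groupV // mulVg repr_mx1 det1.
Qed.

(** w - 1 vanishes on H, hence factors through alpha_H; w is then a rank one update of the
    identity. *)
Lemma pt_stab_rank1 H w : H \in hyps -> w \in pt_stab rV H ->
  exists2 u : 'cV[C]_n, (forall x, rV w *m x = x + alpha H x *: u) &
    \det (rV w) = 1 + alpha H u.
Proof.
move=> HH /pt_stabP[wW wH]; have [v av] := alpha_neq0 HH.
pose u := rV w *m v - v; pose l : 'rV[C]_n := \row_j alpha H (delta_mx j 0).
have lE x : (l *m x) = (alpha H x)%:M.
  apply/matrixP => i j; rewrite !ord1 !mxE eqxx mulr1n.
  rewrite [X in alpha H X](_ : x = \sum_i x i 0 *: delta_mx i 0); last first.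
    by rewrite {1}[x]matrix_sum_delta; apply: eq_bigr => k _; rewrite big_ord1.
  rewrite linear_sum; apply: eq_bigr => k _; rewrite linearZ /= !mxE.
  by rewrite mulrC.
have uE x : rV w *m x = x + alpha H x *: u.
  have : x - alpha H x *: v \in H.
    by rewrite mem_hyp // linearB linearZ /= av /GRing.scale /= mulr1 subrr.
  move/wH; rewrite mulmxBr -scalemxAr scalerBr => /eqP.
  by rewrite subr_eq => /eqP ->; rewrite addrA addrAC.
exists u => //; have -> : rV w = 1%:M + u *m l.
  apply/matrixP => i j; have := congr1 (fun M : 'cV_n => M i 0) (uE (delta_mx j 0)).
  rewrite -colE mxE => ->; rewrite !mxE big_ord1 !mxE eqxx andbT; congr (_ + _).
  by rewrite mulrC.
by rewrite det_rank1_update lE mxE eqxx mulr1n.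
Qed.

Lemma alpha_det H w x : H \in hyps -> w \in pt_stab rV H ->
  alpha H (rV w *m x) = \det (rV w) * alpha H x.
Proof.
move=> HH wH; have [u uE ->] := pt_stab_rank1 HH wH.
by rewrite uE linearD linearZ /= mulrDl mul1r [_ *: _]mulrC.
Qed.

(** Excludes transvections: if det w = 1 then alpha_H(u) = 0, so w^k x = x + k alpha_H(x) u, and
    taking for k the order of w forces u = 0 in characteristic zero. *)
Lemma det_pt_stab_inj H w : H \in hyps -> w \in pt_stab rV H ->
  \det (rV w) = 1 -> w = 1%g.
Proof.
move=> HH wH; have [u uE ->] := pt_stab_rank1 HH wH => /eqP.
rewrite -[X in _ == X]addr0 (inj_eq (addrI _)) => /eqP au.
have wW := pt_stab_sub wH.
have wk k x : rV (w ^+ k)%g *m x = x + (k%:R * alpha H x) *: u.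
  elim: k x => [|k IH] x; first by rewrite expg0 repr_mx1 mul1mx mul0r scale0r addr0.
  rewrite expgS repr_mxM ?groupX // -mulmxA IH uE linearD linearZ /= au scaler0 addr0.
  by rewrite -addrA -scalerDl -natr1 mulrDl mul1r.
have u0 : u = 0.
  have [v av] := alpha_neq0 HH; have := wk #[w]%g v; rewrite expg_order repr_mx1 mul1mx.
  move=> /eqP; rewrite -{1}[v]addr0 (inj_eq (addrI _)) av mulr1 eq_sym scaler_eq0.
  by rewrite pnatr_eq0 eqn0Ngt order_gt0 => /eqP.
apply/set1gP; apply: (subsetP faithful); apply/rkerP; split=> //.
apply/matrixP => i j; have := congr1 (fun M : 'cV_n => M i 0) (uE (delta_mx j 0)).
by rewrite u0 scaler0 addr0 -colE !mxE eqxx andbT.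
Qed.

Lemma det_neq0 w : w \in W -> \det (rV w) != 0.
Proof. by move=> wW; rewrite -unitfE -unitmxE repr_mx_unit. Qed.

Lemma det_order H w : w \in pt_stab rV H -> \det (rV w) ^+ n_ rV H = 1.
Proof.
move=> wH; have wW := pt_stab_sub wH.
have dX k : \det (rV w) ^+ k = \det (rV (w ^+ k)%g).
  elim: k => [|k IH]; first by rewrite expr0 expg0 repr_mx1 det1.
  by rewrite exprS expgS repr_mxM ?groupX // det_mulmx IH.
by rewrite dX /n_ (expg_cardG wH) // repr_mx1 det1.
Qed.

(** Orthogonality for the powers of det on W_H. A value det(w0)^m other than 1 kills the sum by
    translation. Otherwise the n_H numbers det(w), distinct by [det_pt_stab_inj], are all roots of
    X^r - 1 with r the remainder of m modulo n_H, which is too many when r > 0. *)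
Lemma det_sum H (m : int) : H \in hyps ->
  \sum_(w in pt_stab rV H) \det (rV w) ^ m = if (n_ rV H %| m)%Z then (n_ rV H)%:R else 0.
Proof.
move=> HH; case: ifPn => [/dvdzP[q ->]|ndvd].
  rewrite (eq_bigr (fun=> 1)) => [|w wH]; first by rewrite sumr_const.
  by rewrite mulrC -exprz_exp -exprnP det_order // exp1rz.
have [/exists_inP[w0 w0H d0]|] := boolP [exists w in pt_stab rV H, \det (rV w) ^ m != 1].
  apply/eqP; have := d0; rewrite -subr_eq0 => d0'; rewrite -(mulrI_eq0 _ (mulfI d0')).
  rewrite mulrBl mul1r subr_eq0; apply/eqP.
  rewrite [RHS](reindex_inj (mulgI w0)) mulr_sumr /=; apply: eq_big => [w|w wH].
    by rewrite groupMl.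
  rewrite repr_mxM ?(pt_stab_sub wH) ?(pt_stab_sub w0H) // det_mulmx.
  by rewrite expfzMl.
rewrite negb_exists_in => /forall_inP h.
have ng := n_gt0 H; pose r := `|(m %% n_ rV H)%Z|%N.
have rE : r%:Z = (m %% n_ rV H)%Z.
  by rewrite /r gez0_abs // modz_ge0 // lt0r_neq0.
have r0 : (0 < r)%N.
  by rewrite lt0n; apply: contra ndvd => /eqP r0; apply/dvdz_mod0P; rewrite -rE r0.
have rn : (r < n_ rV H)%N by rewrite -ltz_nat rE ltz_pmod.
have dr w : w \in pt_stab rV H -> \det (rV w) ^+ r = 1.
  move=> wH; have /negPn/eqP := h w wH; rewrite {1}(divz_eq m (n_ rV H)).
  rewrite expfzDr ?det_neq0 ?(pt_stab_sub wH) // mulrC [_ * Posz _]mulrC -exprz_exp.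
  by rewrite -exprnP det_order // exp1rz mulr1 -rE.
have : (size [seq \det (rV w) | w <- enum (pt_stab rV H)] <= r)%N.
  apply: max_unity_roots => //.
    apply/allP => z /mapP[w]; rewrite mem_enum => wH ->; apply/unity_rootP.
    exact: dr.
  rewrite map_inj_in_uniq ?enum_uniq // => w w'; rewrite !mem_enum => wH w'H e.
  have := det_pt_stab_inj HH (groupM (groupVr wH) w'H); rewrite repr_mxM; last 2 first.
  - exact: pt_stab_sub (groupVr wH).
  - exact: pt_stab_sub w'H.
  rewrite det_mulmx -e -det_mulmx -repr_mxM ?groupV ?(pt_stab_sub wH) //.
  rewrite mulVg repr_mx1 det1 => /(_ erefl) ww.
by rewrite -[w']mul1g -(mulgV w) -mulgA ww mulg1.
by rewrite size_map -cardE leqNgt rn.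
Qed.

Lemma det_sum_dual H w : H \in hyps -> w \in pt_stab rV H ->
  \sum_(j < n_ rV H) \det (rV w) ^- j = if w == 1%g then (n_ rV H)%:R else 0.
Proof.
move=> HH wH; case: ifPn => [/eqP ->|w1].
  rewrite (eq_bigr (fun=> 1)) => [|j _]; first by rewrite sumr_const card_ord.
  by rewrite repr_mx1 det1 expr1n invr1.
have d1 : (\det (rV w))^-1 - 1 != 0.
  rewrite subr_eq0; apply: contra w1 => /eqP e; apply/eqP/(det_pt_stab_inj HH) => //.
  by rewrite -[LHS]invrK e invr1.
apply: (mulfI d1); rewrite mulr0.
under eq_bigr => j _ do rewrite -exprVn.
by rewrite -subrX1 exprVn det_order // invr1 subrr.
Qed.

(** Projecting a vector with alpha_H = 1 onto the det-isotypic part of V leaves its value under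
    alpha_H unchanged, by [alpha_det]. *)
Lemma eigenvector_exists H : H \in hyps ->
  exists2 v, alpha H v = 1 & forall w, w \in pt_stab rV H -> rV w *m v = \det (rV w) *: v.
Proof.
move=> HH; have [v0 a0] := alpha_neq0 HH.
pose N := (n_ rV H)%:R : C; have N0 : N != 0 by rewrite pnatr_eq0 -lt0n n_gt0.
pose v := N^-1 *: \sum_(w in pt_stab rV H) (\det (rV w))^-1 *: (rV w *m v0).
exists v => [|g gH].
  rewrite linearZ linear_sum /= (eq_bigr (fun=> 1)) => [|w wH].
    by rewrite sumr_const; apply: mulVf.
  rewrite linearZ /= alpha_det // a0 mulr1; apply: mulVf.
  by rewrite det_neq0 // (pt_stab_sub wH).
rewrite -scalemxAr scalerA mulrC -scalerA; congr (_ *: _).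
rewrite mulmx_sumr scaler_sumr [RHS](reindex_inj (mulgI g)) /=.
apply: eq_big => [w|w wH]; first by rewrite groupMl.
have gW := pt_stab_sub gH; have wW := pt_stab_sub wH.
rewrite -scalemxAr mulmxA repr_mxM // det_mulmx scalerA invfM mulrA mulfV ?mul1r //.
exact: det_neq0.
Qed.

End Geometry.

End Hyperplanes.
Import Hyperplanes.

(** * Differential calculus and the Euler field over K *)

Module Calculus.

Section Ratfield.
Variables (C : numFieldType) (n : nat) (K : ratfield C n).
Local Notation S := {mpoly C[n]}.
Implicit Types (f g : K) (P Q : S) (A B : 'M[C]_n) (xi eta : 'cV[C]_n).

Definition cst : C -> K := toK K \o @mpolyC n C.
HB.instance Definition _ := GRing.RMorphism.on cst.

Lemma cstE c : cst c = toK K c%:MP. Proof. by []. Qed.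

Lemma toKZ c P : toK K (c *: P) = cst c * toK K P.
Proof. by rewrite -mul_mpolyC rmorphM. Qed.

Lemma toK_inj : injective (toK K).
Proof.
move=> P Q /eqP; rewrite -subr_eq0 -rmorphB toK_eq0 subr_eq0.
by move/eqP.
Qed.

Lemma dK_zmod xi : zmod_morphism (dK K xi).
Proof. by move=> f g; apply: (addIr (dK K xi g)); rewrite -dKD !subrK. Qed.
HB.instance Definition _ xi := GRing.isZmodMorphism.Build K K (dK K xi) (dK_zmod xi).

Lemma dK_cst xi c : dK K xi (cst c) = 0.
Proof. by rewrite dKE pderC rmorph0. Qed.

Lemma dK1 xi : dK K xi 1 = 0.
Proof. by rewrite -(rmorph1 cst) dK_cst. Qed.

Lemma dKZ xi c f : dK K xi (cst c * f) = cst c * dK K xi f.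
Proof. by rewrite dKM dK_cst mul0r add0r. Qed.

Lemma dKV xi f : f != 0 -> dK K xi f^-1 = - (f^-1 ^+ 2 * dK K xi f).
Proof.
move=> f0; have := dK1 xi; rewrite -(mulVf f0) dKM => /eqP.
rewrite addr_eq0 => /eqP e; apply: (mulIf f0); rewrite e mulNr; congr (- _).
by field.
Qed.

Lemma dKX xi f m : dK K xi (f ^+ m) = m%:R * f ^+ m.-1 * dK K xi f.
Proof.
elim: m => [|m IH]; first by rewrite dK1 !mul0r.
case: m IH => [|m] IH; first by rewrite expr1 mulr1 mul1r.
rewrite exprS dKM IH /= [in RHS]mulrSr !mulrDl mul1r addrC; congr (_ + _).
  by rewrite exprS !mulrA [f * _]mulrC.
by rewrite mulrC.
Qed.

Lemma dKXz xi f (m : int) : f != 0 ->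
  dK K xi (f ^ m) = m%:~R * (f ^ m / f) * dK K xi f.
Proof.
move=> f0; case: m => m.
  rewrite -exprnP dKX; case: m => [|m]; first by rewrite !mul0r.
  by rewrite /= exprSr mulfK.
rewrite NegzE -exprz_inv -exprnP dKX dKV // mulrNz /= [f^-1 ^+ m.+1]exprS.
have -> : (m.+1%:Z)%:~R = m.+1%:R :> K by [].
by field.
Qed.

Lemma K_rmorph_ext (f g : {rmorphism K -> K}) :
  (forall P, f (toK K P) = g (toK K P)) -> f =1 g.
Proof. by move=> e h; have [P [Q [_ ->]]] := toK_frac h; rewrite !fmorph_div !e. Qed.

(** The Leibniz rule is twisted by [h] to cover derivations composed with a substitution. Applied to
    f Q = P it determines D f from the values on polynomials. *)
Lemma K_der_ext (D1 D2 : K -> K) (h : {rmorphism K -> K}) :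
  (forall f g, D1 (f * g) = D1 f * h g + h f * D1 g) ->
  (forall f g, D2 (f * g) = D2 f * h g + h f * D2 g) ->
  (forall P, D1 (toK K P) = D2 (toK K P)) -> D1 =1 D2.
Proof.
move=> M1 M2 e f; have [P [Q [Q0 fE]]] := toK_frac f.
have Q0' : toK K Q != 0 by rewrite toK_eq0.
have fQ : f * toK K Q = toK K P by rewrite fE divfK.
have := e P; rewrite -fQ M1 M2 e => /addIr.
by apply: mulIf; rewrite fmorph_eq0.
Qed.

Lemma dK_lin xi eta c f : dK K (c *: xi + eta) f = cst c * dK K xi f + dK K eta f.
Proof.
move: f; apply: (@K_der_ext _ (fun f => cst c * dK K xi f + dK K eta f) idfun) => /= [f g|f g|P].
- exact: dKM.
- by rewrite !dKM; ring.
- by rewrite !dKE pder_lin rmorphD /= toKZ.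
Qed.

Lemma dK_comm xi eta f : dK K xi (dK K eta f) = dK K eta (dK K xi f).
Proof.
apply/eqP; rewrite -subr_eq0; apply/eqP; move: f.
apply: (@K_der_ext (fun f => dK K xi (dK K eta f) - dK K eta (dK K xi f)) (fun=> 0) idfun) => /= [f g|f g|P].
- by rewrite !dKM !raddfD /= !dKM; ring.
- by rewrite mul0r mulr0 addr0.
- by rewrite !dKE pder_comm subrr.
Qed.

Lemma sK_cst A c : A \in unitmx -> sK K A (cst c) = cst c.
Proof. by move=> uA; rewrite sKE // substC. Qed.

Lemma sK_comp A B f : A \in unitmx -> B \in unitmx ->
  sK K A (sK K B f) = sK K (B *m A) f.
Proof.
move=> uA uB; move: f; apply: (K_rmorph_ext (f := sK K A \o sK K B)) => P /=.
by rewrite !sKE ?unitmx_mul ?uA ?uB // subst_comp.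
Qed.

Lemma sK1 f : sK K 1%:M f = f.
Proof.
move: f; apply: (K_rmorph_ext (g := idfun)) => P /=.
by rewrite sKE ?unitmx1 // subst1.
Qed.

Lemma dK_sK A xi f : A \in unitmx -> dK K xi (sK K A f) = sK K A (dK K (A *m xi) f).
Proof.
move=> uA; move: f.
apply: (@K_der_ext (fun f => dK K xi (sK K A f)) (fun f => sK K A (dK K (A *m xi) f)) (sK K A)) => [f g|f g|P].
- by rewrite rmorphM dKM.
- by rewrite dKM rmorphD !rmorphM.
- by rewrite sKE // !dKE sKE // pder_subst.
Qed.

Lemma dK_sum (I : Type) (r : seq I) (c : I -> C) (v : I -> 'cV[C]_n) f :
  dK K (\sum_(i <- r) c i *: v i) f = \sum_(i <- r) cst (c i) * dK K (v i) f.
Proof.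
elim: r => [|i r IH]; last by rewrite !big_cons dK_lin IH.
rewrite !big_nil; have := dK_lin 0 0 0 f; rewrite scale0r addr0 rmorph0 mul0r add0r.
have := dK_lin 0 0 1 f; rewrite scale1r addr0 rmorph1 mul1r => e _.
by apply: (addIr (dK K 0 f)); rewrite -e add0r.
Qed.

Lemma dK_basis xi f : dK K xi f = \sum_i cst (xi i 0) * dK K (delta_mx i 0) f.
Proof.
rewrite -dK_sum; congr (dK K _ f).
by rewrite {1}[xi]matrix_sum_delta; apply: eq_bigr => i _; rewrite big_ord1.
Qed.

Definition euler f : K := \sum_i toK K 'X_i * dK K (delta_mx i 0) f.

Lemma euler_zmod : zmod_morphism euler.
Proof.
move=> f g; rewrite /euler -sumrB; apply: eq_bigr => i _.
by rewrite raddfB mulrBr.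
Qed.
HB.instance Definition _ := GRing.isZmodMorphism.Build K K euler euler_zmod.

Lemma eulerM f g : euler (f * g) = euler f * g + f * euler g.
Proof.
rewrite /euler mulr_suml mulr_sumr -big_split; apply: eq_bigr => i _ /=.
by rewrite dKM mulrDr mulrA mulrCA.
Qed.

Lemma euler_cst c : euler (cst c) = 0.
Proof. by rewrite /euler big1 // => i _; rewrite dK_cst mulr0. Qed.

Lemma eulerZ c f : euler (cst c * f) = cst c * euler f.
Proof. by rewrite eulerM euler_cst mul0r add0r. Qed.

Lemma euler_dK xi f : euler (dK K xi f) = dK K xi (euler f) - dK K xi f.
Proof.
rewrite [euler f]/euler raddf_sum /= (dK_basis xi f) -sumrB; apply: eq_bigr => i _.
rewrite dKM dKE pderX addrC addrA [- _ + _]addrC -cstE subrr add0r dK_comm.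
by rewrite -dK_basis.
Qed.

Lemma euler_sK A f : A \in unitmx -> euler (sK K A f) = sK K A (euler f).
Proof.
move=> uA; rewrite /euler rmorph_sum /=.
have e i : A *m delta_mx i 0 = \sum_j A j i *: delta_mx j 0 :> 'cV[C]_n.
  rewrite {1}[A *m _]matrix_sum_delta; apply: eq_bigr => j _.
  by rewrite big_ord1 -colE mxE.
under eq_bigr => i _ do rewrite dK_sK // e dK_sum rmorph_sum mulr_sumr.
rewrite exchange_big /=; apply: eq_bigr => j _.
rewrite rmorphM sKE // substX rmorph_sum mulr_suml; apply: eq_bigr => i _ /=.
by rewrite rmorphM /= sK_cst // toKZ mulrA [_ * cst _]mulrC.
Qed.

Lemma mcoeff_euler P m : (\sum_i 'X_i * P^`M(i))@_m = (mdeg m)%:R * P@_m.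
Proof.
pose F (P0 : S) : S := \sum_i 'X_i * P0^`M(i).
have FX m' : F 'X_[m'] = (mdeg m')%:R *: 'X_[m'].
  rewrite /F mdegE natr_sum scaler_suml; apply: eq_bigr => i _.
  rewrite mderivX -scalerAr; have [->|mi] := eqVneq (m' i) 0%N; first by rewrite !scale0r.
  by rewrite -mpolyXD addmC submK // lep1mP.
have FD P1 Q c : F (c *: P1 + Q) = c *: F P1 + F Q.
  rewrite /F scaler_sumr -big_split; apply: eq_bigr => i _ /=.
  by rewrite mderivD mderivZ mulrDr scalerAr.
suff /(congr1 (mcoeff m)) -> : F P = \sum_(k <- msupp P) P@_k *: ((mdeg k)%:R *: 'X_[k]).
  rewrite raddf_sum /=; have [mP|mP] := boolP (m \in msupp P).
    rewrite (bigD1_seq m) ?msupp_uniq //= big1 => [|k km].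
      by rewrite !mcoeffZ mcoeffX eqxx mulr1 addr0 mulrC.
    by rewrite !mcoeffZ mcoeffX (negPf km) !mulr0.
  rewrite memN_msupp_eq0 // mulr0 big_seq big1 // => k kP.
  by rewrite !mcoeffZ mcoeffX; case: eqP mP => [<-|]; rewrite ?kP ?mulr0.
rewrite {1}[P]mpolyE; elim: (msupp P) => [|k r IH]; last first.
  by rewrite !big_cons FD IH FX.
by rewrite !big_nil /F big1 // => i _; rewrite mderiv0 mulr0.
Qed.

(** Comparison of leading coefficients shows that the eigenvalue is the degree of P. So an
    eigenvalue that is not a natural number excludes nonzero polynomials, and any other one bounds
    their size. *)
Lemma euler_toK P (c : C) : euler (toK K P) = cst c * toK K P -> P != 0 ->
  exists2 k : nat, c = k%:R & msize P = k.+1.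
Proof.
have -> : euler (toK K P) = toK K (\sum_i 'X_i * P^`M(i)).
  rewrite /euler rmorph_sum; apply: eq_bigr => i _; rewrite dKE rmorphM; congr (_ * toK K _).
  rewrite /pder (bigD1 i) //= mxE !eqxx scale1r big1 ?addr0 // => j ji.
  by rewrite mxE (negPf ji) scale0r.
rewrite -toKZ => /toK_inj e P0.
have /mlead_supp lP := P0; have := congr1 (mcoeff (mlead P)) e.
rewrite mcoeff_euler mcoeffZ => /mulIf <-; last by rewrite -mcoeff_msupp.
by exists (mdeg (mlead P)) => //; rewrite -mlead_deg.
Qed.

End Ratfield.

End Calculus.
Import Calculus.

(** * The local ring of rational functions along a hyperplane *)

Module LocalRing.

Section LocalRing.
Variables (C : numClosedFieldType) (gT : finGroupType) (W : {group gT}).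
Variables (n : nat) (rV : mx_representation C W n).
Variable alpha : {vspace 'cV[C]_n} -> 'Hom('cV[C]_n, C^o).
Hypothesis faithful : mx_faithful rV.
Hypothesis formsP : is_hyperplane_forms rV alpha.
Variable K : ratfield C n.

Local Notation S := {mpoly C[n]}.
Implicit Types (H : {vspace 'cV[C]_n}) (w g : gT) (x xi v : 'cV[C]_n).
Implicit Types (P Q : S) (f h : K).
Local Notation hyps := (hyperplanes rV).

Definition lform H : S := \sum_j (alpha H (delta_mx j 0) : C) *: 'X_j.
Definition aK H : K := toK K (lform H).
(** The logarithmic form d alpha_H / alpha_H on xi. Rescaling alpha_H does not change it, hence the
    exact equivariance in [wK_om]. *)
Definition om H xi : K := cst K (alpha H xi) / aK H.

Lemma form_basis H x : alpha H x = \sum_j x j 0 * (alpha H (delta_mx j 0) : C).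
Proof.
rewrite {1}[x]matrix_sum_delta linear_sum; apply: eq_bigr => j _.
by rewrite big_ord1 linearZ.
Qed.

Lemma meval_lform H x : (lform H).@[fun i => x i 0] = alpha H x.
Proof.
rewrite raddf_sum form_basis; apply: eq_bigr => j _ /=.
by rewrite mevalZ mevalXU mulrC.
Qed.

Lemma pder_lform H xi : pder xi (lform H) = (alpha H xi : C)%:MP.
Proof.
rewrite (big_morph _ (pderD xi) (id1 := 0)); last by rewrite -mpolyC0 pderC.
rewrite form_basis raddf_sum; apply: eq_bigr => j _ /=.
by rewrite -mul_mpolyC pderM pderC mul0r add0r pderX -mpolyCM mulrC.
Qed.

Lemma dK_aK H xi : dK K xi (aK H) = cst K (alpha H xi).
Proof. by rewrite dKE pder_lform. Qed.

Lemma lform_neq0 H : H \in hyps -> lform H != 0.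
Proof.
move=> HH; have [x ax] := alpha_neq0 formsP HH; apply: contraTneq (oner_neq0 C) => l0.
by rewrite -ax -meval_lform l0 meval0 negbK.
Qed.

Lemma aK_neq0 H : H \in hyps -> aK H != 0.
Proof. by move=> HH; rewrite toK_eq0 lform_neq0. Qed.

Lemma euler_aK H : euler (aK H) = aK H.
Proof.
rewrite /euler [in RHS]/aK [lform H in RHS]/lform rmorph_sum /=; apply: eq_bigr => i _.
by rewrite dK_aK toKZ mulrC.
Qed.

Lemma subst_lform H H' c (A : 'M[C]_n) :
  (forall x, alpha H (A *m x) = c * alpha H' x) -> subst A (lform H) = c *: lform H'.
Proof.
move=> e; rewrite /lform rmorph_sum /=.
under eq_bigr => j _ do rewrite substZ substX scaler_sumr.
rewrite exchange_big /= scaler_sumr; apply: eq_bigr => k _.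
rewrite scalerA -e form_basis scaler_suml; apply: eq_bigr => j _.
by rewrite scalerA mulrC -colE mxE.
Qed.

Definition wK w : {rmorphism K -> K} := sK K (rV w^-1%g).

Lemma unit_rVV w : w \in W -> rV w^-1%g \in unitmx.
Proof. by move=> wW; rewrite repr_mx_unit ?groupV. Qed.

Lemma wKM w g f : w \in W -> g \in W -> wK (w * g)%g f = wK w (wK g f).
Proof.
move=> wW gW; rewrite /wK sK_comp ?unit_rVV //.
by rewrite -repr_mxM ?groupV // invMg.
Qed.

Lemma wK1 f : wK 1%g f = f.
Proof. by rewrite /wK invg1 repr_mx1 sK1. Qed.

Lemma wK_cst w c : w \in W -> wK w (cst K c) = cst K c.
Proof. by move=> wW; rewrite sK_cst ?unit_rVV. Qed.

Lemma wK_toK w P : w \in W -> wK w (toK K P) = toK K (subst (rV w^-1%g) P).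
Proof. by move=> wW; rewrite sKE ?unit_rVV. Qed.

Lemma wK_dK w xi f : w \in W -> wK w (dK K xi f) = dK K (rV w *m xi) (wK w f).
Proof. by move=> wW; rewrite /wK dK_sK ?unit_rVV // rVK. Qed.

Lemma wK_aK w H : w \in W -> H \in hyps ->
  exists2 c, c != 0 & wK w (aK H) = cst K c * aK (hmove rV w H) /\
    forall x, alpha H (rV w^-1%g *m x) = c * alpha (hmove rV w H) x.
Proof.
move=> wW HH; have [c c0 ce] := alpha_hmove formsP wW HH; exists c => //; split=> //.
by rewrite wK_toK // (subst_lform ce) toKZ.
Qed.

Lemma wK_om w H xi : w \in W -> H \in hyps ->
  wK w (om H xi) = om (hmove rV w H) (rV w *m xi).
Proof.
move=> wW HH; have [c c0 [e ce]] := wK_aK wW HH.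
rewrite /om fmorph_div /= wK_cst // e.
have -> : alpha H xi = c * alpha (hmove rV w H) (rV w *m xi) :> C by rewrite -ce rVK.
have aw := aK_neq0 (hmove_hyps wW HH).
have cc : cst K c != 0 by rewrite fmorph_eq0.
by rewrite rmorphM /=; field; rewrite aw cc.
Qed.

Lemma wK_aK_stab H w : H \in hyps -> w \in pt_stab rV H ->
  wK w (aK H) = (cst K (\det (rV w)))^-1 * aK H.
Proof.
move=> HH wH; have wW := pt_stab_sub wH; rewrite wK_toK // -fmorphV.
rewrite (@subst_lform H H (\det (rV w))^-1) ?toKZ // => x.
rewrite -{2}(rVKV rV x wW) (alpha_det formsP) // mulKf //.
exact: det_neq0.
Qed.

Definition vanish H P := exists Q, P = lform H * Q.

Lemma vanish_meval H P x : H \in hyps -> x \in H -> vanish H P -> P.@[fun i => x i 0] = 0.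
Proof.
move=> HH xH [Q ->]; rewrite mevalM meval_lform.
by move: xH; rewrite (mem_hyp formsP) // => /eqP ->; rewrite mul0r.
Qed.

(** alpha_H is prime: every R is congruent modulo alpha_H to R o A, where A = 1 - v alpha_H projects
    onto H, and alpha_H o A = 0. So the multiples of alpha_H are the kernel of a ring morphism into
    a domain. *)
Lemma vanishM H P Q : H \in hyps -> vanish H (P * Q) -> vanish H P \/ vanish H Q.
Proof.
move=> HH; have [v av] := alpha_neq0 formsP HH.
pose l : 'rV[C]_n := \row_j alpha H (delta_mx j 0); pose A := 1%:M - v *m l.
have decomp R : exists R', R = subst A R + lform H * R'.
  move: R; apply: mpoly_alg_ind => [c|i|R1 R2 [R1' e1] [R2' e2]|R1 R2 [R1' e1] [R2' e2]].
  - by exists 0; rewrite substC mulr0 addr0.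
  - exists (v i 0)%:MP; rewrite substX /lform mulr_suml -big_split /=.
    under eq_bigr => j _.
      rewrite -scalerAl [_ * _%:MP]mulrC mul_mpolyC !mxE scalerA -scalerDl big_ord1 !mxE.
      rewrite [v i 0 * _]mulrC subrK; over.
    rewrite (bigD1 i) //= eqxx scale1r big1 ?addr0 // => j ji.
    by rewrite eq_sym (negPf ji) scale0r.
  - exists (R1' + R2'); rewrite {1}e1 {1}e2 rmorphD mulrDr; ring.
  - exists (R1' * subst A R2 + R1 * R2'); rewrite {1}e2 mulrDr {1}e1 rmorphM; ring.
have sl : subst A (lform H) = 0.
  have -> : subst A (lform H) = 0 *: lform H; last by rewrite scale0r.
  apply: subst_lform => x; rewrite mul0r mulmxBl mul1mx -mulmxA linearB.
  have -> : l *m x = (alpha H x : C)%:M.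
    apply/matrixP => i j; rewrite !ord1 !mxE eqxx mulr1n form_basis.
    by apply: eq_bigr => k _; rewrite !mxE mulrC.
  by rewrite mul_mx_scalar linearZ /= av /GRing.scale /= mulr1 subrr.
have vs R : subst A R = 0 -> vanish H R.
  by move=> e; have [R' ->] := decomp R; exists R'; rewrite e add0r.
case=> R /(congr1 (subst A)); rewrite !rmorphM /= sl mul0r => /eqP.
by rewrite mulf_eq0 => /orP[] /eqP /vs; [left|right].
Qed.

Lemma nvanish_lform H H' : H \in hyps -> H' \in hyps -> H <> H' -> ~ vanish H (lform H').
Proof.
move=> HH HH' ne van; apply: ne; apply: (hyps_incl formsP) => // x xH.
by rewrite -meval_lform (vanish_meval HH xH van).
Qed.

Lemma nvanish_cst H c : H \in hyps -> c != 0 -> ~ vanish H c%:MP.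
Proof.
move=> HH c0 /(vanish_meval HH (mem0v H)); rewrite mevalC => /eqP.
by rewrite (negPf c0).
Qed.

Lemma vanish_subst w H P : w \in W -> H \in hyps ->
  vanish H P -> vanish (hmove rV w H) (subst (rV w^-1%g) P).
Proof.
move=> wW HH [Q ->]; rewrite rmorphM /=.
have [c c0 ce] := alpha_hmove formsP wW HH.
exists (c *: subst (rV w^-1%g) Q); rewrite (subst_lform ce).
by rewrite -scalerAl scalerAr.
Qed.

Lemma vanish_substE w H P : w \in W -> H \in hyps ->
  vanish (hmove rV w H) (subst (rV w^-1%g) P) -> vanish H P.
Proof.
move=> wW HH /(vanish_subst (groupVr wW) (hmove_hyps wW HH)).
by rewrite -hmoveM ?groupV // mulVg hmove1 subst_comp -repr_mxM ?groupV //
  mulgV repr_mx1 subst1.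
Qed.

(** w^-1 moves a point x by alpha_H(x) times a fixed vector, which settles the coordinates; products
    follow as for any difference of products. *)
Lemma vanish_subst_stab H w P : H \in hyps -> w \in pt_stab rV H ->
  vanish H (subst (rV w^-1%g) P - P).
Proof.
move=> HH wH; have [u uE _] := pt_stab_rank1 formsP HH (groupVr wH).
move: P; apply: mpoly_alg_ind => [c|i|P Q [P' eP] [Q' eQ]|P Q [P' eP] [Q' eQ]].
- by exists 0; rewrite substC mulr0 subrr.
- exists (u i 0)%:MP; rewrite substX /lform mulr_suml.
  have -> : 'X_i = \sum_j (i == j)%:R *: 'X_j :> S.
    rewrite (bigD1 i) //= eqxx scale1r big1 ?addr0 // => j ji.
    by rewrite eq_sym (negPf ji) scale0r.
  rewrite -sumrB; apply: eq_bigr => j _.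
  rewrite -scalerBl -scalerAl [_ * _%:MP]mulrC mul_mpolyC scalerA; congr (_ *: _).
  have := congr1 (fun M : 'cV_n => M i 0) (uE (delta_mx j 0)).
  by rewrite -colE !mxE eqxx andbT => ->; rewrite addrAC subrr add0r.
- by exists (P' + Q'); rewrite rmorphD mulrDr -eP -eQ; ring.
- exists (P' * subst (rV w^-1%g) Q + P * Q'); rewrite mulrDr mulrA -eP mulrCA -eQ rmorphM.
  by ring.
Qed.

(** The localization at the prime alpha_H, a discrete valuation ring with uniformizer [aK H]: its
    elements have no pole along H. *)
Definition locreg H f := exists P Q, ~ vanish H Q /\ f * toK K Q = toK K P.

Lemma nvanishM H P Q : H \in hyps -> ~ vanish H P -> ~ vanish H Q -> ~ vanish H (P * Q).
Proof. by move=> HH nP nQ /(vanishM HH)[]. Qed.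

Lemma locreg_toK H P : H \in hyps -> locreg H (toK K P).
Proof.
move=> HH; exists P, 1; rewrite rmorph1 mulr1; split=> //.
by rewrite -mpolyC1; apply: nvanish_cst => //; apply: oner_neq0.
Qed.

Lemma locreg_cst H c : H \in hyps -> locreg H (cst K c).
Proof. exact: locreg_toK. Qed.

Lemma locreg0 H : H \in hyps -> locreg H 0.
Proof. by move=> HH; rewrite -(rmorph0 (cst K)); apply: locreg_cst. Qed.

Lemma locreg1 H : H \in hyps -> locreg H 1.
Proof. by move=> HH; rewrite -(rmorph1 (cst K)); apply: locreg_cst. Qed.

Lemma locregD H f h : H \in hyps -> locreg H f -> locreg H h -> locreg H (f + h).
Proof.
move=> HH [P [Q [nQ eP]]] [P' [Q' [nQ' eP']]].
exists (P * Q' + P' * Q), (Q * Q'); split; first exact: nvanishM.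
by rewrite rmorphD !rmorphM /= -eP -eP'; ring.
Qed.

Lemma locregM H f h : H \in hyps -> locreg H f -> locreg H h -> locreg H (f * h).
Proof.
move=> HH [P [Q [nQ eP]]] [P' [Q' [nQ' eP']]].
exists (P * P'), (Q * Q'); split; first exact: nvanishM.
by rewrite !rmorphM /= -eP -eP'; ring.
Qed.

Lemma locregN H f : H \in hyps -> locreg H f -> locreg H (- f).
Proof.
move=> HH rf; rewrite -mulN1r; apply: locregM => //.
by rewrite -(rmorph1 (cst K)) -rmorphN; apply: locreg_cst.
Qed.

Lemma locreg_sum H (I : Type) (r : seq I) (p : pred I) (F : I -> K) : H \in hyps ->
  (forall i, p i -> locreg H (F i)) -> locreg H (\sum_(i <- r | p i) F i).
Proof.
move=> HH rF; apply: (big_ind (locreg H)) => //; first exact: locreg0.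
by move=> f h; apply: locregD.
Qed.

Lemma locregX H f m : H \in hyps -> locreg H f -> locreg H (f ^+ m).
Proof.
move=> HH rf; elim: m => [|m IH]; first by rewrite expr0; apply: locreg1.
by rewrite exprS; apply: locregM.
Qed.

Lemma locreg_dK H xi f : H \in hyps -> locreg H f -> locreg H (dK K xi f).
Proof.
move=> HH [P [Q [nQ e]]]; exists (pder xi P * Q - P * pder xi Q), (Q * Q).
split; first exact: nvanishM.
by rewrite rmorphB !rmorphM /= -!dKE -e dKM; ring.
Qed.

Lemma locregV H H' : H \in hyps -> H' \in hyps -> H <> H' -> locreg H (aK H')^-1.
Proof.
move=> HH HH' ne; exists 1, (lform H'); split; first exact: nvanish_lform.
by rewrite mulVf ?rmorph1 // aK_neq0.
Qed.

Lemma locreg_om H H' xi : H \in hyps -> H' \in hyps -> H <> H' -> locreg H (om H' xi).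
Proof. by move=> HH HH' ne; apply: locregM => //; [apply: locreg_cst | apply: locregV]. Qed.

Lemma locreg_wK w H f : w \in W -> H \in hyps -> locreg H f -> locreg (hmove rV w H) (wK w f).
Proof.
move=> wW HH [P [Q [nQ e]]].
exists (subst (rV w^-1%g) P), (subst (rV w^-1%g) Q); split.
  by move=> /(vanish_substE wW HH).
by rewrite -!wK_toK // -rmorphM e.
Qed.

Lemma hmove_stab H w : w \in pt_stab rV H -> hmove rV w H = H.
Proof.
move=> wH; have wW := pt_stab_sub wH; apply/vspaceP => x; rewrite hmoveP //.
have /pt_stabP[_ h] := wH.
have /pt_stabP[_ h'] := groupVr wH.
by apply/idP/idP => xH; [rewrite -(rVKV rV x wW) h | rewrite h'].
Qed.

(** Under w, the numerator and the denominator of f change by multiples of alpha_H, so the divided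
    difference acquires no pole along H. This is what keeps the difference terms of Dunkl operators
    under control. *)
Lemma locreg_diff H w f : H \in hyps -> w \in pt_stab rV H -> locreg H f ->
  locreg H ((wK w f - f) / aK H).
Proof.
move=> HH wH [P [Q [nQ e]]]; have wW := pt_stab_sub wH.
have [P' eP'] := vanish_subst_stab P HH wH.
have [Q' eQ'] := vanish_subst_stab Q HH wH.
exists (P' * Q - P * Q'), (subst (rV w^-1%g) Q * Q); split.
  apply: nvanishM => // h; apply: nQ; apply: (vanish_substE wW HH).
  by rewrite hmove_stab.
have a0 := aK_neq0 HH; apply: (mulfI a0).
have eP : aK H * toK K P' = wK w f * wK w (toK K Q) - f * toK K Q.
  by rewrite -(rmorphM (toK K)) -eP' rmorphB -wK_toK // -e rmorphM.
have eQ : aK H * toK K Q' = wK w (toK K Q) - toK K Q.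
  by rewrite -(rmorphM (toK K)) -eQ' rmorphB -wK_toK.
rewrite rmorphB !rmorphM /= mulrBr [aK H * (toK K P' * _)]mulrA eP.
rewrite [aK H * (toK K P * _)]mulrCA eQ -wK_toK // -e.
by field.
Qed.

End LocalRing.

End LocalRing.
Import LocalRing.

(** * The connection, the Dunkl operators, orders and types along H *)

Module Operators.

Section Operators.
Variables (C : numClosedFieldType) (gT : finGroupType) (W : {group gT}).
Variables (n : nat) (rV : mx_representation C W n).
Variable alpha : {vspace 'cV[C]_n} -> 'Hom('cV[C]_n, C^o).
Hypothesis faithful : mx_faithful rV.
Hypothesis formsP : is_hyperplane_forms rV alpha.
Variable K : ratfield C n.
Variables (d : nat) (tau : mx_representation C W d).

Local Notation hyps := (hyperplanes rV).
Local Notation cst := (cst K).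
Local Notation aK := (aK alpha K).
Local Notation om := (om alpha K).
Local Notation wK := (wK rV K).
Local Notation locreg := (locreg alpha (K := K)).
Local Notation hmove := (hmove rV).

Implicit Types (H : {vspace 'cV[C]_n}) (w g : gT) (x xi eta v : 'cV[C]_n).
Implicit Types (a b : {vspace 'cV[C]_n} -> nat -> C) (m j l : int).

Definition cmx p q (A : 'M[C]_(p, q)) : 'M[K]_(p, q) := map_mx cst A.
(* This is f |-> w o f o w^-1; below, the e_{H,i} act on the values in [AH] and
   diagonally, through [act], in [RH]. *)
Definition act q w (f : 'M[K]_(d, q)) : 'M[K]_(d, q) := cmx (tau w) *m map_mx (wK w) f.
Definition dmx p q xi (f : 'M[K]_(p, q)) : 'M[K]_(p, q) := map_mx (dK K xi) f.
Definition emx p q (f : 'M[K]_(p, q)) : 'M[K]_(p, q) := map_mx (@euler _ _ K) f.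

Definition AH b H : 'M[C]_d :=
  \sum_(i < n_ rV H) ((n_ rV H)%:R * b H i) *: e_ rV tau H i.
(** The coefficient of w in sum_i n_H b_{H,i} e_{H,i}, where n_H has cancelled the denominator of
    e_{H,i}. *)
Definition bet b H w : C := \sum_(i < n_ rV H) b H i * \det (rV w) ^- i.
(** Extends the index i periodically to all integers; the remainder is non-negative, so the absolute
    value only turns it into a natural number. *)
Definition bz b H l : C := b H `|(l %% n_ rV H)%Z|%N.

Definition invmult b := forall H w i, H \in hyps -> w \in W -> (i < n_ rV H)%N ->
  b (hmove w H) i = b H i.

Definition RH q a H (f : 'M[K]_(d, q)) : 'M[K]_(d, q) :=
  \sum_(w in pt_stab rV H) cst (bet a H w) *: act w f.
Definition nab q b xi (f : 'M[K]_(d, q)) : 'M[K]_(d, q) :=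
  dmx xi f + \sum_(H <- hyps) om H xi *: (cmx (AH b H) *m f).
Definition dunkl q a b xi (f : 'M[K]_(d, q)) : 'M[K]_(d, q) :=
  nab b xi f - \sum_(H <- hyps) om H xi *: RH a H f.
(** Unlike [dunkl], keeps only the difference term whose coefficient has its pole along H; the
    coefficients of the others are regular along H. *)
Definition locdunkl q a b H xi (f : 'M[K]_(d, q)) : 'M[K]_(d, q) :=
  nab b xi f - om H xi *: RH a H f.

Section Algebra.
Variable q : nat.
Implicit Types f h : 'M[K]_(d, q).

Lemma dmxD xi f h : dmx xi (f + h) = dmx xi f + dmx xi h.
Proof. by rewrite /dmx map_mxD. Qed.

Lemma dmxZ xi (c : K) f : dmx xi (c *: f) = dK K xi c *: f + c *: dmx xi f.
Proof. by apply/matrixP => i j; rewrite !mxE dKM. Qed.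

Lemma dmx_mul p r xi (f : 'M[K]_(p, q)) (h : 'M[K]_(q, r)) :
  dmx xi (f *m h) = dmx xi f *m h + f *m dmx xi h.
Proof.
apply/matrixP => i j; rewrite !mxE raddf_sum -big_split; apply: eq_bigr => k _ /=.
by rewrite dKM !mxE.
Qed.

Lemma dmx_cmx p xi (A : 'M[C]_(p, d)) f : dmx xi (cmx A *m f) = cmx A *m dmx xi f.
Proof.
apply/matrixP => i j; rewrite !mxE raddf_sum; apply: eq_bigr => k _ /=.
by rewrite !mxE dKZ.
Qed.

Lemma dmx_comm xi eta f : dmx xi (dmx eta f) = dmx eta (dmx xi f).
Proof. by apply/matrixP => i j; rewrite !mxE dK_comm. Qed.

Lemma nabD b xi f h : nab b xi (f + h) = nab b xi f + nab b xi h.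
Proof.
rewrite /nab dmxD addrACA -big_split; congr (_ + _); apply: eq_bigr => H _ /=.
by rewrite mulmxDr scalerDr.
Qed.

Lemma nabZ b xi (c : K) f : nab b xi (c *: f) = dK K xi c *: f + c *: nab b xi f.
Proof.
rewrite /nab dmxZ -addrA scalerDr scaler_sumr; congr (_ + (_ + _)).
by apply: eq_bigr => H _; rewrite -scalemxAr !scalerA [om H xi * c]mulrC.
Qed.

Lemma nabZc b xi (c : C) f : nab b xi (cst c *: f) = cst c *: nab b xi f.
Proof. by rewrite nabZ dK_cst scale0r add0r. Qed.

Lemma nab0 b xi : nab b xi (0 : 'M[K]_(d, q)) = 0.
Proof. by rewrite -{1}(scale0r 0) -(rmorph0 cst) nabZc rmorph0 scale0r. Qed.

Lemma nabB b xi f h : nab b xi (f - h) = nab b xi f - nab b xi h.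
Proof. by rewrite nabD -scaleN1r -(rmorphN1 cst) nabZc rmorphN1 scaleN1r. Qed.

Lemma nab_sum (I : Type) (r : seq I) (P : pred I) b xi (F : I -> 'M[K]_(d, q)) :
  nab b xi (\sum_(i <- r | P i) F i) = \sum_(i <- r | P i) nab b xi (F i).
Proof. exact: (big_morph _ (nabD b xi) (nab0 b xi)). Qed.

Lemma nab_lin b (c : C) xi eta f : nab b (c *: xi + eta) f = cst c *: nab b xi f + nab b eta f.
Proof.
rewrite /nab scalerDr addrACA; congr (_ + _).
  by apply/matrixP => i j; rewrite !mxE dK_lin.
rewrite scaler_sumr -big_split; apply: eq_bigr => H _ /=.
by rewrite scalerA -scalerDl; congr (_ *: _);
  rewrite /om linearP rmorphD rmorphM /= mulrDl mulrA.
Qed.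

Lemma actD w f h : act w (f + h) = act w f + act w h.
Proof. by rewrite /act map_mxD mulmxDr. Qed.

Lemma actZ w (c : K) f : act w (c *: f) = wK w c *: act w f.
Proof. by rewrite /act map_mxZ scalemxAr. Qed.

Lemma actZc w (c : C) f : w \in W -> act w (cst c *: f) = cst c *: act w f.
Proof. by move=> wW; rewrite actZ wK_cst. Qed.

Lemma actB w f h : act w (f - h) = act w f - act w h.
Proof. by rewrite /act map_mxB mulmxBr. Qed.

Lemma act0 w : act w (0 : 'M[K]_(d, q)) = 0.
Proof. by rewrite /act map_mx0 mulmx0. Qed.

Lemma act_sum (I : Type) (r : seq I) (P : pred I) w (F : I -> 'M[K]_(d, q)) :
  act w (\sum_(i <- r | P i) F i) = \sum_(i <- r | P i) act w (F i).
Proof. exact: (big_morph _ (actD w) (act0 w)). Qed.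

Lemma map_wK_cmx p r w (A : 'M[C]_(p, r)) : w \in W -> map_mx (wK w) (cmx A) = cmx A.
Proof. by move=> wW; apply/matrixP => i k; rewrite !mxE wK_cst. Qed.

Lemma actM w g f : w \in W -> g \in W -> act (w * g)%g f = act w (act g f).
Proof.
move=> wW gW; rewrite /act map_mxM map_wK_cmx // mulmxA -map_mxM -repr_mxM //.
by congr (_ *m _); apply/matrixP => i j; rewrite !mxE wKM.
Qed.

Lemma act1 f : act 1%g f = f.
Proof.
rewrite /act repr_mx1 /cmx map_mx1 mul1mx.
by apply/matrixP => i j; rewrite !mxE wK1.
Qed.

Lemma act_mulr r w f (h : 'M[K]_(q, r)) : act w (f *m h) = act w f *m map_mx (wK w) h.
Proof. by rewrite /act map_mxM mulmxA. Qed.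

Lemma act_dmx w xi f : w \in W -> act w (dmx xi f) = dmx (rV w *m xi) (act w f).
Proof.
move=> wW; rewrite /act dmx_cmx; congr (_ *m _).
by apply/matrixP => i j; rewrite !mxE wK_dK.
Qed.

Lemma emxZ (c : K) f : emx (c *: f) = euler c *: f + c *: emx f.
Proof. by apply/matrixP => i j; rewrite !mxE eulerM. Qed.

Lemma emxD f h : emx (f + h) = emx f + emx h.
Proof. by rewrite /emx map_mxD. Qed.

Lemma emx_act w f : w \in W -> emx (act w f) = act w (emx f).
Proof.
move=> wW; apply/matrixP => i j; rewrite !mxE raddf_sum; apply: eq_bigr => k _ /=.
by rewrite !mxE eulerZ euler_sK ?unit_rVV.
Qed.

End Algebra.

Lemma AHE b H : AH b H = \sum_(w in pt_stab rV H) bet b H w *: tau w.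
Proof.
rewrite /AH /bet; under [RHS]eq_bigr => w _ do rewrite scaler_suml.
rewrite exchange_big /=; apply: eq_bigr => i _.
rewrite /e_ scalerA mulrAC mulfV ?mul1r; last by rewrite pnatr_eq0 -lt0n n_gt0.
by rewrite scaler_sumr; apply: eq_bigr => w _; rewrite scalerA.
Qed.

Lemma bet_lin (s : C) a b H w :
  bet (fun H i => s * a H i + b H i) H w = s * bet a H w + bet b H w.
Proof.
rewrite /bet mulr_sumr -big_split; apply: eq_bigr => i _ /=.
by rewrite mulrDl mulrA.
Qed.

Lemma AH_lin (s : C) a b H :
  AH (fun H i => s * a H i + b H i) H = s *: AH a H + AH b H.
Proof.
rewrite !AHE scaler_sumr -big_split; apply: eq_bigr => w _ /=.
by rewrite bet_lin scalerDl scalerA.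
Qed.

Lemma bet_hmove b H g w : invmult b -> H \in hyps -> g \in W -> w \in W ->
  bet b (hmove g H) (w ^ g^-1)%g = bet b H w.
Proof.
move=> ib HH gW wW; rewrite /bet n_hmove //; apply: eq_bigr => i _.
by rewrite ib // det_conj ?groupV.
Qed.

(** Fourier inversion on W_H: by [det_sum] only the index congruent to l modulo n_H survives. *)
Lemma bet_sum b H l : H \in hyps ->
  \sum_(w in pt_stab rV H) bet b H w * \det (rV w) ^ l = (n_ rV H)%:R * bz b H l.
Proof.
move=> HH; have n0 := n_gt0 rV H.
under eq_bigr => w wH.
  rewrite mulr_suml; under eq_bigr => i _.
    rewrite -mulrA exprnN -expfzDr ?det_neq0 ?(pt_stab_sub wH) // addrC; over.
  over.
rewrite exchange_big /=.
under eq_bigr => i _ do rewrite -mulr_sumr (det_sum faithful formsP) //.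
have lt : (`|(l %% n_ rV H)%Z|%N < n_ rV H)%N.
  by rewrite -ltz_nat gez0_abs ?ltz_pmod // modz_ge0 // lt0r_neq0.
rewrite (bigD1 (Ordinal lt)) //= big1 => [|i ne].
  rewrite ifT ?addr0; first by rewrite mulrC.
  rewrite /= gez0_abs ?modz_ge0 ?lt0r_neq0 //.
  by rewrite -eqz_mod_dvd modz_mod.
rewrite ifF ?mulr0 //; apply: contraNF ne; rewrite -eqz_mod_dvd => /eqP e.
apply/eqP/val_inj => /=; rewrite e modz_small ?absz_nat //.
by rewrite /= ltz_nat ltn_ord.
Qed.

Lemma AH_conj b H g : invmult b -> H \in hyps -> g \in W ->
  tau g *m AH b H = AH b (hmove g H) *m tau g.
Proof.
move=> ib HH gW; rewrite !AHE mulmx_sumr mulmx_suml.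
rewrite [RHS](reindex_inj (conjg_inj g^-1%g)) /=; apply: eq_big => [w|w wH].
  by rewrite pt_stab_hmove.
have wW := pt_stab_sub wH.
rewrite -scalemxAr -scalemxAl bet_hmove // -!repr_mxM ?groupJ ?groupV //.
by rewrite conjgE invgK !mulgA mulgKV.
Qed.

Section Equivariance.
Variable q : nat.
Implicit Types f h : 'M[K]_(d, q).

Lemma RHD a H f h : RH a H (f + h) = RH a H f + RH a H h.
Proof. by rewrite /RH -big_split; apply: eq_bigr => w _; rewrite actD scalerDr. Qed.

Lemma RHZc a H (c : C) f : RH a H (cst c *: f) = cst c *: RH a H f.
Proof.
rewrite /RH scaler_sumr; apply: eq_bigr => w wH.
by rewrite actZc ?(pt_stab_sub wH) // !scalerA mulrC.
Qed.

Lemma act_RH a H g f : invmult a -> H \in hyps -> g \in W ->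
  act g (RH a H f) = RH a (hmove g H) (act g f).
Proof.
move=> ia HH gW; rewrite /RH act_sum.
rewrite [RHS](reindex_inj (conjg_inj g^-1%g)) /=; apply: eq_big => [w|w wH].
  by rewrite pt_stab_hmove.
have wW := pt_stab_sub wH; rewrite actZc // bet_hmove // -!actM ?groupJ ?groupV //.
by rewrite conjgE invgK !mulgA mulgKV.
Qed.

Lemma act_nab b w xi f : invmult b -> w \in W ->
  act w (nab b xi f) = nab b (rV w *m xi) (act w f).
Proof.
move=> ib wW; rewrite /nab actD act_dmx // act_sum; congr (_ + _).
rewrite -[RHS](hmove_sum rV _ wW).
rewrite !big_seq; apply: eq_bigr => H HH.
rewrite actZ wK_om //; congr (_ *: _).
by rewrite /act map_mxM map_wK_cmx // !mulmxA -!map_mxM AH_conj.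
Qed.

Lemma act_locdunkl a b H w xi f : invmult a -> invmult b -> w \in W -> H \in hyps ->
  act w (locdunkl a b H xi f) = locdunkl a b (hmove w H) (rV w *m xi) (act w f).
Proof.
by move=> ia ib wW HH; rewrite /locdunkl actB act_nab // actZ wK_om // act_RH.
Qed.

Lemma act_dunkl a b w xi f : invmult a -> invmult b -> w \in W ->
  act w (dunkl a b xi f) = dunkl a b (rV w *m xi) (act w f).
Proof.
move=> ia ib wW; rewrite /dunkl actB act_nab // act_sum; congr (_ - _).
rewrite -[RHS](hmove_sum rV _ wW) !big_seq; apply: eq_bigr => H HH.
by rewrite actZ wK_om // act_RH.
Qed.

End Equivariance.

Definition locmx p r H (f : 'M[K]_(p, r)) :=
  forall (i : 'I_p) (k : 'I_r), locreg H (f i k).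
(** The filtration by order along H; a negative m allows poles. *)
Definition Fil p r H m (f : 'M[K]_(p, r)) := locmx H (aK H ^ (- m) *: f).
(** The det^j-isotypic part for the diagonal action of W_H. *)
Definition typed r H j (f : 'M[K]_(d, r)) :=
  forall w, w \in pt_stab rV H -> act w f = cst (\det (rV w)) ^ j *: f.

Section Local.
Variables (q : nat) (H : {vspace 'cV[C]_n}) (HH : H \in hyps).
Implicit Types f h : 'M[K]_(d, q).

Lemma locmx0 p r : locmx H (0 : 'M[K]_(p, r)).
Proof. by move=> i k; rewrite mxE; apply: (locreg0 formsP). Qed.

Lemma locmxD p r (f h : 'M[K]_(p, r)) : locmx H f -> locmx H h -> locmx H (f + h).
Proof. by move=> rf rh i k; rewrite mxE; apply: (locregD formsP). Qed.

Lemma locmxZ p r (c : K) (f : 'M[K]_(p, r)) : locreg H c -> locmx H f -> locmx H (c *: f).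
Proof. by move=> rc rf i k; rewrite mxE; apply: (locregM formsP). Qed.

Lemma locmxN p r (f : 'M[K]_(p, r)) : locmx H f -> locmx H (- f).
Proof. by move=> rf i k; rewrite mxE; apply: (locregN formsP). Qed.

Lemma locmxB p r (f h : 'M[K]_(p, r)) : locmx H f -> locmx H h -> locmx H (f - h).
Proof. by move=> rf rh; apply: locmxD => //; apply: locmxN. Qed.

Lemma locmx_sum p r (I : Type) (s : seq I) (P : pred I) (F : I -> 'M[K]_(p, r)) :
  (forall i, P i -> locmx H (F i)) -> locmx H (\sum_(i <- s | P i) F i).
Proof. by move=> rF; apply: (big_ind (locmx H)) => //; [apply: locmx0 | apply: locmxD]. Qed.

Lemma locmxM p r s (f : 'M[K]_(p, r)) (h : 'M[K]_(r, s)) :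
  locmx H f -> locmx H h -> locmx H (f *m h).
Proof.
by move=> rf rh i k; rewrite mxE; apply: (locreg_sum formsP) => // l _; apply: (locregM formsP).
Qed.

Lemma locmx_cmx p r (A : 'M[C]_(p, r)) : locmx H (cmx A).
Proof. by move=> i k; rewrite mxE; apply: (locreg_cst formsP). Qed.

Lemma locmx_dmx p r xi (f : 'M[K]_(p, r)) : locmx H f -> locmx H (dmx xi f).
Proof. by move=> rf i k; rewrite mxE; apply: (locreg_dK formsP). Qed.

Lemma Fil_act m w f : w \in W -> Fil H m f -> Fil (hmove w H) m (act w f).
Proof.
move=> wW Ff i k; have [c c0 [e _]] := wK_aK formsP K wW HH.
have HH' := hmove_hyps wW HH; have a0 := aK_neq0 formsP K HH'.
have -> : aK (hmove w H) ^ (- m) *: act w f = cst c ^ m *: act w (aK H ^ (- m) *: f).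
  rewrite actZ scalerA; congr (_ *: _).
  have -> : wK w (aK H ^ (- m)) = (cst c * aK (hmove w H)) ^ (- m).
    by rewrite rmorphXz ?unitfE ?(aK_neq0 formsP) // e.
  by rewrite expfzMl mulrA -expfzDr ?fmorph_eq0 // subrr mul1r.
rewrite -rmorphXz ?unitfE // mxE; apply: (locregM formsP) => //; first exact: (locreg_cst formsP).
rewrite mxE; apply: (locreg_sum formsP) => // l _; apply: (locregM formsP) => //.
  by rewrite mxE; apply: (locreg_cst formsP).
by rewrite mxE; apply: (locreg_wK formsP).
Qed.

Lemma Fil_shift p r m l (f : 'M[K]_(p, r)) : Fil H m f -> Fil H (m + l) (aK H ^ l *: f).
Proof.
rewrite /Fil scalerA -expfzDr ?(aK_neq0 formsP) //.
by have -> : - (m + l) + l = - m by ring.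
Qed.

Lemma Fil_le p r m l (f : 'M[K]_(p, r)) : l <= m -> Fil H m f -> Fil H l f.
Proof.
move=> lm Ff; rewrite /Fil.
have -> : aK H ^ (- l) *: f = aK H ^ (m - l) *: (aK H ^ (- m) *: f).
  by rewrite scalerA -expfzDr ?(aK_neq0 formsP) //; have -> : m - l - m = - l by ring.
apply: locmxZ => //; move: lm; rewrite -subr_ge0; case: (m - l) => // k _.
by rewrite -exprnP; apply: (locregX formsP) => //; apply: (locreg_toK formsP).
Qed.

Lemma FilD p r m (f h : 'M[K]_(p, r)) : Fil H m f -> Fil H m h -> Fil H m (f + h).
Proof. by move=> Ff Fh; rewrite /Fil scalerDr; apply: locmxD. Qed.

Lemma FilZ p r m (c : K) (f : 'M[K]_(p, r)) : locreg H c -> Fil H m f -> Fil H m (c *: f).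
Proof.
by move=> rc Ff; rewrite /Fil scalerA mulrC -scalerA; apply: locmxZ.
Qed.

Lemma Fil0 p r m : Fil H m (0 : 'M[K]_(p, r)).
Proof. by rewrite /Fil scaler0; apply: locmx0. Qed.

Lemma Fil_sum p r m (I : Type) (s : seq I) (P : pred I) (F : I -> 'M[K]_(p, r)) :
  (forall i, P i -> Fil H m (F i)) -> Fil H m (\sum_(i <- s | P i) F i).
Proof. by move=> rF; apply: (big_ind (Fil H m)) => //; [apply: Fil0 | apply: FilD]. Qed.

End Local.
End Operators.

End Operators.
Import Operators.

(** * Leading terms along a hyperplane *)

Module LocalExpansion.

Section LocalAnalysis.
Variables (C : numClosedFieldType) (gT : finGroupType) (W : {group gT}).
Variables (n : nat) (rV : mx_representation C W n).
Variable alpha : {vspace 'cV[C]_n} -> 'Hom('cV[C]_n, C^o).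
Hypothesis faithful : mx_faithful rV.
Hypothesis formsP : is_hyperplane_forms rV alpha.
Variable K : ratfield C n.
Variables (d : nat) (tau : mx_representation C W d).

Local Notation hyps := (hyperplanes rV).
Local Notation cst := (cst K).
Local Notation aK := (aK alpha K).
Local Notation om := (om alpha K).
Local Notation wK := (wK rV K).
Local Notation act := (act rV (K := K) tau).
Local Notation nab := (nab rV alpha (K := K) tau).
Local Notation AH := (AH rV tau).
Local Notation bet := (bet rV).
Local Notation bz := (bz rV).
Local Notation typed := (typed rV (K := K) tau).
Local Notation Fil := (Fil alpha (K := K)).
Local Notation locmx := (locmx alpha (K := K)).
Local Notation locreg := (locreg alpha (K := K)).
Local Notation cmx := (cmx K).

Implicit Types (H : {vspace 'cV[C]_n}) (w g : gT) (x xi eta v : 'cV[C]_n).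
Implicit Types (a b : {vspace 'cV[C]_n} -> nat -> C) (m j l : int).

Section OneHyperplane.
Variables (q : nat) (H : {vspace 'cV[C]_n}) (HH : H \in hyps).
Implicit Types f h : 'M[K]_(d, q).

Let aK0 : aK H != 0. Proof. exact: (aK_neq0 formsP K HH). Qed.

Lemma nab_pow b xi m f :
  aK H ^ (- m) *: nab b xi f =
  nab b xi (aK H ^ (- m) *: f) + (m%:~R * om H xi) *: (aK H ^ (- m) *: f).
Proof.
rewrite nabZ addrAC scalerA -scalerDl dKXz // dK_aK rmorphN /om.
suff -> : - m%:~R * (aK H ^ (- m) / aK H) * cst (alpha H xi) +
   m%:~R * (cst (alpha H xi) / aK H) * aK H ^ (- m) = 0 by rewrite scale0r add0r.
by ring.
Qed.

Lemma locmx_nab b xi f : locmx H f ->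
  locmx H (nab b xi f - om H xi *: (cmx (AH b H) *m f)).
Proof.
move=> rf; rewrite /nab (bigD1_seq H) ?hyps_uniq //= addrCA addrAC subrr add0r.
apply: (locmxD formsP HH); first exact: (locmx_dmx formsP HH).
rewrite big_seq_cond; apply: (locmx_sum formsP HH) => H' /andP[H'h ne].
apply: (locmxZ formsP HH).
  by apply: (locreg_om formsP) => // e; rewrite e eqxx in ne.
by apply: (locmxM formsP HH) => //; apply: (locmx_cmx formsP K HH).
Qed.

Lemma om_tangent xi : alpha H xi = 0 -> om H xi = 0.
Proof. by move=> e; rewrite /om e rmorph0 mul0r. Qed.

Lemma Fil_nab_tangent b xi m f : alpha H xi = 0 -> Fil H m f -> Fil H m (nab b xi f).
Proof.
move=> e Ff; rewrite /Operators.Fil nab_pow om_tangent // mulr0 scale0r addr0.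
by have := locmx_nab b xi Ff; rewrite om_tangent // scale0r subr0.
Qed.

(** The logarithmic version of nabla_v. It does not lower the order along H ([Fil_theta]), so it has
    local exponents on leading terms. *)
Definition theta b v f := aK H *: nab b v f.

Lemma aK_om xi : aK H * om H xi = cst (alpha H xi).
Proof. by rewrite /om mulrC divfK. Qed.

Lemma theta_pow b v m f :
  aK H ^ (- m) *: theta b v f =
  aK H *: (nab b v (aK H ^ (- m) *: f) - om H v *: (cmx (AH b H) *m (aK H ^ (- m) *: f)))
  + cst (alpha H v) *: (m%:~R *: (aK H ^ (- m) *: f) + cmx (AH b H) *m (aK H ^ (- m) *: f)).
Proof.
rewrite /theta scalerA mulrC -scalerA nab_pow; move: (_ *: f) => h.
rewrite -aK_om -[(aK H * _) *: _]scalerA -scalerDr; congr (_ *: _).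
by rewrite scalerDr addrACA [- _ + _]addrC subrr addr0 scalerA [om H v * _]mulrC.
Qed.

Lemma Fil_theta b v m f : Fil H m f -> Fil H m (theta b v f).
Proof.
move=> Ff; rewrite /Operators.Fil theta_pow; apply: (locmxD formsP HH).
  by apply: (locmxZ formsP HH); [exact: (locreg_toK formsP) | exact: locmx_nab].
apply: (locmxZ formsP HH); first exact: (locreg_cst formsP).
apply: (locmxD formsP HH); last by apply: (locmxM formsP HH) => //; apply: (locmx_cmx formsP K HH).
apply: (locmxZ formsP HH) => //; rewrite -(rmorph_int cst); exact: (locreg_cst formsP).
Qed.

Lemma act_pow m w f : w \in pt_stab rV H ->
  act w (aK H ^ (- m) *: f) = cst (\det (rV w)) ^ m *: (aK H ^ (- m) *: act w f).
Proof.
move=> wH; have dw : cst (\det (rV w)) != 0.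
  by rewrite fmorph_eq0 det_neq0 ?(pt_stab_sub wH).
rewrite actZ scalerA; congr (_ *: _).
rewrite rmorphXz ?unitfE // (wK_aK_stab formsP) // expfzMl; congr (_ * _).
by rewrite exprz_inv opprK.
Qed.

(* On the leading coefficient of [f], of order [m] along [H], the group acts
   through the values only; type [j] forces the values into type [j + m]. *)
Lemma typed_lead b m j f : typed H j f -> Fil H m f ->
  locmx H ((aK H)^-1 *: (cmx (AH b H) *m (aK H ^ (- m) *: f)
    - cst ((n_ rV H)%:R * bz b H (j + m)) *: (aK H ^ (- m) *: f))).
Proof.
move=> tf; rewrite /Operators.Fil; set h := _ *: f => rh.
have acth w : w \in pt_stab rV H -> act w h = cst (\det (rV w)) ^ (j + m) *: h.
  move=> wH; have dw : cst (\det (rV w)) != 0.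
    by rewrite fmorph_eq0 det_neq0 ?(pt_stab_sub wH).
  rewrite act_pow // tf // /h !scalerA expfzDr //; congr (_ *: _).
  by rewrite mulrAC [_ ^ m * _]mulrC.
move: h rh acth => h rh acth.
have one w : w \in pt_stab rV H ->
    locmx H ((aK H)^-1 *: (cmx (tau w) *m h - cst (\det (rV w) ^ (j + m)) *: h)).
  move=> wH; have dw : \det (rV w) \is a GRing.unit.
    by rewrite unitfE det_neq0 ?(pt_stab_sub wH).
  rewrite rmorphXz // -acth // /Operators.act -mulmxBr.
  rewrite scalemxAr; apply: (locmxM formsP HH); first exact: (locmx_cmx formsP K HH).
  move=> i k; rewrite !mxE mulrC -opprB mulNr.
  apply: (locregN formsP HH); apply: (locreg_diff formsP) => //.
have -> : cmx (AH b H) *m h - cst ((n_ rV H)%:R * bz b H (j + m)) *: h =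
    \sum_(w in pt_stab rV H) cst (bet b H w) *:
      (cmx (tau w) *m h - cst (\det (rV w) ^ (j + m)) *: h).
  rewrite AHE /Operators.cmx raddf_sum mulmx_suml -(bet_sum faithful formsP) // raddf_sum.
  rewrite scaler_suml -sumrB; apply: eq_bigr => w wH /=.
  by rewrite map_mxZ -scalemxAl scalerBr scalerA rmorphM.
rewrite scaler_sumr; apply: (locmx_sum formsP HH) => w wH.
rewrite scalerA mulrC -scalerA; apply: (locmxZ formsP HH); first exact: (locreg_cst formsP).
exact: one.
Qed.

(** On a leading term of order m the operator acts as alpha_H(v) times m plus the residue of the
    connection, and [typed_lead] makes this residue the scalar n_H b_{H,j+m}. Subtracting the local
    exponent therefore raises the order. *)
Lemma theta_lead b v m j f : typed H j f -> Fil H m f ->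
  Fil H (m + 1) (theta b v f - cst (alpha H v * (m%:~R + (n_ rV H)%:R * bz b H (j + m))) *: f).
Proof.
move=> tf Ff; rewrite /Operators.Fil.
have -> : aK H ^ (- (m + 1)) = (aK H)^-1 * aK H ^ (- m).
  by rewrite opprD expfzDr // mulrC exprN1.
rewrite -scalerA scalerBr theta_pow.
set h := aK H ^ (- m) *: f; set A := cmx _ *m h.
have -> : aK H ^ (- m) *: (cst (alpha H v * (m%:~R + (n_ rV H)%:R * bz b H (j + m))) *: f)
   = cst (alpha H v) *: (m%:~R *: h + cst ((n_ rV H)%:R * bz b H (j + m)) *: h).
  rewrite scalerA mulrC -scalerA -/h rmorphM -scalerA -scalerDl rmorphD.
  by rewrite (rmorph_int cst).
rewrite -addrA -scalerBr opprD addrACA subrr add0r scalerDr.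
apply: (locmxD formsP HH).
  by rewrite scalerA mulVf // scale1r; apply: locmx_nab.
rewrite scalerA mulrC -scalerA; apply: (locmxZ formsP HH); first exact: (locreg_cst formsP).
exact: typed_lead.
Qed.

End OneHyperplane.


Definition delta : {mpoly C[n]} := \prod_(H <- hyps) lform alpha H.

Lemma toK_delta : toK K delta = \prod_(H <- hyps) aK H.
Proof. by rewrite rmorph_prod. Qed.

Lemma delta_neq0 : delta != 0.
Proof. by rewrite prodf_seq_neq0; apply/allP => H HH /=; apply: (lform_neq0 formsP). Qed.

Lemma toK_delta_neq0 : toK K delta != 0.
Proof. by rewrite toK_eq0 delta_neq0. Qed.

(** The denominator is cleared factor by factor: regularity along H makes P divisible by the prime
    alpha_H. *)
Lemma locreg_poly_prod (s : seq {vspace 'cV[C]_n}) (f : K) P : {subset s <= hyps} ->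
  (forall H, H \in hyps -> locreg H f) ->
  \prod_(H <- s) aK H * f = toK K P -> exists P', f = toK K P'.
Proof.
move=> sh lf; elim: s sh P => [|H s IH] sh P.
  by rewrite big_nil mul1r; exists P.
rewrite big_cons -mulrA; set g := _ * f => e.
have HH : H \in hyps by apply: sh; rewrite mem_head.
have [P2 [Q [nQ eQ]]] : locreg H g.
  apply: (locregM formsP) => //; last exact: lf.
  by rewrite -(rmorph_prod (toK K)); apply: (locreg_toK formsP).
have vP : vanish alpha H (P * Q).
  exists P2; apply: (@toK_inj _ _ K); rewrite !rmorphM /= -e -eQ mulrA.
  by [].
have [[P' eP']|//] := vanishM formsP HH vP.
apply: (IH _ P') => [H' H's|]; first by apply: sh; rewrite inE H's orbT.
apply: (mulfI (aK_neq0 formsP K HH)); rewrite e eP' rmorphM; by [].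
Qed.

Lemma locreg_poly N (f : K) P : (forall H, H \in hyps -> locreg H f) ->
  toK K delta ^+ N * f = toK K P -> exists P', f = toK K P'.
Proof.
move=> lf; elim: N P => [|N IH] P; first by rewrite expr0 mul1r; exists P.
rewrite exprS -mulrA toK_delta => e; have [||P' e'] := locreg_poly_prod _ _ e.
- by [].
- move=> H HH; apply: (locregM formsP) => //; last exact: lf.
  by apply: (locregX formsP) => //; rewrite -toK_delta; apply: (locreg_toK formsP).
by apply: (IH P'); rewrite toK_delta.
Qed.

Lemma euler_om H xi : H \in hyps -> euler (om H xi) = - om H xi.
Proof.
move=> HH; have a0 := aK_neq0 formsP K HH; apply: (mulIf a0).
have := eulerM (om H xi) (aK H); rewrite [om H xi * aK H]mulrC aK_om // euler_cst euler_aK.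
by move/esym/eqP; rewrite addr_eq0 mulNr => /eqP.
Qed.

Lemma dK_om H xi eta : H \in hyps ->
  dK K xi (om H eta) = - (cst (alpha H xi) * cst (alpha H eta) / aK H ^+ 2).
Proof.
move=> HH; rewrite /LocalRing.om dKM dK_cst mul0r add0r dKV ?(aK_neq0 formsP) // dK_aK.
have a0 := aK_neq0 formsP K HH.
by field.
Qed.

(** * Flatness of the connection *)

Section Flatness.
Variable b : {vspace 'cV[C]_n} -> nat -> C.
Hypothesis ib : invmult rV b.

Definition conn xi : 'M[K]_d := \sum_(H <- hyps) om H xi *: cmx (AH b H).

Lemma nabE q xi (f : 'M[K]_(d, q)) : nab b xi f = dmx xi f + conn xi *m f.
Proof.
by rewrite /Operators.nab /conn mulmx_suml; congr (_ + _); apply: eq_bigr => H _; rewrite scalemxAl.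
Qed.

Lemma conn_lin (c : C) xi eta : conn (c *: xi + eta) = cst c *: conn xi + conn eta.
Proof.
rewrite /conn scaler_sumr -big_split; apply: eq_bigr => H _ /=.
by rewrite scalerA -scalerDl; congr (_ *: _);
  rewrite /LocalRing.om linearP rmorphD rmorphM /= mulrDl mulrA.
Qed.

Lemma conn_act w xi : w \in W ->
  cmx (tau w) *m map_mx (wK w) (conn xi) = conn (rV w *m xi) *m cmx (tau w).
Proof.
move=> wW; rewrite /conn mulmx_suml -[RHS](hmove_sum rV _ wW).
rewrite (raddf_sum (map_mx (wK w))) mulmx_sumr !big_seq; apply: eq_bigr => H HH /=.
rewrite map_mxZ wK_om // -scalemxAr -scalemxAl; congr (_ *: _).
by rewrite map_wK_cmx // -!map_mxM AH_conj.
Qed.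

Lemma locmx_conn H xi : H \in hyps -> alpha H xi = 0 -> locmx H (conn xi).
Proof.
move=> HH e; rewrite /conn big_seq; apply: (locmx_sum formsP HH) => H' HH'.
apply: (locmxZ formsP HH); last exact: (locmx_cmx formsP K HH).
have [<-|ne] := eqVneq H H'; first by rewrite om_tangent //; apply: (locreg0 formsP).
by apply: (locreg_om formsP) => //; apply/eqP.
Qed.

Lemma locmx_conn_sub H xi : H \in hyps -> locmx H (conn xi - om H xi *: cmx (AH b H)).
Proof.
move=> HH; rewrite /conn (bigD1_seq H) ?hyps_uniq //= addrAC subrr add0r.
rewrite big_seq_cond; apply: (locmx_sum formsP HH) => H' /andP[HH' ne].
apply: (locmxZ formsP HH); last exact: (locmx_cmx formsP K HH).
by apply: (locreg_om formsP) => // e; rewrite e eqxx in ne.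
Qed.

Lemma cmx_AHE H : cmx (AH b H) = \sum_(w in pt_stab rV H) cst (bet b H w) *: cmx (tau w).
Proof.
rewrite AHE /Operators.cmx (raddf_sum (map_mx cst)); apply: eq_bigr => w _ /=.
by rewrite map_mxZ.
Qed.

(* The orbit sums in [conn xi] commute with the stabilizer of [H] modulo
   [alpha H], because the stabilizer fixes [xi] and the points of [H]. *)
Lemma locmx_comm_AH H xi : H \in hyps -> alpha H xi = 0 ->
  locmx H ((aK H)^-1 *: (cmx (AH b H) *m conn xi - conn xi *m cmx (AH b H))).
Proof.
move=> HH e; rewrite cmx_AHE mulmx_suml mulmx_sumr -sumrB scaler_sumr.
apply: (locmx_sum formsP HH) => w wH; rewrite -scalemxAl -scalemxAr -scalerBr.
rewrite scalerA mulrC -scalerA; apply: (locmxZ formsP HH); first exact: (locreg_cst formsP).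
have wW := pt_stab_sub wH.
have wxi : rV w *m xi = xi.
  by have /pt_stabP[_ ->] := wH; rewrite // (mem_hyp formsP) // e eqxx.
have /esym := conn_act xi wW; rewrite wxi => ->; rewrite -mulmxBr scalemxAr.
apply: (locmxM formsP HH); first exact: (locmx_cmx formsP K HH).
move=> i k; rewrite !mxE mulrC -opprB mulNr.
by apply: (locregN formsP HH); apply: (locreg_diff formsP) => //; apply: locmx_conn.
Qed.

Definition curv xi eta : 'M[K]_d := conn xi *m conn eta - conn eta *m conn xi.

(** Only the term of H in [conn v] is singular along H, and its contribution is the commutator
    treated in [locmx_comm_AH]. *)
Lemma locmx_curv_tangent H v xi : H \in hyps -> alpha H xi = 0 -> locmx H (curv v xi).
Proof.
move=> HH e; have -> : curv v xi =
   cst (alpha H v) *: ((aK H)^-1 *: (cmx (AH b H) *m conn xi - conn xi *m cmx (AH b H)))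
   + ((conn v - om H v *: cmx (AH b H)) *m conn xi
      - conn xi *m (conn v - om H v *: cmx (AH b H))).
  rewrite /curv scalerA -/(LocalRing.om _ _ _ _) mulmxBl mulmxBr scalerBr -scalemxAl -scalemxAr.
  move: (conn v *m _) (_ *m conn v) (om H v *: (_ *m conn _)) (om H v *: (conn _ *m _)).
  by move=> A1 A2 A3 A4; apply/matrixP => i k; rewrite !mxE; ring.
apply: (locmxD formsP HH).
  by apply: (locmxZ formsP HH); [exact: (locreg_cst formsP) | exact: locmx_comm_AH].
have c1 := locmx_conn HH e; have c2 := locmx_conn_sub v HH.
by apply: (locmxB formsP HH); apply: (locmxM formsP HH).
Qed.

Lemma curv_lin (c : C) xi eta zeta :
  curv (c *: xi + eta) zeta = cst c *: curv xi zeta + curv eta zeta.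
Proof.
rewrite /curv conn_lin mulmxDl mulmxDr -scalemxAl -scalemxAr scalerBr.
by rewrite opprD addrACA.
Qed.

Lemma curvN xi eta : curv xi eta = - curv eta xi.
Proof. by rewrite /curv opprB. Qed.

Lemma curvxx xi : curv xi xi = 0.
Proof. exact: subrr. Qed.

(** The curvature is bilinear and alternating, so splitting both arguments along v and H leaves only
    terms with an argument tangent to H. *)
Lemma locmx_curv H xi eta : H \in hyps -> locmx H (curv xi eta).
Proof.
move=> HH; have [v av] := alpha_neq0 formsP HH.
have dec x : exists2 y, alpha H y = 0 & x = alpha H x *: v + y.
  exists (x - alpha H x *: v); last by rewrite addrC subrK.
  by rewrite linearB linearZ /= av /GRing.scale /= mulr1 subrr.
have [xi' ex ->] := dec xi; have [eta' ee ->] := dec eta.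
rewrite curv_lin; apply: (locmxD formsP HH); last first.
  by rewrite curvN; apply: (locmxN formsP HH); apply: locmx_curv_tangent.
apply: (locmxZ formsP HH); first exact: (locreg_cst formsP).
by rewrite curvN curv_lin curvxx scaler0 add0r -curvN; apply: locmx_curv_tangent.
Qed.

(** Without a pole along any hyperplane the commutator is polynomial; it is homogeneous of degree
    -2, hence zero. This replaces the usual computation at intersections of codimension two. *)
Lemma curv0 xi eta : curv xi eta = 0.
Proof.
apply/matrixP => i k; rewrite [RHS]mxE.
have lc H : H \in hyps -> locreg H (curv xi eta i k) by move=> HH; apply: locmx_curv.
have toP : exists P, toK K delta ^+ 2 * curv xi eta i k = toK K P.
  have toC z i' k' : exists P, toK K delta * conn z i' k' = toK K P.
    rewrite /conn summxE mulr_sumr big_seq; apply: (big_ind (fun f => exists P, f = toK K P)).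
    - by exists 0; rewrite rmorph0.
    - by move=> _ _ [P ->] [Q ->]; exists (P + Q); rewrite rmorphD.
    move=> H HH; exists ((\prod_(H' <- hyps | H' != H) lform alpha H') *
      (alpha H z * AH b H i' k')%:MP).
    rewrite toK_delta (bigD1_seq H) ?hyps_uniq //= !mxE rmorphM rmorph_prod -cstE rmorphM.
    by rewrite -mulrA mulrCA [aK H * _]mulrA aK_om.
  have toD z t : exists P, toK K delta ^+ 2 * (conn z *m conn t) i k = toK K P.
    rewrite mxE mulr_sumr; apply: (big_ind (fun f => exists P, f = toK K P)).
    - by exists 0; rewrite rmorph0.
    - by move=> _ _ [P ->] [Q ->]; exists (P + Q); rewrite rmorphD.
    move=> j _; have [P eP] := toC z i j; have [Q eQ] := toC t j k.
    by exists (P * Q); rewrite rmorphM -eP -eQ expr2 mulrACA.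
  have [P eP] := toD xi eta; have [Q eQ] := toD eta xi.
  exists (P - Q); rewrite rmorphB -eP -eQ -mulrBr /curv; congr (_ * _).
  by move: (conn xi *m _) (conn eta *m _) => A B; rewrite !mxE.
have [P eP] := toP; have [P' eP'] := locreg_poly lc eP.
apply/eqP; rewrite eP' toK_eq0; apply/negPn/negP => P0.
have econn z : emx (conn z) = - conn z.
  apply/matrixP => i' k'; rewrite !mxE !summxE raddf_sum -sumrN !big_seq.
  by apply: eq_bigr => H HH; rewrite /= !mxE eulerM euler_cst mulr0 addr0 euler_om // mulNr.
have emxM (A B : 'M[K]_d) : emx (A *m B) = emx A *m B + A *m emx B.
  apply/matrixP => i' k'; rewrite !mxE raddf_sum -big_split; apply: eq_bigr => j _ /=.
  by rewrite eulerM !mxE.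
have eC : emx (curv xi eta) = cst (- 2%:R) *: curv xi eta.
  rewrite rmorphN rmorph_nat scaleNr scaler_nat /curv /Operators.emx map_mxB.
  rewrite -!/(Operators.emx _) !emxM !econn !mulNmx !mulmxN mulr2n.
  move: (conn xi *m _) (conn eta *m _) => A B.
  by apply/matrixP => i' k'; rewrite !mxE; ring.
move: eC eP'; move: (curv xi eta) => M eC eP'.
have := congr1 (fun M : 'M_d => M i k) eC; rewrite !mxE eP' => /euler_toK /(_ P0) [m e _].
have : (m + 2)%:R = 0 :> C by rewrite natrD -e addNr.
by move/eqP; rewrite pnatr_eq0 addn2.
Qed.

Lemma nab_comm q xi eta (f : 'M[K]_(d, q)) :
  nab b xi (nab b eta f) = nab b eta (nab b xi f).
Proof.
have dconn z t : dmx z (conn t) = dmx t (conn z).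
  apply/matrixP => i k; rewrite !mxE !summxE !raddf_sum !big_seq; apply: eq_bigr => H HH /=.
  rewrite !mxE [om H t * _]mulrC [om H z * _]mulrC [LHS]dKZ [RHS]dKZ !dK_om //.
  by rewrite [cst (alpha H z) * _]mulrC.
have := curv0 xi eta; rewrite /curv => /eqP; rewrite subr_eq0 => /eqP cc.
rewrite !nabE !dmxD !dmx_mul dmx_comm dconn !mulmxDr !mulmxA cc.
by rewrite -!addrA; do 2!congr (_ + _); rewrite addrCA.
Qed.

End Flatness.
End LocalAnalysis.

End LocalExpansion.
Import LocalExpansion.

(** * Bounded poles of iterated local Dunkl derivatives *)

Module LocalModule.

Section LocalAnalysis.
Variables (C : numClosedFieldType) (gT : finGroupType) (W : {group gT}).
Variables (n : nat) (rV : mx_representation C W n).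
Variable alpha : {vspace 'cV[C]_n} -> 'Hom('cV[C]_n, C^o).
Hypothesis faithful : mx_faithful rV.
Hypothesis formsP : is_hyperplane_forms rV alpha.
Variable K : ratfield C n.
Variables (d : nat) (tau : mx_representation C W d).

Local Notation hyps := (hyperplanes rV).
Local Notation cst := (cst K).
Local Notation aK := (aK alpha K).
Local Notation om := (om alpha K).
Local Notation wK := (wK rV K).
Local Notation hmove := (hmove rV).
Local Notation act := (act rV (K := K) tau).
Local Notation nab := (nab rV alpha (K := K) tau).
Local Notation RH := (RH rV (K := K) tau).
Local Notation bet := (bet rV).
Local Notation bz := (bz rV).
Local Notation locdunkl := (locdunkl rV alpha (K := K) tau).
Local Notation typed := (typed rV (K := K) tau).
Local Notation Fil := (Fil alpha (K := K)).
Local Notation locreg := (locreg alpha (K := K)).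

Implicit Types (H : {vspace 'cV[C]_n}) (w g : gT) (x xi eta v : 'cV[C]_n).
Implicit Types (a b : {vspace 'cV[C]_n} -> nat -> C) (m j l : int).

Variables (a : {vspace 'cV[C]_n} -> nat -> C) (k : {vspace 'cV[C]_n} -> nat -> int).
Local Notation b := (fun H i => a H i + (k H i)%:~R).
Hypothesis ia : invmult rV a.
Hypothesis ib : invmult rV b.
Variable B : nat.
Hypothesis kB : forall H i, H \in hyps -> (i < n_ rV H)%N -> ((n_ rV H)%:Z * `|k H i| <= B%:Z)%R.

Lemma nab_scale_dir q c (x : C) xi (f : 'M[K]_(d, q)) :
  nab c (x *: xi) f = cst x *: nab c xi f.
Proof.
have := nab_lin rV alpha tau c 1 0 0 f; rewrite scale1r addr0 rmorph1 scale1r => n0.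
have n00 : nab c 0 f = 0 by apply: (addIr (nab c 0 f)); rewrite -n0 add0r.
by have := nab_lin rV alpha tau c x xi 0 f; rewrite n00 !addr0.
Qed.

(** Singles out the transversal direction on which W_H acts by det; along it the local Dunkl
    operator sends type j to type j + 1. *)
Definition eig H v := forall w, w \in pt_stab rV H -> rV w *m v = \det (rV w) *: v.

Section OneHyperplane.
Variables (q : nat) (H : {vspace 'cV[C]_n}) (HH : H \in hyps).
Variables (v : 'cV[C]_n) (ev : eig H v).
Implicit Types f h : 'M[K]_(d, q).
Local Notation N := (n_ rV H).
Local Notation theta := (theta rV alpha tau H b v).
Local Notation D := (locdunkl a b H v).

Let aK0 : aK H != 0. Proof. exact: (aK_neq0 formsP K HH). Qed.
Let det0 w : w \in pt_stab rV H -> cst (\det (rV w)) != 0.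
Proof. by move=> wH; rewrite fmorph_eq0 det_neq0 ?(pt_stab_sub wH). Qed.

Lemma typedD j f h : typed H j f -> typed H j h -> typed H j (f + h).
Proof. by move=> tf th w wH; rewrite actD tf // th // scalerDr. Qed.

Lemma typedZ j (c : C) f : typed H j f -> typed H j (cst c *: f).
Proof. by move=> tf w wH; rewrite actZc ?(pt_stab_sub wH) // tf // !scalerA mulrC. Qed.

Lemma typed_theta j f : typed H j f -> typed H j (theta f).
Proof.
move=> tf w wH; have wW := pt_stab_sub wH; have d0 := det0 wH.
rewrite /LocalExpansion.theta actZ (wK_aK_stab formsP) // act_nab // tf // ev //.
rewrite -rmorphXz ?unitfE ?det_neq0 // nabZc.
rewrite nab_scale_dir !scalerA; congr (_ *: _).
by field.
Qed.

Lemma RH_typed c j f : typed H j f -> RH c H f = cst (N%:R * bz c H j) *: f.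
Proof.
move=> tf; rewrite -(bet_sum faithful formsP) // rmorph_sum scaler_suml.
apply: eq_bigr => w wH; rewrite tf // scalerA rmorphM rmorphXz //.
by rewrite unitfE det_neq0 ?(pt_stab_sub wH).
Qed.

Definition fac j (t : int) f : 'M[K]_(d, q) :=
  theta f - cst (alpha H v * (t%:~R + N%:R * bz a H (j + t))) *: f.

Lemma typed_fac j l t f : typed H j f -> typed H j (fac l t f).
Proof.
move=> tf; rewrite /fac -scaleNr -rmorphN; apply: typedD; first exact: typed_theta.
exact: typedZ.
Qed.

Lemma Fil_fac j m t f : Fil H m f -> Fil H m (fac j t f).
Proof.
move=> Ff; rewrite /fac -scaleNr -rmorphN; apply: (FilD formsP HH).
  exact: (Fil_theta formsP tau HH).
by apply: (FilZ formsP HH) => //; apply: (locreg_cst formsP).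
Qed.

Lemma theta_sub (c : C) f h : theta (f - cst c *: h) = theta f - cst c *: theta h.
Proof. by rewrite /LocalExpansion.theta nabB nabZc scalerBr !scalerA [aK H * _]mulrC. Qed.

Lemma facC j t s f : fac j t (fac j s f) = fac j s (fac j t f).
Proof.
rewrite /fac !theta_sub !scalerBr !scalerA.
rewrite [cst (alpha H v * (t%:~R + _)) * cst _]mulrC.
move: (theta f) (theta (theta f)) (_ *: f) => f1 f2 f3.
move: (cst _) (cst _) => c1 c2.
by apply/matrixP => i l; rewrite !mxE; ring.
Qed.

Definition facs j (ts : seq nat) f := foldr (fun t : nat => fac j t) f ts.

Lemma facs_rem j t ts f : t \in ts -> facs j ts f = facs j (rem t ts) (fac j t f).
Proof.
have comm (r : nat) ts' f' : facs j ts' (fac j r f') = fac j r (facs j ts' f').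
  by elim: ts' => //= s ts' ->; rewrite facC.
elim: ts => //= s ts IH; rewrite inE; have [->|ne /= /IH ->] := eqVneq t s.
  by rewrite comm.
by [].
Qed.

Lemma typed_facs j ts f : typed H j f -> typed H j (facs j ts f).
Proof. by move=> tf; elim: ts => //= t ts IH; apply: typed_fac. Qed.

Lemma Fil_facs j m ts f : Fil H m f -> Fil H m (facs j ts f).
Proof. by move=> Ff; elim: ts => //= t ts IH; apply: Fil_fac. Qed.

Lemma typed_pow j (r : nat) f : typed H j f -> typed H (j + r) (aK H ^ (- r%:Z) *: f).
Proof.
move=> tf w wH; rewrite (act_pow formsP) // tf // !scalerA expfzDr ?det0 //.
by congr (_ *: _); rewrite mulrAC [_ ^ r%:Z * _]mulrC.
Qed.

(** On a typed vector the difference term is a scalar ([RH_typed]). After t steps the type is j + t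
    and moving alpha_H^-t past nabla_v contributes -t, so the next step applies [fac j t] and
    divides by alpha_H. *)
Lemma locdunkl_iter j r f : typed H j f ->
  iter r D f = aK H ^ (- r%:Z) *: facs j (rev (iota 0 r)) f.
Proof.
move=> tf; elim: r => [|r IH]; first by rewrite /= expr0z scale1r.
have -> : rev (iota 0 r.+1) = r :: rev (iota 0 r) by rewrite -[r.+1]addn1 iotaD rev_cat.
rewrite iterS IH /=.
set g := facs j _ f; have tg : typed H j g by exact: typed_facs.
rewrite /Operators.locdunkl (RH_typed _ (typed_pow r tg)).
have e := nab_pow formsP tau HH b v r g.
have -> : nab b v (aK H ^ (- r%:Z) *: g) = aK H ^ (- r%:Z) *: nab b v g
    - (r%:~R * om H v) *: (aK H ^ (- r%:Z) *: g).
  by rewrite e addrK.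
have -> : aK H ^ (- (r.+1)%:Z) = aK H ^ (- r%:Z) / aK H.
  by rewrite -exprN1 -expfzDr //; congr (_ ^ _); lia.
have omE : om H v = cst (alpha H v) / aK H by [].
rewrite /fac /LocalExpansion.theta omE !rmorphM rmorphD !(rmorph_int cst) rmorphM.
move: (nab b v g) => h; clear tg e; clearbody g; move: (aK H ^ _) => p.
by apply/matrixP => i l; rewrite !mxE; field.
Qed.

(* [fac j t] improves the order [m] when [t = m + N k_{j + m}]; these values
   of [t] are pairwise distinct since [t = m] modulo [N]. *)
Definition shift j m : int := m + N%:Z * k H `|((j + m) %% N)%Z|%N.

Lemma modz_shift j m : ((j + shift j m) %% N)%Z = ((j + m) %% N)%Z.
Proof. by rewrite /shift addrA addrC [N%:Z * _]mulrC modzMDl. Qed.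

Lemma shift_inj j : injective (shift j).
Proof.
move=> m l e; have em := modz_shift j m; rewrite e modz_shift in em.
by move: e; rewrite /shift em => /addIr.
Qed.

(** The complex part a cancels: with t = [shift j m], the integers j + t and j + m agree modulo n_H,
    so the local exponent m + n_H b_{H,j+m} equals the scalar t + n_H a_{H,j+t} of the factor. *)
Lemma fac_gain j m f : typed H j f -> Fil H m f -> Fil H (m + 1) (fac j (shift j m) f).
Proof.
move=> tf Ff; have := theta_lead faithful formsP HH b v tf Ff.
suff -> : m%:~R + N%:R * bz b H (j + m) = (shift j m)%:~R + N%:R * bz a H (j + shift j m) :> C by [].
rewrite /Operators.bz modz_shift /shift !rmorphD /= rmorphM /= mulrDr.
by rewrite -!addrA; congr (_ + _); rewrite addrC.
Qed.

(** The factors commute, so the one that gains at the present order can be applied first. Distinct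
    orders call for distinct factors by [shift_inj], so those of the later orders remain in the
    list. *)
Lemma facs_gain j (p : nat) m ts f : typed H j f -> Fil H m f -> uniq ts ->
  (forall l : nat, (l < p)%N -> exists2 t : nat, t \in ts & t%:Z = shift j (m + l%:Z)) ->
  Fil H (m + p%:Z) (facs j ts f).
Proof.
elim: p m ts f => [|p IH] m ts f tf Ff uts ht.
  by rewrite addr0; apply: Fil_facs.
have [t tts te] := ht 0%N isT; rewrite addr0 in te.
rewrite (facs_rem _ _ tts).
have -> : m + p.+1%:Z = (m + 1) + p%:Z by lia.
apply: IH; first exact: typed_fac.
- by rewrite te; apply: fac_gain.
- exact: rem_uniq.
move=> l lp; have [s sts se] := ht l.+1 lp; exists s; last by rewrite se; congr shift; lia.
rewrite mem_rem_uniq // inE sts andbT; apply/eqP => st.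
have /shift_inj := etrans (esym se) (etrans (congr1 Posz st) te); lia.
Qed.

Lemma modz_ltn l : (`|(l %% N)%Z|%N < N)%N.
Proof.
have n0 := n_gt0 rV H.
by rewrite -ltz_nat gez0_abs ?ltz_pmod // modz_ge0 // lt0r_neq0.
Qed.

(** Each step loses one order through the prefactor alpha_H^-r and, with at most 2B exceptions, wins
    it back: [shift] displaces an order by at most B. *)
Lemma Fil_iter_typed j r f : typed H j f -> Fil H B f -> Fil H (- B%:Z) (iter r D f).
Proof.
move=> tf Ff; rewrite (locdunkl_iter r tf).
have sh m : `|shift j m - m| <= B%:Z.
  rewrite /shift addrAC subrr add0r normrM; apply: kB => //; exact: modz_ltn.
apply: (Fil_le formsP HH (m := (r%:Z - B%:Z) + - r%:Z)); first by lia.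
apply: (Fil_shift formsP HH); have [le|lt] := leqP (B + B) r; last first.
  by apply: (Fil_le formsP HH (m := B%:Z)); [lia | exact: Fil_facs].
have -> : r%:Z - B%:Z = B%:Z + (r - (B + B))%N%:Z by lia.
apply: facs_gain => //; first by rewrite rev_uniq iota_uniq.
move=> l lr; have := sh (B%:Z + l%:Z); rewrite ler_norml => /andP[s1 s2].
exists `|shift j (B%:Z + l%:Z)|%N; last by lia.
by rewrite mem_rev mem_iota add0n; lia.
Qed.

Lemma locdunklD f h : D (f + h) = D f + D h.
Proof. by rewrite /Operators.locdunkl nabD RHD scalerDr opprD addrACA. Qed.

Lemma iter_locdunklD r f h : iter r D (f + h) = iter r D f + iter r D h.
Proof. by elim: r => //= r ->; rewrite locdunklD. Qed.

Lemma locdunkl0 : D (0 : 'M[K]_(d, q)) = 0.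
Proof. by apply: (addIr (D (0 : 'M[K]_(d, q)))); rewrite -locdunklD !add0r. Qed.

Lemma iter_locdunkl0 r : iter r D (0 : 'M[K]_(d, q)) = 0.
Proof. by elim: r => //= r ->; exact: locdunkl0. Qed.

(** Averaging against the powers of det splits f into the typed parts [p j], to which
    [Fil_iter_typed] applies. *)
Lemma Fil_iter r f : Fil H B f -> Fil H (- B%:Z) (iter r D f).
Proof.
move=> Ff; have N0 : N%:R != 0 :> C by rewrite pnatr_eq0 -lt0n n_gt0.
pose p (j : nat) := cst N%:R^-1 *: \sum_(w in pt_stab rV H) cst (\det (rV w) ^- j) *: act w f.
have fE : f = \sum_(j < N) p j.
  rewrite /p -scaler_sumr exchange_big /=.
  under eq_bigr => w wH do rewrite -scaler_suml -rmorph_sum (det_sum_dual faithful formsP HH wH).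
  rewrite (bigD1 1%g) ?group1 //= eqxx act1 big1 => [|w /andP[_ /negPf ->]]; last first.
    by rewrite rmorph0 scale0r.
  by rewrite addr0 scalerA -rmorphM mulVf // rmorph1 scale1r.
have tp (j : nat) : typed H j%:Z (p j).
  move=> g gH; have gW := pt_stab_sub gH; rewrite actZc // act_sum.
  rewrite [RHS]scalerA mulrC -[RHS]scalerA; congr (_ *: _).
  rewrite scaler_sumr [RHS](reindex_inj (mulgI g)) /=; apply: eq_big => [w|w wH].
    by rewrite groupMl.
  have wW := pt_stab_sub wH; rewrite actZc // -actM // repr_mxM // det_mulmx !scalerA.
  congr (_ *: _); rewrite exprMn invfM rmorphM mulrA -exprnP -rmorphXn -rmorphM.
  by rewrite mulfV ?rmorph1 ?mul1r // expf_neq0 // det_neq0.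
have Fp (j : nat) : Fil H B (p j).
  apply: (FilZ formsP HH); first exact: (locreg_cst formsP).
  apply: (Fil_sum formsP HH) => w wH; apply: (FilZ formsP HH); first exact: (locreg_cst formsP).
  by have := Fil_act formsP tau HH (pt_stab_sub wH) Ff; rewrite hmove_stab.
rewrite fE (big_morph _ (iter_locdunklD r) (iter_locdunkl0 r)).
by apply: (Fil_sum formsP HH) => j _; apply: Fil_iter_typed (tp j) (Fp j).
Qed.

End OneHyperplane.

(* The Dunkl derivatives transversal to H produce poles of order at most B. *)
Definition LL q H (f : 'M[K]_(d, q)) := forall v r, eig H v ->
  Fil H (- B%:Z) (iter r (locdunkl a b H v) f).

Lemma LL_Fil q H (f : 'M[K]_(d, q)) : H \in hyps -> Fil H B f -> LL H f.
Proof. by move=> HH Ff v r ev; apply: Fil_iter. Qed.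

(** W_H contains a reflection, of determinant other than 1, acting trivially on H; so the
    det-eigenspace meets H in 0 and is a line. *)
Lemma eig_line H u v : H \in hyps -> eig H u -> eig H v -> alpha H v = 1 ->
  u = alpha H u *: v.
Proof.
move=> HH eu ev av; apply/eqP; rewrite -subr_eq0; set y := _ - _; apply/eqP.
have yH : y \in H.
  by rewrite (mem_hyp formsP) // linearB linearZ /= av /GRing.scale /= mulr1 subrr.
have [w wR HE] := hypsP rV H HH; move: wR; rewrite inE => /andP[wW _].
have wH : w \in pt_stab rV H by rewrite inE wW HE /= subvv.
have dw : 1 - \det (rV w) != 0.
  rewrite subr_eq0 eq_sym; apply/eqP => /(det_pt_stab_inj faithful formsP HH wH) w1.
  have [x ax] := alpha_neq0 formsP HH.
  have : x \in H by rewrite HE mem_fixedSpace w1 repr_mx1 mul1mx.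
  by rewrite (mem_hyp formsP) // ax oner_eq0.
have : rV w *m y = \det (rV w) *: y.
  by rewrite mulmxBr -scalemxAr eu // ev // scalerBr !scalerA mulrC.
have /pt_stabP[_ ->] := wH; last by [].
move/eqP; rewrite -subr_eq0 -{1}[y]scale1r -scalerBl scaler_eq0 (negPf dw).
by move/eqP.
Qed.

Lemma locdunkl_lin q H (c : C) xi eta (f : 'M[K]_(d, q)) :
  locdunkl a b H (c *: xi + eta) f = cst c *: locdunkl a b H xi f + locdunkl a b H eta f.
Proof.
rewrite /Operators.locdunkl nab_lin scalerBr addrACA scalerA -opprD -scalerDl.
by congr (_ - _ *: _); rewrite /LocalRing.om linearP rmorphD rmorphM /= mulrDl mulrA.
Qed.

Lemma locdunkl_dir0 q H (f : 'M[K]_(d, q)) : locdunkl a b H 0 f = 0.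
Proof.
have := locdunkl_lin H 1 0 0 f; rewrite scale1r addr0 rmorph1 scale1r => e.
by apply: (addIr (locdunkl a b H 0 f)); rewrite -e add0r.
Qed.

Lemma locdunklZ q H v (c : C) (f : 'M[K]_(d, q)) :
  locdunkl a b H v (cst c *: f) = cst c *: locdunkl a b H v f.
Proof. by rewrite /Operators.locdunkl nabZc RHZc scalerBr !scalerA [om _ _ * _]mulrC. Qed.

Lemma LLE q H v (f : 'M[K]_(d, q)) : H \in hyps -> eig H v -> alpha H v = 1 ->
  (forall r, Fil H (- B%:Z) (iter r (locdunkl a b H v) f)) -> LL H f.
Proof.
move=> HH ev av h u r eu; rewrite (eig_line HH eu ev av).
suff -> : iter r (locdunkl a b H (alpha H u *: v)) f
    = cst (alpha H u) ^+ r *: iter r (locdunkl a b H v) f.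
  by apply: (FilZ formsP HH) => //; apply: (locregX formsP) => //; apply: (locreg_cst formsP).
elim: r => [|r IH]; first by rewrite expr0 scale1r.
rewrite !iterS IH -rmorphXn locdunklZ.
have := locdunkl_lin H (alpha H u) v 0 (iter r (locdunkl a b H v) f).
rewrite !addr0 locdunkl_dir0 addr0 => ->.
by rewrite scalerA -rmorphM -exprSr rmorphXn.
Qed.

Lemma LL_locdunkl q H v (f : 'M[K]_(d, q)) : H \in hyps -> eig H v -> alpha H v = 1 ->
  LL H f -> LL H (locdunkl a b H v f).
Proof. by move=> HH ev av h; apply: (LLE HH ev av) => r; rewrite -iterSr; apply: h. Qed.

Lemma LLD q H (f h : 'M[K]_(d, q)) : H \in hyps -> LL H f -> LL H h -> LL H (f + h).
Proof.
move=> HH lf lh v r ev; rewrite iter_locdunklD; apply: (FilD formsP HH); first exact: lf.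
exact: lh.
Qed.

Lemma LL0 q H : H \in hyps -> LL H (0 : 'M[K]_(d, q)).
Proof. by move=> HH v r ev; rewrite iter_locdunkl0; apply: (Fil0 formsP K HH). Qed.

Lemma LL_act q g H (f : 'M[K]_(d, q)) : g \in W -> H \in hyps ->
  LL H f -> LL (hmove g H) (act g f).
Proof.
move=> gW HH lf v r ev; have gV : (g^-1)%g \in W by rewrite groupV.
have -> : iter r (locdunkl a b (hmove g H) v) (act g f) =
    act g (iter r (locdunkl a b H (rV g^-1%g *m v)) f).
  elim: r => // r IH; rewrite !iterS IH act_locdunkl //.
  by rewrite rVKV.
apply: (Fil_act formsP) => //; apply: lf => w wH; have wW := pt_stab_sub wH.
have := ev (w ^ g^-1)%g; rewrite pt_stab_hmove // => /(_ wH).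
rewrite det_conj // conjgE invgK !repr_mxM ?groupM ?groupV // => e.
by rewrite scalemxAr -e -!mulmxA rVK.
Qed.

(** Leibniz rule for the local Dunkl operator D: besides c D f it yields the derivative of c times
    f, and divided differences of c times the w f. These coefficients stay in the local ring and
    these vectors in the module, so induction on r closes. *)
Lemma LLZ q H (c : K) (f : 'M[K]_(d, q)) : H \in hyps -> locreg H c -> LL H f -> LL H (c *: f).
Proof.
move=> HH rc lf; have [v av ev] := eigenvector_exists formsP HH.
apply: (LLE HH ev av) => r; elim: r c f rc lf => [|r IH] c f rc lf.
  by apply: (FilZ formsP HH) => //; apply: (lf v 0%N).
have e : locdunkl a b H v (c *: f) = c *: locdunkl a b H v f + dK K v c *: f -
   \sum_(w in pt_stab rV H) (cst (bet a H w) * ((wK w c - c) / aK H)) *: act w f.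
  have -> : locdunkl a b H v (c *: f) =
      dK K v c *: f + c *: nab b v f - om H v *: RH a H (c *: f) by rewrite -nabZ.
  have -> : om H v *: RH a H (c *: f) = c *: (om H v *: RH a H f) +
      \sum_(w in pt_stab rV H) (cst (bet a H w) * ((wK w c - c) / aK H)) *: act w f.
    rewrite /Operators.RH !scaler_sumr -big_split; apply: eq_bigr => w wH /=.
    rewrite actZ !scalerA -scalerDl /LocalRing.om av rmorph1 mul1r; congr (_ *: _).
    by ring.
  rewrite /Operators.locdunkl scalerBr opprD !addrA; congr (_ - _).
  by rewrite [in RHS]addrAC [c *: _ + _]addrC.
rewrite iterSr e -scaleN1r -(rmorph1 cst) -rmorphN iter_locdunklD.
have h1 : Fil H (- B%:Z) (iter r (locdunkl a b H v) (c *: locdunkl a b H v f + dK K v c *: f)).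
  rewrite iter_locdunklD; apply: (FilD formsP HH); apply: IH => //.
    exact: LL_locdunkl.
  exact: (locreg_dK formsP).
apply: (FilD formsP HH) => //; rewrite scaler_sumr.
rewrite (big_morph _ (iter_locdunklD H v r) (iter_locdunkl0 q H v r)).
apply: (Fil_sum formsP HH) => w wH; rewrite scalerA; apply: IH.
  apply: (locregM formsP) => //; first exact: (locreg_cst formsP).
  by apply: (locregM formsP) => //; [exact: (locreg_cst formsP) | apply: (locreg_diff formsP)].
by have := LL_act (pt_stab_sub wH) HH lf; rewrite hmove_stab.
Qed.

Lemma RH_nab q H xi (f : 'M[K]_(d, q)) : H \in hyps -> alpha H xi = 0 ->
  RH a H (nab b xi f) = nab b xi (RH a H f).
Proof.
move=> HH e; rewrite /Operators.RH nab_sum; apply: eq_bigr => w wH.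
rewrite nabZc act_nab ?(pt_stab_sub wH) //.
by have /pt_stabP[_ ->] := wH; rewrite // (mem_hyp formsP) // e eqxx.
Qed.

(** nabla_xi commutes with nabla_v by flatness, and with the difference term because W_H fixes xi
    and alpha_H is constant along xi. *)
Lemma LL_nab q H xi (f : 'M[K]_(d, q)) : H \in hyps -> alpha H xi = 0 ->
  LL H f -> LL H (nab b xi f).
Proof.
move=> HH e lf v r ev.
suff -> : iter r (locdunkl a b H v) (nab b xi f) = nab b xi (iter r (locdunkl a b H v) f).
  by apply: (Fil_nab_tangent formsP) => //; apply: lf.
elim: r => // r IH; rewrite !iterS IH; move: (iter r _ f) => h.
rewrite /Operators.locdunkl nabB nabZ (dK_om formsP) // e rmorph0 !mul0r oppr0 scale0r add0r.
by rewrite RH_nab //; congr (_ - _); apply: (nab_comm formsP).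
Qed.



End LocalAnalysis.

End LocalModule.
Import LocalModule.

(** * Regular functions on V_reg and homogeneity of the Dunkl operators *)

Module EulerOperator.

Section GlobalModule.
Variables (C : numClosedFieldType) (gT : finGroupType) (W : {group gT}).
Variables (n : nat) (rV : mx_representation C W n).
Variable alpha : {vspace 'cV[C]_n} -> 'Hom('cV[C]_n, C^o).
Hypothesis faithful : mx_faithful rV.
Hypothesis formsP : is_hyperplane_forms rV alpha.
Variable K : ratfield C n.
Variables (d : nat) (tau : mx_representation C W d).

Local Notation hyps := (hyperplanes rV).
Local Notation cst := (cst K).
Local Notation aK := (aK alpha K).
Local Notation om := (om alpha K).
Local Notation wK := (wK rV K).
Local Notation hmove := (hmove rV).
Local Notation RH := (RH rV (K := K) tau).
Local Notation AH := (AH rV tau).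
Local Notation dunkl := (dunkl rV alpha (K := K) tau).
Local Notation cmx := (cmx K).

Implicit Types (H : {vspace 'cV[C]_n}) (w g : gT) (x xi eta v : 'cV[C]_n).
Implicit Types (a b : {vspace 'cV[C]_n} -> nat -> C) (m j l : int).
Local Notation delta := (delta rV alpha).
Local Notation deltaK := (toK K delta).

Lemma wK_delta w : w \in W -> exists2 c, c != 0 & wK w deltaK = cst c * deltaK.
Proof.
move=> wW; have [c c0 e] : exists2 c, c != 0 &
    \prod_(H <- hyps) wK w (aK H) = cst c * \prod_(H <- hyps) aK (hmove w H).
  have : {subset hyps <= hyps} by [].
  elim: {1 3 4}hyps => [_|H s IH sh].
    by exists 1; rewrite ?oner_neq0 // !big_nil rmorph1 mulr1.
  have HH : H \in hyps by apply: sh; rewrite mem_head.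
  have [|c c0 e] := IH; first by move=> H' H's; apply: sh; rewrite inE H's orbT.
  have [c' c'0 [e' _]] := wK_aK formsP K wW HH.
  exists (c' * c); first exact: mulf_neq0.
  by rewrite !big_cons e e' rmorphM; ring.
exists c => //; rewrite toK_delta rmorph_prod e; congr (_ * _).
by rewrite -(big_map (hmove w) predT aK); apply: perm_big; apply: hmove_perm.
Qed.

(** The algebra C[V_reg] inside K. *)
Definition Lreg (c : K) := exists N P, deltaK ^+ N * c = toK K P.

Lemma Lreg_toK P : Lreg (toK K P).
Proof. by exists 0%N, P; rewrite expr0 mul1r. Qed.

Lemma LregM c e : Lreg c -> Lreg e -> Lreg (c * e).
Proof.
move=> [N [P eP]] [N' [P' eP']]; exists (N + N')%N, (P * P').
by rewrite rmorphM -eP -eP' exprD; ring.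
Qed.

Lemma LregD c e : Lreg c -> Lreg e -> Lreg (c + e).
Proof.
move=> [N [P eP]] [N' [P' eP']]; exists (N + N')%N, (delta ^+ N' * P + delta ^+ N * P').
by rewrite rmorphD !rmorphM !rmorphXn /= -eP -eP' exprD; ring.
Qed.

Lemma Lreg_cst c : Lreg (cst c). Proof. exact: Lreg_toK. Qed.

Lemma Lreg0 : Lreg 0. Proof. by rewrite -(rmorph0 cst); apply: Lreg_cst. Qed.

Lemma LregN c : Lreg c -> Lreg (- c).
Proof.
by move=> lc; rewrite -mulN1r -(rmorphN1 cst); apply: LregM => //; apply: Lreg_cst.
Qed.

Lemma Lreg_sum (I : Type) (r : seq I) (p : pred I) (F : I -> K) :
  (forall i, p i -> Lreg (F i)) -> Lreg (\sum_(i <- r | p i) F i).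
Proof. by move=> h; apply: (big_ind Lreg) => //; [exact: Lreg0 | exact: LregD]. Qed.

Lemma Lreg_dK xi c : Lreg c -> Lreg (dK K xi c).
Proof.
move=> [N [P eP]]; exists N.+1, (delta * pder xi P - N%:R * pder xi delta * P).
rewrite rmorphB !rmorphM rmorph_nat /= -!dKE -eP dKM dKX exprS.
case: N {eP} => [|N]; first by rewrite expr0 !mul0r; ring.
by rewrite /= exprS; ring.
Qed.

Lemma Lreg_wK w c : w \in W -> Lreg c -> Lreg (wK w c).
Proof.
move=> wW [N [P eP]]; have [c0 c00 e] := wK_delta wW.
exists N, (c0^-1 ^+ N *: subst (rV w^-1%g) P).
rewrite toKZ -wK_toK // -eP rmorphM rmorphXn e exprMn rmorphXn fmorphV mulrA.
rewrite exprVn mulKf //.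
by rewrite expf_neq0 // fmorph_eq0.
Qed.

Lemma Lreg_om H xi : H \in hyps -> Lreg (om H xi).
Proof.
move=> HH; apply: LregM; first exact: Lreg_cst.
exists 1%N, (\prod_(H' <- hyps | H' != H) lform alpha H').
rewrite expr1 toK_delta (bigD1_seq H) ?hyps_uniq //= rmorph_prod mulrAC.
by rewrite mulfV ?mul1r // (aK_neq0 formsP K HH).
Qed.

Section Euler.
Variables (q : nat).
Implicit Types f : 'M[K]_(d, q).

Lemma emx_dmx xi f : emx (dmx xi f) = dmx xi (emx f) - dmx xi f.
Proof. by apply/matrixP => i j; rewrite !mxE euler_dK. Qed.

Lemma emx_cmx (A : 'M[C]_d) f : emx (cmx A *m f) = cmx A *m emx f.
Proof.
apply/matrixP => i j; rewrite !mxE raddf_sum; apply: eq_bigr => l _ /=.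
by rewrite !mxE eulerZ.
Qed.

Lemma emx_sum (I : Type) (r : seq I) (p : pred I) (F : I -> 'M[K]_(d, q)) :
  emx (\sum_(i <- r | p i) F i) = \sum_(i <- r | p i) emx (F i).
Proof.
apply: (big_morph _ (@emxD C n K d q)); apply/matrixP => i j.
by rewrite !mxE raddf0.
Qed.

Lemma emxZc (c : C) f : emx (cst c *: f) = cst c *: emx f.
Proof. by rewrite emxZ euler_cst scale0r add0r. Qed.

Lemma emx_RH a H f : emx (RH a H f) = RH a H (emx f).
Proof.
rewrite emx_sum; apply: eq_bigr => w wH.
by rewrite emxZc emx_act ?(pt_stab_sub wH).
Qed.

Lemma emx_dunkl a b xi f : emx (dunkl a b xi f) = dunkl a b xi (emx f) - dunkl a b xi f.
Proof.
rewrite /Operators.dunkl -!sumrN !emxD emx_dmx !emx_sum.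
have -> : \sum_(H <- hyps) emx (om H xi *: (cmx (AH b H) *m f)) =
   \sum_(H <- hyps) om H xi *: (cmx (AH b H) *m emx f) -
   \sum_(H <- hyps) om H xi *: (cmx (AH b H) *m f).
  rewrite -sumrB !big_seq; apply: eq_bigr => H HH.
  by rewrite emxZ (euler_om formsP) // emx_cmx scaleNr addrC.
have -> : \sum_(H <- hyps) emx (- (om H xi *: RH a H f)) =
   \sum_(H <- hyps) - (om H xi *: RH a H (emx f)) +
   \sum_(H <- hyps) om H xi *: RH a H f.
  rewrite -big_split !big_seq; apply: eq_bigr => H HH /=.
  rewrite -scaleN1r -(rmorphN1 cst) emxZc emxZ (euler_om formsP) // emx_RH rmorphN1 scaleN1r.
  by rewrite scaleNr opprD opprK addrC.
rewrite !sumrN /Operators.nab.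
move: (\sum_(H <- hyps) om H xi *: RH a H (emx f)) (\sum_(H <- hyps) om H xi *: RH a H f) => x1 x2.
move: (\sum_(H <- hyps) _) (\sum_(H <- hyps) _) => x3 x4.
by apply/matrixP => i j; rewrite !mxE; ring.
Qed.

Lemma sum_om H : H \in hyps -> \sum_i toK K 'X_i * om H (delta_mx i 0) = 1.
Proof.
move=> HH; have a0 := aK_neq0 formsP K HH; apply: (mulIf a0).
rewrite mul1r mulr_suml [RHS]/LocalRing.aK [lform alpha H]/lform rmorph_sum; apply: eq_bigr => i _ /=.
by rewrite -mulrA [om H _ * _]mulrC (aK_om formsP) // mulrC toKZ.
Qed.

(** The Euler field contracts every logarithmic form to 1 ([sum_om]), so what remains is the degree
    operator plus operators that preserve degrees. *)
Lemma euler_dunkl a b f :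
  \sum_i toK K 'X_i *: dunkl a b (delta_mx i 0) f =
  emx f + \sum_(H <- hyps) cmx (AH b H) *m f - \sum_(H <- hyps) RH a H f.
Proof.
have gen (F : {vspace 'cV[C]_n} -> 'M[K]_(d, q)) :
   \sum_i toK K 'X_i *: (\sum_(H <- hyps) om H (delta_mx i 0) *: F H) = \sum_(H <- hyps) F H.
  under eq_bigr => i _ do rewrite scaler_sumr.
  rewrite exchange_big /= !big_seq; apply: eq_bigr => H HH.
  under eq_bigr => i _ do rewrite scalerA.
  by rewrite -scaler_suml sum_om // scale1r.
rewrite -[in RHS](gen (fun H => RH a H f)) -[in RHS](gen (fun H => cmx (AH b H) *m f)).
have -> : emx f = \sum_i toK K 'X_i *: dmx (delta_mx i 0) f.
  apply/matrixP => i j; rewrite summxE !mxE; apply: eq_bigr => l _.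
  by rewrite !mxE.
rewrite -big_split -sumrB; apply: eq_bigr => i _ /=.
by rewrite -scalerDr -scalerBr.
Qed.

Lemma dunklZ a b xi (c : C) f : dunkl a b xi (cst c *: f) = cst c *: dunkl a b xi f.
Proof.
rewrite /Operators.dunkl nabZc scalerBr scaler_sumr; congr (_ - _).
by apply: eq_bigr => H _; rewrite RHZc !scalerA mulrC.
Qed.

Lemma dunklD a b xi f h : dunkl a b xi (f + h) = dunkl a b xi f + dunkl a b xi h.
Proof.
rewrite /Operators.dunkl nabD [RHS]addrACA -opprD -big_split; congr (_ - _).
by apply: eq_bigr => H _; rewrite RHD scalerDr.
Qed.

Lemma dunkl_mulr r a b xi f (A : 'M[C]_(q, r)) :
  dunkl a b xi (f *m cmx A) = dunkl a b xi f *m cmx A.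
Proof.
have dA : dmx xi (cmx A) = 0 by apply/matrixP => i j; rewrite !mxE dK_cst.
rewrite /Operators.dunkl /Operators.nab dmx_mul dA mulmx0 addr0 mulmxBl mulmxDl !mulmx_suml.
congr (_ + _ - _); apply: eq_bigr => H _; first by rewrite -scalemxAl mulmxA.
rewrite -scalemxAl; congr (_ *: _); rewrite /Operators.RH mulmx_suml; apply: eq_bigr => w wH.
by rewrite -scalemxAl act_mulr map_wK_cmx ?(pt_stab_sub wH).
Qed.

End Euler.
End GlobalModule.

End EulerOperator.
Import EulerOperator.

(** * Generic parameters and the global module *)

Module GenericModule.

Section Cofinite.
Variable C : numClosedFieldType.
Implicit Type P Q : C -> Prop.

Definition cofin P := exists bad : seq C, forall s, s \notin bad -> P s.

Lemma cofin_imp P Q : (forall s, P s -> Q s) -> cofin P -> cofin Q.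
Proof. by move=> PQ [bad h]; exists bad => s /h /PQ. Qed.

Lemma cofin_true P : (forall s, P s) -> cofin P.
Proof. by move=> h; exists [::] => s _. Qed.

Lemma cofinI P Q : cofin P -> cofin Q -> cofin (fun s => P s /\ Q s).
Proof.
move=> [b1 h1] [b2 h2]; exists (b1 ++ b2) => s; rewrite mem_cat negb_or.
by move=> /andP[/h1 p1 /h2 p2].
Qed.

Lemma cofin_all (I : eqType) (r : seq I) (P : I -> C -> Prop) :
  (forall i, i \in r -> cofin (P i)) -> cofin (fun s => forall i, i \in r -> P i s).
Proof.
elim: r => [_|i r IH h]; first by apply: cofin_true.
have [|b1 h1] := IH; first by move=> j jr; apply: h; rewrite inE jr orbT.
have [b2 h2] := h i (mem_head _ _); exists (b1 ++ b2) => s.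
rewrite mem_cat negb_or => /andP[/h1 p1 /h2 p2] j; rewrite inE => /orP[/eqP ->|/p1] //.
Qed.

Lemma cofin_shift P : cofin P -> cofin (fun s => P (s + 1)).
Proof.
move=> [bad h]; exists [seq x - 1 | x <- bad] => s nb; apply: h.
by apply: contra nb => sb; apply/mapP; exists (s + 1); rewrite ?addrK.
Qed.

Lemma cofin_ex P : cofin P -> exists s, P s.
Proof.
move=> [bad h]; pose r := [seq i%:R : C | i <- iota 0 (size bad).+1].
have ur : uniq r.
  by rewrite map_inj_uniq ?iota_uniq // => i j /eqP; rewrite eqr_nat => /eqP.
have /allPn[s _ /h] : ~~ all (mem bad) r; last by exists s.
apply/negP => /allP sub; have := uniq_leq_size ur sub.
by rewrite size_map size_iota ltnn.
Qed.

Lemma cofin_root (p : {poly C}) : p != 0 -> cofin (fun s => ~~ root p s).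
Proof.
move=> p0; have [r pE] := closed_field_poly_normal p; exists r => s.
by rewrite pE rootZ ?lead_coef_eq0 // root_prod_XsubC.
Qed.

(** The determinant is a polynomial in s that is nonzero at s = 0. *)
Lemma cofin_unitmx N (A B : 'M[C]_N) : A \in unitmx -> cofin (fun s => A + s *: B \in unitmx).
Proof.
move=> uA; pose M : 'M[{poly C}]_N := map_mx polyC A + 'X *: map_mx polyC B.
have hM s : (\det M).[s] = \det (A + s *: B).
  rewrite -horner_evalE -det_map_mx; congr (\det _); apply/matrixP => i j.
  by rewrite /M !mxE /= /horner_eval hornerD hornerM hornerX !hornerC.
have dM0 : \det M != 0.
  apply: contraTneq uA => e; rewrite unitmxE unitfE negbK.
  by have := hM 0; rewrite scale0r addr0 => <-; rewrite e horner0.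
apply: cofin_imp (cofin_root dM0) => s.
by rewrite /root hM unitmxE unitfE.
Qed.

End Cofinite.
Section GenericKernel.
Variables (C : numClosedFieldType) (gT : finGroupType) (W : {group gT}).
Variables (n : nat) (rV : mx_representation C W n).
Variable alpha : {vspace 'cV[C]_n} -> 'Hom('cV[C]_n, C^o).
Hypothesis faithful : mx_faithful rV.
Hypothesis formsP : is_hyperplane_forms rV alpha.
Variable K : ratfield C n.
Variables (d : nat) (tau : mx_representation C W d).

Local Notation hyps := (hyperplanes rV).
Local Notation cst := (cst K).
Local Notation aK := (aK alpha K).
Local Notation om := (om alpha K).
Local Notation act := (act rV (K := K) tau).
Local Notation RH := (RH rV (K := K) tau).
Local Notation AH := (AH rV tau).
Local Notation dunkl := (dunkl rV alpha (K := K) tau).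
Local Notation locdunkl := (locdunkl rV alpha (K := K) tau).
Local Notation locreg := (locreg alpha (K := K)).
Local Notation cmx := (cmx K).

Implicit Types (H : {vspace 'cV[C]_n}) (w g : gT) (x xi eta v : 'cV[C]_n).
Implicit Types (a b : {vspace 'cV[C]_n} -> nat -> C) (m l : int).
Local Notation delta := (delta rV alpha).
Local Notation deltaK := (toK K delta).
Local Notation Lreg := (Lreg rV alpha (K := K)).

Variables (kap : {vspace 'cV[C]_n} -> nat -> C) (k : {vspace 'cV[C]_n} -> nat -> int).
Hypothesis ikap : invmult rV kap.
Hypothesis ik : invmult rV (fun H i => (k H i)%:~R).
Variable B : nat.
Hypothesis kB : forall H i, H \in hyps -> (i < n_ rV H)%N -> ((n_ rV H)%:Z * `|k H i| <= B%:Z)%R.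

Definition as_ (s : C) := fun H i => s * kap H i.
Definition bs_ (s : C) := fun H i => as_ s H i + (k H i)%:~R.

Let ias s : invmult rV (as_ s).
Proof. by move=> H w i HH wW lt; rewrite /as_ ikap. Qed.

Let ibs s : invmult rV (bs_ s).
Proof. by move=> H w i HH wW lt; rewrite /bs_ ias // ik. Qed.

Local Notation LL s := (LL rV alpha (K := K) tau (as_ s) k B).
Local Notation T s := (dunkl (as_ s) (bs_ s)).

Definition Mod (s : C) q (f : 'M[K]_(d, q)) :=
  (forall i j, Lreg (f i j)) /\ forall H, H \in hyps -> LL s H f.

Section Fixed.
Variables (s : C) (q : nat).
Implicit Types f h : 'M[K]_(d, q).

Lemma Lreg_act w f : w \in W -> (forall i j, Lreg (f i j)) -> forall i j, Lreg (act w f i j).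
Proof.
move=> wW lf i j; rewrite mxE; apply: Lreg_sum => l _; apply: LregM.
  by rewrite mxE; apply: Lreg_cst.
by rewrite mxE; apply: (Lreg_wK formsP).
Qed.

Lemma Mod_act w f : w \in W -> Mod s f -> Mod s (act w f).
Proof.
move=> wW [lf Lf]; split; first exact: Lreg_act.
move=> H HH; have wV : (w^-1)%g \in W by rewrite groupV.
have HH' := hmove_hyps wV HH.
have := LL_act formsP (ias s) (ibs s) wW HH' (Lf _ HH').
by rewrite -hmoveM // mulgV hmove1.
Qed.

(** Along H the Dunkl operator is the local one plus difference terms with coefficients regular
    along H. The local one is split into the transversal direction, which only shifts the iterates,
    and a tangent direction, where it reduces to nabla. *)
Lemma Mod_dunkl xi f : Mod s f -> Mod s (T s xi f).
Proof.
move=> Mf; have [lf Lf] := Mf; split.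
  have lRH H i j : Lreg (RH (as_ s) H f i j).
    rewrite summxE; apply: Lreg_sum => w wH; rewrite mxE; apply: LregM.
      exact: Lreg_cst.
    by apply: Lreg_act => //; exact: pt_stab_sub wH.
  have lA H i j : Lreg ((cmx (AH (bs_ s) H) *m f) i j).
    rewrite mxE; apply: Lreg_sum => l _; apply: LregM => //.
    by rewrite mxE; apply: Lreg_cst.
  move=> i j; rewrite /Operators.dunkl /Operators.nab !mxE !summxE !big_seq; apply: LregD.
    apply: LregD; first exact: Lreg_dK.
    apply: Lreg_sum => H HH; rewrite mxE; apply: LregM => //.
    exact: (Lreg_om formsP).
  apply: LregN; apply: Lreg_sum => H HH; rewrite mxE; apply: LregM => //.
  exact: (Lreg_om formsP).
move=> H HH; have [v av ev] := eigenvector_exists formsP HH.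
have -> : T s xi f = locdunkl (as_ s) (bs_ s) H xi f +
    \sum_(H' <- hyps | H' != H) (- om H' xi) *: RH (as_ s) H' f.
  rewrite /Operators.dunkl /Operators.locdunkl (bigD1_seq H) ?hyps_uniq //= opprD addrA; congr (_ + _).
  by rewrite -sumrN; apply: eq_bigr => H' _; rewrite scaleNr.
have LLsum (I : Type) (r : seq I) (p : pred I) (F : I -> 'M[K]_(d, q)) :
    (forall i, p i -> LL s H (F i)) -> LL s H (\sum_(i <- r | p i) F i).
  move=> h; apply: (big_ind (LL s H)) => //; first exact: (LL0 formsP).
  by move=> x y; apply: (LLD formsP).
have Lc c h : LL s H h -> LL s H (cst c *: h).
  by apply: (LLZ faithful formsP (ias s) (ibs s)) => //; apply: (locreg_cst formsP).
apply: (LLD formsP) => //.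
  pose y := xi - alpha H xi *: v.
  have ay : alpha H y = 0.
    by rewrite linearB linearZ /= av /GRing.scale /= mulr1 subrr.
  have -> : xi = alpha H xi *: v + y by rewrite addrC subrK.
  rewrite (locdunkl_lin rV alpha tau (as_ s) k); apply: (LLD formsP) => //.
    by apply: (Lc); apply: (LL_locdunkl faithful formsP) => //; apply: Lf.
  rewrite /Operators.locdunkl om_tangent // scale0r subr0.
  by apply: (LL_nab formsP (ibs s)) => //; apply: Lf.
rewrite big_seq_cond; apply: (LLsum) => H' /andP[HH' ne].
apply: (LLZ faithful formsP (ias s) (ibs s)) => //.
  by apply: (locregN formsP) => //; apply: (locreg_om formsP) => // e; rewrite e eqxx in ne.
apply: (LLsum) => w wH; apply: (Lc).
by have [_] := Mod_act (pt_stab_sub wH) Mf; apply.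
Qed.

Lemma locreg_delta_pow H (c : K) : H \in hyps ->
  locreg H (aK H ^ B%:Z * c) -> locreg H (deltaK ^+ B * c).
Proof.
move=> HH lc; have -> : deltaK ^+ B * c =
    (\prod_(H' <- hyps | H' != H) aK H') ^+ B * (aK H ^ B%:Z * c).
  by rewrite toK_delta (bigD1_seq H) ?hyps_uniq //= exprMn -exprnP; ring.
apply: (locregM formsP) => //; apply: (locregX formsP) => //.
rewrite -(rmorph_prod (toK K)); exact: (locreg_toK formsP).
Qed.

(** The case r = 0 of the local condition bounds the poles along every hyperplane by B. *)
Lemma Mod_poly f : Mod s f -> forall i j, exists P, deltaK ^+ B * f i j = toK K P.
Proof.
move=> [lf Lf] i j; have [N [P e]] := lf i j.
apply: (locreg_poly (N := N) (P := delta ^+ B * P) formsP).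
  move=> H HH; apply: locreg_delta_pow => //.
  have [v av ev] := eigenvector_exists formsP HH.
  by have := Lf H HH v 0%N ev i j; rewrite opprK mxE.
by rewrite rmorphM rmorphXn /= -e; ring.
Qed.

(** delta^B has order B along every hyperplane, the order from which [LL_Fil] starts. *)
Lemma Mod_delta (A : 'M[C]_(d, q)) : Mod s (deltaK ^+ B *: cmx A).
Proof.
split=> [i j|H HH].
  rewrite !mxE; apply: LregM; last exact: Lreg_cst.
  by rewrite -rmorphXn; apply: Lreg_toK.
apply: (LL_Fil faithful formsP tau (ibs s) kB) => // i j; rewrite !mxE mulrA.
apply: (locregM formsP) => //; last exact: (locreg_cst formsP).
rewrite toK_delta (bigD1_seq H) ?hyps_uniq //= exprMn mulrA exprnP -expfzDr.
  rewrite addNr expr0z mul1r; apply: (locregX formsP) => //.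
  rewrite -(rmorph_prod (toK K)); exact: (locreg_toK formsP).
exact: (aK_neq0 formsP K HH).
Qed.

End Fixed.
End GenericKernel.

End GenericModule.
Import GenericModule.

(** * The common kernel of the Dunkl operators for generic s *)

Module GenericKernel.

(** As long as some vector with P lies outside the row span it is added, which happens at most d
    times; the choice is classical, P being an arbitrary proposition. *)
Lemma span_pred (F : fieldType) d (P : 'rV[F]_d -> Prop) :
  exists m (A : 'M[F]_(m, d)), (forall i, P (row i A)) /\ forall v, P v -> (v <= A)%MS.
Proof.
suff h r m (A : 'M[F]_(m, d)) : (forall i, P (row i A)) -> (d - \rank A <= r)%N ->
    exists m (A : 'M[F]_(m, d)), (forall i, P (row i A)) /\ forall v, P v -> (v <= A)%MS.
  by apply: (h d 0%N 0) => [[]|] //; apply: leq_subr.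
elim: r m A => [|r IH] m A PA le.
  exists m, A; split=> // v _; apply: submx_full; rewrite /row_full eqn_leq rank_leq_col.
  by rewrite -subn_eq0 -leqn0.
have [[v [Pv nv]]|nex] := boolp.EM (exists v, P v /\ ~~ (v <= A)%MS); last first.
  exists m, A; split=> // v Pv; apply: contraT => nv; case: nex; by exists v.
apply: (IH _ (col_mx A v)) => [i|].
  by rewrite -(splitK i); case: (split i) => k /=; rewrite ?rowKu // rowKd row_id.
have lt : (\rank A < \rank (col_mx A v))%N.
  apply: rank_ltmx; rewrite ltmxE -{1}addsmxE addsmxSl /= col_mx_sub submx_refl /=.
  by [].
by rewrite -ltnS; apply: leq_trans le; rewrite ltn_sub2l // (leq_trans lt) ?rank_leq_col.
Qed.

Section GenericKernel.
Variables (C : numClosedFieldType) (gT : finGroupType) (W : {group gT}).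
Variables (n : nat) (rV : mx_representation C W n).
Variable alpha : {vspace 'cV[C]_n} -> 'Hom('cV[C]_n, C^o).
Hypothesis faithful : mx_faithful rV.
Hypothesis formsP : is_hyperplane_forms rV alpha.
Variable K : ratfield C n.
Variables (d : nat) (tau : mx_representation C W d).

Local Notation hyps := (hyperplanes rV).
Local Notation cst := (cst K).
Local Notation aK := (aK alpha K).
Local Notation act := (act rV (K := K) tau).
Local Notation RH := (RH rV (K := K) tau).
Local Notation AH := (AH rV tau).
Local Notation bet := (bet rV).
Local Notation dunkl := (dunkl rV alpha (K := K) tau).
Local Notation cmx := (cmx K).

Implicit Types (H : {vspace 'cV[C]_n}) (w g : gT) (x xi eta : 'cV[C]_n).
Implicit Types (a b : {vspace 'cV[C]_n} -> nat -> C) (l : int).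
Local Notation delta := (delta rV alpha).
Local Notation deltaK := (toK K delta).


Variables (kap : {vspace 'cV[C]_n} -> nat -> C) (k : {vspace 'cV[C]_n} -> nat -> int).
Hypothesis ikap : invmult rV kap.
Let kC H i : C := (k H i)%:~R.
Hypothesis ik : invmult rV kC.
Variable B : nat.
Hypothesis kB : forall H i, H \in hyps -> (i < n_ rV H)%N -> ((n_ rV H)%:Z * `|k H i| <= B%:Z)%R.
Variables (ckap ck : C).
Hypothesis kapS : \sum_(H <- hyps) AH kap H = ckap%:M.
Hypothesis kS : \sum_(H <- hyps) AH kC H = ck%:M.

Local Notation as_ := (as_ kap).
Local Notation bs_ := (bs_ kap k).
Local Notation Mod s := (Mod rV alpha (K := K) tau kap k B s).
Local Notation T s := (dunkl (as_ s) (bs_ s)).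
Local Notation N := (size hyps).

Let ias s : invmult rV (as_ s).
Proof. by move=> H w i HH wW lt; rewrite /GenericModule.as_ ikap. Qed.

Let ibs s : invmult rV (bs_ s).
Proof. by move=> H w i HH wW lt; rewrite /GenericModule.bs_ ias //; congr (_ + _); apply: ik. Qed.

Lemma cmx_scalar p (c : C) : cmx (c%:M : 'M_p) = (cst c)%:M.
Proof. by apply/matrixP => i j; rewrite !mxE rmorphMn. Qed.

Definition Zop (u : 'cV[K]_d) : 'cV[K]_d := cst ckap *: u - \sum_(H <- hyps) RH kap H u.

Lemma RH_scale q (s : C) H (u : 'M[K]_(d, q)) : RH (as_ s) H u = cst s *: RH kap H u.
Proof.
rewrite /Operators.RH scaler_sumr; apply: eq_bigr => w _; rewrite scalerA -rmorphM.
congr (cst _ *: _); rewrite /Operators.bet mulr_sumr; apply: eq_bigr => i _.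
by rewrite mulrA.
Qed.

Lemma euler_T s (q : C) (u : 'cV[K]_d) : emx u = cst q *: u ->
  \sum_i toK K 'X_i *: T s (delta_mx i 0) u = cst (q + ck) *: u + cst s *: Zop u.
Proof.
move=> eu; rewrite euler_dunkl // eu.
have -> : \sum_(H <- hyps) cmx (AH (bs_ s) H) *m u = cst (s * ckap + ck) *: u.
  rewrite -mulmx_suml -(raddf_sum (map_mx cst)).
  have -> : \sum_(H <- hyps) AH (bs_ s) H = (s * ckap + ck)%:M.
    rewrite raddfD /= -scale_scalar_mx -kapS -kS scaler_sumr -big_split.
    by apply: eq_bigr => H _; apply: AH_lin.
  by rewrite -[LHS]/(cmx _ *m u) cmx_scalar mul_scalar_mx.
have -> : \sum_(H <- hyps) RH (as_ s) H u = cst s *: \sum_(H <- hyps) RH kap H u.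
  by rewrite scaler_sumr; apply: eq_bigr => H _; apply: RH_scale.
rewrite /Zop !rmorphD !rmorphM /= scalerBr scalerA.
move: (\sum_(H <- hyps) _) => X.
by apply/matrixP => i j; rewrite !mxE; ring.
Qed.

(* On the W-orbit of u, the operator q + s Z is given by a |W| x |W| matrix
   that does not depend on u. *)
Lemma Zop_inv (q : C) : q != 0 -> cofin (fun s : C => forall (Y : 'cV[K]_d -> Prop),
  Y 0 ->
  (forall u u', Y u -> Y u' -> Y (u + u')) -> (forall (c : K) u, Y u -> Y (c *: u)) ->
  (forall w u, w \in W -> Y u -> Y (act w u)) ->
  forall u, Y (cst q *: u + cst s *: Zop u) -> Y u).
Proof.
move=> q0.
(* Collects the coefficient of w in the difference terms of all hyperplanes that w fixes
   pointwise. *)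
pose g w : C := \sum_(H <- hyps | w \in pt_stab rV H) bet kap H w.
pose e (i : 'I_#|W|) : gT := enum_val i.
have eW i : e i \in W by apply: enum_valP.
have einj i j : (e i == e j) = (i == j) by rewrite (inj_eq enum_val_inj).
pose A : 'M[C]_#|W| := ckap%:M - \matrix_(i, j) g ((e i)^-1 * e j)%g.
have AE i j : A i j = ckap *+ (i == j) - g ((e i)^-1 * e j)%g by rewrite !mxE.
clearbody A.
have ZE (u : 'cV[K]_d) : Zop u = cst ckap *: u - \sum_(w in W) cst (g w) *: act w u.
  rewrite /Zop; congr (_ - _).
  under [RHS]eq_bigr => w wW do rewrite raddf_sum scaler_suml.
  rewrite [LHS](exchange_big_dep (mem W)) //= => H w _ wH; exact: pt_stab_sub wH.
have uq n0 : (q%:M : 'M[C]_n0) \in unitmx.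
  by rewrite unitmxE det_scalar unitfE expf_neq0.
apply: cofin_imp (cofin_unitmx A (uq _)) => s; set M := _ + _ => uM Y Y0 YD YZ Yact u Yu.
have ME0 i j : M i j = q *+ (i == j) + s * A i j by rewrite !mxE.
clearbody M.
have ME i : cst q *: act (e i) u + cst s *: act (e i) (Zop u) =
    \sum_j cst (M i j) *: act (e j) u.
  rewrite ZE actB actZc // act_sum scalerBr.
  have -> : \sum_(w in W) act (e i) (cst (g w) *: act w u) =
      \sum_j cst (g ((e i)^-1 * e j)%g) *: act (e j) u.
    rewrite (reindex_inj (mulgI (e i)^-1%g)) /=.
    rewrite (eq_bigl (mem W)) => [|w]; last by rewrite groupMl ?groupV.
    rewrite big_enum_val; apply: eq_bigr => j _.
    by rewrite actZc // -actM ?mulKVg // groupM ?groupV.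
  have single c : \sum_j cst (c *+ (i == j)) *: act (e j) u = cst c *: act (e i) u.
    rewrite (bigD1 i) //= eqxx mulr1n big1 ?addr0 // => j.
    by rewrite eq_sym => /negPf ->; rewrite mulr0n rmorph0 scale0r.
  rewrite -(single q) -(single ckap) !scaler_sumr -sumrB -big_split.
  apply: eq_bigr => j _; rewrite ME0 AE !(rmorphD, rmorphM, rmorphB) /= !scalerA.
  by rewrite [cst (- _)]rmorphN mulrBr scalerDl scalerBl.
have W1 : (1%g : gT) \in W by apply: group1.
pose i1 := enum_rank_in W1 1%g.
have e1 : e i1 = 1%g by apply: enum_rankK_in.
(* M describes q + s Z on the family of all w u. The row of w = 1 in its inverse recovers u from the
   vectors w (q u + s Z u), which lie in Y because Y is W-stable. *)
have -> : u = \sum_i cst (invmx M i1 i) *: act (e i) (cst q *: u + cst s *: Zop u).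
  under eq_bigr => i _ do rewrite actD !actZc // ME scaler_sumr.
  rewrite exchange_big /=.
  under eq_bigr => j _.
    under eq_bigr => i _ do rewrite scalerA -rmorphM.
    rewrite -scaler_suml -raddf_sum /=.
    have -> : \sum_i invmx M i1 i * M i j = (i1 == j)%:R.
      by have := mulVmx uM => /matrixP/(_ i1 j); rewrite !mxE.
    over.
  rewrite (bigD1 i1) //= eqxx rmorph1 scale1r e1 act1 // big1 ?addr0 // => j.
  by rewrite eq_sym => /negPf ->; rewrite rmorph0 scale0r.
apply: (big_ind Y) => // i _; apply: YZ; exact: Yact.
Qed.

Definition Kern (s : C) (u : 'cV[K]_d) :=
  [/\ forall xi, T s xi u = 0, emx u = cst (- ck) *: u & Mod s u].

(** The K-span of the common kernel, encoded as the intersection of all K-subspaces containing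
    it. *)
Definition XK (s : C) (u : 'cV[K]_d) := forall Y : 'cV[K]_d -> Prop,
  Y 0 -> (forall v, Kern s v -> Y v) -> (forall u u', Y u -> Y u' -> Y (u + u')) ->
  (forall (c : K) u, Y u -> Y (c *: u)) -> Y u.

Lemma Kern_act s w u : w \in W -> Kern s u -> Kern s (act w u).
Proof.
move=> wW [Tu eu Mu]; split; last exact: Mod_act.
  move=> xi; have := act_dunkl formsP tau (rV w^-1%g *m xi) u (ias s) (ibs s) wW.
  by rewrite Tu act0 mulmxA -repr_mxM ?groupV // mulgV repr_mx1 mul1mx => <-.
by rewrite emx_act // eu actZc.
Qed.

Lemma XK0 s : XK s 0. Proof. by move=> Y. Qed.

Lemma XKD s u u' : XK s u -> XK s u' -> XK s (u + u').
Proof. by move=> h h' Y Y0 YK YD YZ; apply: (YD); [apply: h | apply: h']. Qed.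

Lemma XKZ s (c : K) u : XK s u -> XK s (c *: u).
Proof. by move=> h Y Y0 YK YD YZ; apply: (YZ); apply: h. Qed.

Lemma XK_act s w u : w \in W -> XK s u -> XK s (act w u).
Proof.
move=> wW h Y Y0 YK YD YZ; apply: (h (fun u => Y (act w u))).
- by rewrite act0.
- by move=> v Kv; apply/YK/Kern_act.
- by move=> v v' Yv Yv'; rewrite actD; apply: YD.
- by move=> c v Yv; rewrite actZ; apply: YZ.
Qed.

Lemma euler_deltaK : euler deltaK = cst N%:R * deltaK.
Proof.
suff gen r : {subset r <= hyps} ->
    euler (\prod_(H <- r) aK H) = cst (size r)%:R * \prod_(H <- r) aK H.
  by rewrite toK_delta; apply: gen.
elim: r => [|H r IH] sub; first by rewrite !big_nil rmorph0 mul0r -(rmorph1 cst) euler_cst.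
rewrite !big_cons eulerM IH ?euler_aK => [|H' rH']; last by apply: sub; rewrite inE rH' orbT.
by rewrite /= mulrS rmorphD rmorph1; ring.
Qed.

Lemma euler_deltaKX m : euler (deltaK ^+ m) = cst (m * N)%:R * deltaK ^+ m.
Proof.
elim: m => [|m IH]; first by rewrite expr0 -(rmorph1 cst) euler_cst mul0n rmorph0 mul0r.
by rewrite exprS eulerM IH euler_deltaK mulSn natrD rmorphD; ring.
Qed.

(** Just below the lowest possible degree: delta^B u would consist of polynomials of degree -1. *)
Lemma Mod_low s (u : 'cV[K]_d) : Mod s u -> emx u = cst (- 1 - (B * N)%:R) *: u -> u = 0.
Proof.
move=> Mu eu; apply/matrixP => i j; rewrite [RHS]mxE.
have [P eP] := Mod_poly formsP Mu i j.
apply/eqP; apply: contraT => u0.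
have P0 : P != 0.
  by rewrite -(toK_eq0 K) -eP mulf_neq0 ?expf_neq0 // toK_delta_neq0.
have e : euler (toK K P) = cst (-1) * toK K P.
  rewrite -eP eulerM euler_deltaKX.
  have := congr1 (fun A : 'cV[K]_d => A i j) eu; rewrite !mxE => ->.
  by rewrite rmorphB rmorphN1; ring.
have [m e' _] := euler_toK e P0.
by have := ler0n C m; rewrite -e' oppr_ge0 ler10.
Qed.

(** The degrees i - B N run from the lowest one possible in the module to that of delta^B, so only
    finitely many conditions are imposed on s. [Y] stands for any W-stable K-subspace. *)
Definition good (s : C) := forall i, i \in iota 0 (2 * (B * N)).+1 ->
  i%:R - (B * N)%:R + ck != 0 ->
  forall (Y : 'cV[K]_d -> Prop), Y 0 ->
  (forall u u', Y u -> Y u' -> Y (u + u')) -> (forall (c : K) u, Y u -> Y (c *: u)) ->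
  (forall w u, w \in W -> Y u -> Y (act w u)) ->
  forall u, Y (cst (i%:R - (B * N)%:R + ck) *: u + cst s *: Zop u) -> Y u.

Lemma good_cofin : cofin good.
Proof.
apply: cofin_all => i _; have [->|ne] := eqVneq (i%:R - (B * N)%:R + ck) 0.
  by apply: cofin_true => s /eqP.
by apply: cofin_imp (Zop_inv ne) => s h _; apply: h.
Qed.

(** Induction on the degree: the T_xi u lie in the span, hence so does their Euler combination q u +
    s Z u, and genericity returns u when q is nonzero. When q = 0, u itself is in the kernel; this
    needs T_xi u = 0, for which the second clause is carried along. *)
Lemma Mod_XK s : good s -> forall i, (i <= 2 * (B * N))%N -> forall u : 'cV[K]_d,
  Mod s u -> emx u = cst (i%:R - (B * N)%:R) *: u ->
  XK s u /\ ((forall j, (j <= i)%N -> j%:R - (B * N)%:R + ck != 0) -> u = 0).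
Proof.
move=> gs i; elim/ltn_ind: i => i IH le u Mu eu.
have Mt xi : Mod s (T s xi u) by apply: (Mod_dunkl faithful formsP ikap ik).
have et xi : emx (T s xi u) = cst (i%:R - (B * N)%:R - 1) *: T s xi u.
  rewrite emx_dunkl // eu dunklZ -{2}[T s xi u]scale1r -scalerBl -(rmorph1 cst) -rmorphB.
  by [].
have step xi : XK s (T s xi u) /\
    ((forall j, (j < i)%N -> j%:R - (B * N)%:R + ck != 0) -> T s xi u = 0).
  case: i IH le eu et => [|i] IH le eu et.
    have -> : T s xi u = 0.
      by apply: (Mod_low (Mt xi)); rewrite et; congr (cst _ *: _); rewrite sub0r addrC.
    by split; first exact: XK0.
  have [] // := IH i (ltnSn i) (ltnW le) (T s xi u) (Mt xi).
  by rewrite et; congr (cst _ *: _); rewrite -natr1; ring.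
have eT := euler_T s eu.
have [q0|q0] := eqVneq (i%:R - (B * N)%:R + ck) 0.
  (* q vanishes in a single degree, so all lower degrees meet the condition of the second clause. *)
  have T0 xi : T s xi u = 0.
    apply: (step xi).2 => j ji; apply: contraTneq ji => e; rewrite -leqNgt.
    have /eqP : i%:R - (B * N)%:R + ck = j%:R - (B * N)%:R + ck by rewrite q0 e.
    by rewrite (can_eq (addrK _)) (can_eq (addrK _)) eqr_nat => /eqP ->.
  split=> [Y Y0 YK _ _|/(_ i (leqnn i))]; last by rewrite q0 eqxx.
  apply: YK; split=> //; rewrite eu; congr (cst _ *: _).
  by apply/eqP; rewrite -subr_eq0 opprK q0.
have Yu := gs i _ q0; rewrite mem_iota add0n in Yu.
split=> [|hj]; last first.
  apply: (Yu le (fun u => u = 0)) => //.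
  - by move=> x y -> ->; rewrite addr0.
  - by move=> c x ->; rewrite scaler0.
  - by move=> w x _ ->; rewrite act0.
  rewrite -eT big1 // => l _; rewrite (step _).2 ?scaler0 // => j ji.
  exact: hj (ltnW ji).
apply: (Yu le (XK s)).
- exact: XK0.
- exact: XKD.
- exact: XKZ.
- exact: XK_act.
rewrite -eT; apply: (big_ind (XK s)); [exact: XK0 | exact: XKD |] => l _.
by apply: XKZ; apply: (step _).1.
Qed.

(** Over K the basis vector e_i is a multiple of delta^B e_i, which lies in the module in the top
    degree B N. *)
Lemma XK_delta_mx s i : good s -> XK s (delta_mx i 0).
Proof.
move=> gs; pose u : 'cV[K]_d := deltaK ^+ B *: cmx (delta_mx i 0).
have Mu : Mod s u by apply: (Mod_delta faithful formsP K tau ikap ik kB).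
have [] := Mod_XK gs (leqnn _) Mu.
  rewrite /u emxZ euler_deltaKX scalerA -[RHS]addr0.
  congr (_ + _); last first.
    apply/matrixP => i' j; rewrite !mxE euler_cst mulr0.
    by [].
  by congr (cst _ * _ *: _); rewrite mul2n -addnn natrD addrK.
have -> : delta_mx i 0 = deltaK ^- B *: u :> 'cV[K]_d.
  rewrite scalerA mulVf ?expf_neq0 ?toK_delta_neq0 // scale1r.
  by apply/matrixP => i' j; rewrite !mxE rmorph_nat.
by move=> h _; apply: XKZ.
Qed.

Lemma generic_kernel : cofin (fun s : C => exists G : 'M[K]_d, [/\ G \in unitmx,
  forall xi, T s xi G = 0, emx G = cst (- ck) *: G &
  forall i j, exists P, deltaK ^+ B * G i j = toK K P]).
Proof.
apply: cofin_imp good_cofin => s gs.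
have [m [A [PA sA]]] := span_pred (fun u : 'rV[K]_d => Kern s u^T).
have fA : row_full A.
  rewrite -sub1mx; apply/row_subP => i.
  have h : ((delta_mx i 0 : 'cV[K]_d)^T <= A)%MS.
    apply: (XK_delta_mx i gs (Y := fun u => (u^T <= A)%MS)).
    - by rewrite trmx0 sub0mx.
    - by move=> v Kv; apply: sA; rewrite trmxK.
    - by move=> u u' hu hu'; rewrite linearD addmx_sub.
    - by move=> c u hu; rewrite linearZ scalemx_sub.
  by rewrite rowE mulmx1; move: h; rewrite trmx_delta.
(* The kernel vectors in A span K^d, so d of them form the columns of an invertible matrix. *)
pose G := (rowsub (fullrankfun fA) A)^T; exists G.
have GK j : Kern s (G *m cmx (delta_mx j 0)).
  rewrite /Operators.cmx map_delta_mx -colE -tr_row row_rowsub; exact: PA.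
have ext (X Y : 'M[K]_d) :
    (forall j, X *m cmx (delta_mx j 0) = Y *m cmx (delta_mx j 0) :> 'cV_d) -> X = Y.
  move=> h; apply/matrixP => i j; have := h j.
  by rewrite /Operators.cmx map_delta_mx -!colE => /matrixP/(_ i 0); rewrite !mxE.
split=> [|xi||i j].
- by rewrite unitmx_tr fullrowsub_unit.
- by apply: ext => j; have [h _ _] := GK j; rewrite -dunkl_mulr h mul0mx.
- apply/matrixP => i j; have [_ h _] := GK j; have := h; rewrite /Operators.cmx map_delta_mx -colE.
  by move=> /matrixP/(_ i 0); rewrite !mxE.
have [_ _ h] := GK j; have [P] := Mod_poly formsP h i 0.
by rewrite /Operators.cmx map_delta_mx -colE mxE; exists P.
Qed.

End GenericKernel.

End GenericKernel.
Import GenericKernel.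

(** * Injectivity in linear pencils; polynomials along lines *)

Module Semicontinuity.

(** With Q u v standing for L u + L' v = 0: if L is injective, so is L + s L' for almost all s. A
    basis of the relation is a pair (A1, A2), where A2 is row free because L is injective. If v = c
    A1 and s v = c A2, then c (1 - s A1 B) = 0 for a right inverse B of A2, and 1 - s A1 B is
    generically invertible. *)
Lemma semicont_vec (C : numClosedFieldType) N (Q : 'rV[C]_N -> 'rV[C]_N -> Prop) :
  Q 0 0 -> (forall u v u' v', Q u v -> Q u' v' -> Q (u + u') (v + v')) ->
  (forall c u v, Q u v -> Q (c *: u) (c *: v)) ->
  (forall v, Q v 0 -> v = 0) -> cofin (fun s : C => forall v, Q v (s *: v) -> v = 0).
Proof.
move=> Q0 QD QZ Qinj.
have [m [A [PA sA]]] := span_pred (fun u : 'rV[C]_(N + N) => Q (lsubmx u) (rsubmx u)).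
have QA u : (u <= A)%MS -> Q (lsubmx u) (rsubmx u).
  move=> /submxP[D ->]; rewrite mulmx_sum_row.
  apply: (big_ind (fun u : 'rV_(N + N) => Q (lsubmx u) (rsubmx u))).
  - by rewrite !raddf0.
  - by move=> x y Qx Qy; rewrite !raddfD; apply: QD.
  - by move=> i _; rewrite !linearZ; apply: QZ; apply: PA.
pose A1 := lsubmx (row_base A); pose A2 := rsubmx (row_base A).
have E c : c *m row_base A = row_mx (c *m A1) (c *m A2) by rewrite -mul_mx_row hsubmxK.
have inj c : c *m A1 = 0 -> c *m A2 = 0 -> c = 0.
  move=> e1 e2; apply: (row_free_inj (row_base_free A)).
  by rewrite mul0mx E e1 e2 row_mx0.
have /row_freeP[B AB] : row_free A2.
  apply: inj_row_free => c e; apply: inj => //; apply: Qinj.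
  have : (c *m row_base A <= A)%MS by rewrite mulmx_sub // eq_row_base.
  by move/QA; rewrite E row_mxKl row_mxKr e.
apply: cofin_imp (cofin_unitmx (- (A1 *m B)) (unitmx1 C (\rank A))) => s us v /= Qv.
have /submxP[c e] : (row_mx v (s *: v) <= row_base A)%MS.
  by rewrite eq_row_base; apply: sA; rewrite row_mxKl row_mxKr.
move: e; rewrite E => /eq_row_mx[ev es].
suff c0 : c = 0 by rewrite ev c0 mul0mx.
apply: (row_free_inj (A := 1%:M + s *: - (A1 *m B))); first by rewrite row_free_unit.
by rewrite mul0mx mulmxDr mulmx1 scalerN mulmxN -scalemxAr mulmxA -ev scalemxAl es -mulmxA AB mulmx1 subrr.
Qed.

Section BoundedPolynomials.
Variables (C : numClosedFieldType) (n d m D : nat).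
Notation S := {mpoly C[n]}.

Let I := ('I_d * 'I_m * 'X_{1..n < D})%type.

Definition decode (v : 'rV[C]_#|{: I}|) : 'M[S]_(d, m) :=
  \matrix_(i, j) \sum_(t : 'X_{1..n < D}) v 0 (enum_rank (i, j, t)) *: 'X_[t].

Lemma decode_lin c u v : decode (c *: u + v) = map_mx ( *:%R c) (decode u) + decode v.
Proof.
apply/matrixP => i j; rewrite !mxE scaler_sumr -big_split; apply: eq_bigr => t _ /=.
by rewrite !mxE scalerDl scalerA.
Qed.

Lemma decode_surj (P : 'M[S]_(d, m)) : (forall i j, msize (P i j) <= D)%N ->
  exists v, P = decode v.
Proof.
move=> sP; exists (\row_l let: (i, j, t) := (enum_val l : I) in (P i j)@_t).
apply/matrixP => i j; rewrite !mxE {1}(mpolywE (sP i j)); apply: eq_bigr => t _.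
by rewrite mxE enum_rankK.
Qed.

Lemma msize_decode v i j : (msize (decode v i j) <= D)%N.
Proof.
rewrite mxE; apply: (big_ind (fun P : S => (msize P <= D)%N)) => [|P Q hP hQ|t _].
- by rewrite msize0.
- by apply: leq_trans (msizeD_le _ _) _; rewrite geq_max hP hQ.
- by apply: leq_trans (msizeZ_le _ _) _; rewrite msizeX bmdeg.
Qed.

Lemma semicont (Q : 'M[S]_(d, m) -> 'M[S]_(d, m) -> Prop) :
  Q 0 0 -> (forall u v u' v', Q u v -> Q u' v' -> Q (u + u') (v + v')) ->
  (forall c u v, Q u v -> Q (map_mx ( *:%R c) u) (map_mx ( *:%R c) v)) ->
  (forall P : 'M[S]_(d, m), (forall i j, msize (P i j) <= D)%N -> Q P 0 -> P = 0) ->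
  cofin (fun s : C => forall P : 'M[S]_(d, m), (forall i j, msize (P i j) <= D)%N ->
    Q P (map_mx ( *:%R s) P) -> P = 0).
Proof.
move=> Q0 QD QZ Qinj.
have d0 : decode 0 = 0.
  by apply/matrixP => i j; rewrite !mxE big1 // => t _; rewrite mxE scale0r.
have dD u v : decode (u + v) = decode u + decode v.
  rewrite -[u]scale1r decode_lin scale1r; congr (_ + _).
  by apply/matrixP => i j; rewrite !mxE scale1r.
have dZ c u : decode (c *: u) = map_mx ( *:%R c) (decode u).
  by rewrite -[c *: u]addr0 decode_lin d0 addr0.
have dinj v : decode v = 0 -> v = 0.
  move=> /matrixP e; apply/matrixP => i l; rewrite ord1 mxE -(enum_valK l).
  case: (enum_val l : I) => [[a b] t]; have := congr1 (mcoeff t) (e a b).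
  rewrite !mxE mcoeff0 raddf_sum (bigD1 t) //= mcoeffZ mcoeffX eqxx mulr1.
  rewrite big1 ?addr0 // => t' nt; rewrite mcoeffZ mcoeffX.
  by rewrite -[bmnm t' == bmnm t]/(t' == t) (negPf nt) mulr0.
have := @semicont_vec C _ (fun u v => Q (decode u) (decode v)).
rewrite d0 => /(_ Q0) []; first by move=> u v u' v' h h'; rewrite !dD; apply: QD.
- by move=> c u v h; rewrite !dZ; apply: QZ.
- by move=> v /Qinj h; apply/dinj/h/msize_decode.
move=> bad h; exists bad => s /h hs P /decode_surj[v ->]; rewrite -dZ => /hs ->.
exact: d0.
Qed.
End BoundedPolynomials.

Section Lines.
Variables (C : numClosedFieldType) (n : nat).
Notation S := {mpoly C[n]}.
Implicit Types (x v : 'cV[C]_n) (P : S).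

Definition ev x P : C := P.@[fun i => x i 0].
Definition line x v : S -> {poly C} := mmap polyC (fun i => (x i 0)%:P + v i 0 *: 'X).
HB.instance Definition _ x := GRing.RMorphism.copy (ev x) (meval (fun i => x i 0)).
HB.instance Definition _ x v := 
  GRing.RMorphism.copy (line x v) (mmap polyC (fun i => (x i 0)%:P + v i 0 *: 'X)).

Lemma evC x c : ev x c%:MP = c. Proof. exact: mevalC. Qed.
Lemma evX x i : ev x 'X_i = x i 0. Proof. exact: mevalXU. Qed.
Lemma evZ x c P : ev x (c *: P) = c * ev x P. Proof. exact: mevalZ. Qed.

Lemma lineC x v c : line x v c%:MP = c%:P. Proof. exact: mmapC. Qed.
Lemma lineX x v i : line x v 'X_i = (x i 0)%:P + v i 0 *: 'X.
Proof. by rewrite /line mmapX mmap1U. Qed.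

Lemma line_ev x v P (t : C) : (line x v P).[t] = ev (x + t *: v) P.
Proof.
move: P; apply: mpoly_alg_ind => [c|i|P Q eP eQ|P Q eP eQ].
- by rewrite lineC evC hornerC.
- by rewrite lineX evX !hornerE !mxE mulrC.
- by rewrite !rmorphD hornerD eP eQ.
- by rewrite !rmorphM hornerM eP eQ.
Qed.

Lemma line_der x v P : (line x v P)^`() = line x v (pder v P).
Proof.
move: P; apply: mpoly_alg_ind => [c|i|P Q eP eQ|P Q eP eQ].
- by rewrite lineC pderC rmorph0 derivC.
- by rewrite lineX pderX lineC derivD derivZ derivX derivC add0r alg_polyC.
- by rewrite pderD !rmorphD derivD eP eQ.
- by rewrite pderM rmorphM derivM eP eQ rmorphD !rmorphM.
Qed.

Lemma horner_eq0 (p : {poly C}) : (forall t, p.[t] = 0) -> p = 0.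
Proof.
move=> h; apply/eqP; apply: contraT => p0.
by have [s] := cofin_ex (cofin_root p0); rewrite /root h eqxx.
Qed.

Lemma ev0 P : ev 0 P = P@_0%MM.
Proof.
move: P; apply: mpoly_alg_ind => [c|i|P Q eP eQ|P Q eP eQ].
- by rewrite evC mcoeffC eqxx mulr1.
- by rewrite evX mxE mcoeffX mnm1_eq0.
- by rewrite rmorphD raddfD /= eP eQ.
- by rewrite rmorphM /= eP eQ -rmorphM.
Qed.

(** The partial derivatives of P vanish everywhere as well, so each coefficient reduces to that of a
    derivative at a smaller monomial. *)
Lemma ev_eq0 P : (forall x, ev x P = 0) -> P = 0.
Proof.
move=> h; apply/mpolyP => m; rewrite mcoeff0.
have [k] := ubnP (mdeg m); elim: k P h m => // k IH P h m.
have [-> _|m0] := eqVneq m 0%MM.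
  by rewrite -ev0 h.
have [i mi] : exists i, m i != 0%N.
  apply/existsP; apply: contraT; rewrite negb_exists => /forallP e.
  by case/eqP: m0; apply/mnmP => i; have := e i; rewrite negbK mnm0E => /eqP.
have -> : m = ((m - U_(i)) + U_(i))%MM.
  by rewrite submK //; apply/mnm_lepP => j; rewrite mnm1E; case: eqP => // <-; rewrite lt0n.
rewrite mdegD mdeg1 addn1 ltnS => le.
have dE : P^`M(i) = pder (delta_mx i 0) P.
  rewrite /pder (bigD1 i) //= mxE !eqxx scale1r big1 ?addr0 // => j ji.
  by rewrite mxE (negPf ji) scale0r.
have : (P^`M(i))@_(m - U_(i)) = 0.
  apply: IH => // x; rewrite dE -[x]addr0 -(scale0r (delta_mx i 0)) -line_ev -line_der.
  by rewrite (horner_eq0 (p := line _ _ P)) ?deriv0 ?horner0 // => t; rewrite line_ev h.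
by rewrite mcoeff_mderiv => /eqP; rewrite mulrn_eq0 => /eqP.
Qed.

(** The coefficient of degree r of the equation expresses D(0) (r + 1) p_{r+1} through Taylor
    coefficients of degree at most r. *)
Lemma linear_ode_unique d (D : {poly C}) (M : 'M[{poly C}]_d) (p : 'I_d -> {poly C}) :
  D.[0] != 0 -> (forall i, D * (p i)^`() = \sum_j M i j * p j) ->
  (forall i, (p i).[0] = 0) -> forall i, p i = 0.
Proof.
move=> D0 ode p0.
suff h r i : (p i)`_r = 0 by move=> i; apply/polyP => r; rewrite h coef0.
elim/ltn_ind: r i => -[|r] IH i; first by rewrite -horner_coef0.
have := congr1 (fun q : {poly C} => q`_r) (ode i).
rewrite coefM big_ord_recl /= subn0 big1 ?addr0 => [|j _]; last first.
  rewrite coef_deriv IH ?mul0rn ?mulr0 //= /bump /=.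
  by have := ltn_ord j; lia.
rewrite coef_sum big1 => [|j _]; last first.
  by rewrite coefM big1 // => l _; rewrite IH ?mulr0 // ltnS leq_subr.
move=> /eqP; rewrite mulf_eq0 -horner_coef0 (negPf D0) /= coef_deriv.
by rewrite mulrn_eq0 => /eqP.
Qed.

End Lines.

End Semicontinuity.
Import Semicontinuity.

(** * Intertwiners of connections and their specialisation *)

Module Intertwiners.

Section Intertwiners.
Variables (C : numClosedFieldType) (gT : finGroupType) (W : {group gT}).
Variables (n : nat) (rV : mx_representation C W n).
Variable alpha : {vspace 'cV[C]_n} -> 'Hom('cV[C]_n, C^o).
Hypothesis faithful : mx_faithful rV.
Hypothesis formsP : is_hyperplane_forms rV alpha.
Variable K : ratfield C n.

Local Notation hyps := (hyperplanes rV).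
Local Notation cst := (cst K).
Local Notation om := (om alpha K).
Local Notation act := (act rV (K := K)).
Local Notation nab tau := (nab rV alpha (K := K) tau).
Local Notation RH tau := (RH rV (K := K) tau).
Local Notation AH tau := (AH rV tau).
Local Notation dunkl tau := (dunkl rV alpha (K := K) tau).
Local Notation cmx := (cmx K).
Local Notation delta := (delta rV alpha).
Local Notation deltaK := (toK K delta).
Local Notation mult := ({vspace 'cV[C]_n} -> nat -> C).

Implicit Types (H : {vspace 'cV[C]_n}) (w g : gT) (x xi : 'cV[C]_n).
Implicit Types (a b kap k l : mult).

(** Fixing N and D confines the matrices to a finite-dimensional space, as semicontinuity
    requires. *)
Definition Preg N D p q (f : 'M[K]_(p, q)) :=
  forall i j, exists P, (msize P <= D)%N /\ deltaK ^+ N * f i j = toK K P.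

Definition lmult (s : C) kap k : mult := fun H i => s * kap H i + k H i.

Let dK0 : deltaK != 0. Proof. exact: (toK_delta_neq0 formsP). Qed.

Lemma semicontK p q N D (Q : 'M[K]_(p, q) -> 'M[K]_(p, q) -> Prop) :
  Q 0 0 -> (forall u v u' v', Q u v -> Q u' v' -> Q (u + u') (v + v')) ->
  (forall c u v, Q u v -> Q (cst c *: u) (cst c *: v)) ->
  (forall G, Preg N D G -> Q G 0 -> G = 0) ->
  cofin (fun s : C => forall G, Preg N D G -> Q G (cst s *: G) -> G = 0).
Proof.
move=> Q0 QD QZ Qinj.
pose ph (P : 'M[{mpoly C[n]}]_(p, q)) : 'M[K]_(p, q) := deltaK ^- N *: map_mx (toK K) P.
have d0 : deltaK ^+ N != 0 by rewrite expf_neq0.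
have phE P i j : deltaK ^+ N * ph P i j = toK K (P i j) by rewrite !mxE mulVKf.
have ph0 : ph 0 = 0 by rewrite /ph map_mx0 scaler0.
have phD P P' : ph (P + P') = ph P + ph P' by rewrite /ph map_mxD scalerDr.
have phZ (c : C) P : ph (map_mx ( *:%R c) P) = cst c *: ph P.
  by apply/matrixP => i j; rewrite !mxE toKZ mulrCA.
have [||||bad h] := @semicont C n p q D (fun u v => Q (ph u) (ph v)).
- by rewrite ph0.
- by move=> u v u' v' h h'; rewrite !phD; apply: QD.
- by move=> c u v h; rewrite !phZ; apply: QZ.
- move=> P sP; rewrite ph0 => /Qinj h.
  have {}h : ph P = 0 by apply: h => i j; exists (P i j); rewrite phE.
  apply/matrixP => i j; rewrite mxE; apply: (@toK_inj _ _ K).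
  by rewrite -phE h mxE mulr0 rmorph0.
exists bad => s /h {}h G PG.
have [P [sP GE]] : exists P : 'M_(p, q), (forall i j, msize (P i j) <= D)%N /\ G = ph P.
  have F (ij : 'I_p * 'I_q) := boolp.cid (PG ij.1 ij.2).
  exists (\matrix_(i, j) sval (F (i, j))); split=> [i j|].
    by rewrite mxE; case: (svalP (F (i, j))).
  apply/matrixP => i j; apply: (mulfI d0); rewrite phE mxE.
  by case: (svalP (F (i, j))) => _ <-.
by rewrite GE -phZ => /(h _ sP) ->.
Qed.

Lemma AH_lmult d (tau : mx_representation C W d) s kap k H :
  AH tau (lmult s kap k) H = s *: AH tau kap H + AH tau k H.
Proof. exact: AH_lin. Qed.

Lemma nab_lmult d q (tau : mx_representation C W d) s kap k xi (f : 'M[K]_(d, q)) :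
  nab tau (lmult s kap k) xi f =
  nab tau k xi f + cst s *: \sum_(H <- hyps) om H xi *: (cmx (AH tau kap H) *m f).
Proof.
rewrite /Operators.nab -addrA; congr (_ + _); rewrite scaler_sumr -big_split.
apply: eq_bigr => H _ /=.
rewrite AH_lmult /Operators.cmx map_mxD map_mxZ -[map_mx _ (AH _ _ _)]/(cmx _).
rewrite mulmxDl scalerDr addrC -scalemxAl !scalerA [om H xi * _]mulrC.
by [].
Qed.

Section Two.
Variables (d m : nat) (tau : mx_representation C W d) (sig : mx_representation C W m).
Implicit Types G : 'M[K]_(d, m).

(* G carries horizontal sections for (sig, a) to horizontal sections for (tau, b). *)
Definition flat b a G := forall xi,
  nab tau b xi G = \sum_(H <- hyps) om H xi *: (G *m cmx (AH sig a H)).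

Definition equi G := forall w, w \in W -> act tau w G = G *m cmx (sig w).

(** Flatness is affine in s, both multiplicities moving in the direction [kap], and equivariance
    does not involve s; [L] below is the value at s = 0 and [L'] the slope. *)
Lemma semicont_flat N D kap k l :
  (forall G, Preg N D G -> flat k l G -> equi G -> G = 0) ->
  cofin (fun s : C => forall G, Preg N D G ->
    flat (lmult s kap k) (lmult s kap l) G -> equi G -> G = 0).
Proof.
move=> inj.
pose L xi G := nab tau k xi G - \sum_(H <- hyps) om H xi *: (G *m cmx (AH sig l H)).
pose L' xi G := \sum_(H <- hyps) om H xi *: (cmx (AH tau kap H) *m G)
  - \sum_(H <- hyps) om H xi *: (G *m cmx (AH sig kap H)).
have sumD (F F' : {vspace 'cV[C]_n} -> 'M[K]_(d, m)) :
    \sum_(H <- hyps) (F H + F' H) = \sum_(H <- hyps) F H + \sum_(H <- hyps) F' H.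
  exact: big_split.
have LD xi u v : L xi (u + v) = L xi u + L xi v.
  rewrite /L nabD [RHS]addrACA -opprD -sumD; congr (_ - _).
  by apply: eq_bigr => H _; rewrite mulmxDl scalerDr.
have LZ xi c u : L xi (cst c *: u) = cst c *: L xi u.
  rewrite /L nabZc scalerBr scaler_sumr; congr (_ - _).
  by apply: eq_bigr => H _; rewrite -scalemxAl !scalerA mulrC.
have LD' xi u v : L' xi (u + v) = L' xi u + L' xi v.
  rewrite /L' [RHS]addrACA -opprD -!sumD; congr (_ - _); apply: eq_bigr => H _.
    by rewrite mulmxDr scalerDr.
  by rewrite mulmxDl scalerDr.
have LZ' xi c u : L' xi (cst c *: u) = cst c *: L' xi u.
  rewrite /L' scalerBr !scaler_sumr; congr (_ - _); apply: eq_bigr => H _.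
    by rewrite -scalemxAr !scalerA mulrC.
  by rewrite -scalemxAl !scalerA mulrC.
have L0 xi : L xi 0 = 0 by rewrite -{1}(scale0r 0) -(rmorph0 cst) LZ rmorph0 scale0r.
have L0' xi : L' xi 0 = 0 by rewrite -{1}(scale0r 0) -(rmorph0 cst) LZ' rmorph0 scale0r.
have := @semicontK d m N D (fun u v => (forall xi, L xi u + L' xi v = 0) /\ equi u).
case.
- by split=> [xi|w wW]; rewrite ?L0 ?L0' ?addr0 // act0 mul0mx.
- move=> u v u' v' [e eu] [e' eu']; split=> [xi|w wW].
    by rewrite LD LD' addrACA e e' addr0.
  by rewrite actD eu // eu' // mulmxDl.
- move=> c u v [e eu]; split=> [xi|w wW]; first by rewrite LZ LZ' -scalerDr e scaler0.
  by rewrite actZc // eu // scalemxAl.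
- move=> G PG [e eu]; apply: inj => // xi.
  by have /eqP := e xi; rewrite L0' addr0 subr_eq0 => /eqP.
move=> bad h; exists bad => s /h {}h G PG fG eG; apply: h => //; split=> // xi.
have := fG xi; rewrite nab_lmult => /eqP; rewrite -subr_eq0 => /eqP <-.
rewrite /L /L'.
have -> : \sum_(H <- hyps) om H xi *: (G *m cmx (AH sig (lmult s kap l) H)) =
    cst s *: (\sum_(H <- hyps) om H xi *: (G *m cmx (AH sig kap H))) +
    \sum_(H <- hyps) om H xi *: (G *m cmx (AH sig l H)).
  rewrite scaler_sumr -sumD; apply: eq_bigr => H _.
  rewrite AH_lmult /Operators.cmx map_mxD map_mxZ mulmxDr scalerDr -scalemxAr !scalerA.
  by rewrite [om H xi * _]mulrC.
have LZs := LZ' xi s G; rewrite /L' in LZs; rewrite LZs scalerBr.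
move: (nab _ _ _ _) (cst s *: _) (cst s *: _) (\sum_(H <- hyps) _) => x1 x2 x3 x4.
by apply/matrixP => i j; rewrite !mxE; ring.
Qed.

End Two.

Lemma Preg_mul N D N' D' p q r (f : 'M[K]_(p, q)) (h : 'M[K]_(q, r)) :
  Preg N D f -> Preg N' D' h -> Preg (N + N') (D + D').+1 (f *m h).
Proof.
move=> Pf Ph i j; rewrite mxE mulr_sumr.
apply: (big_ind (fun e => exists P, (msize P <= (D + D').+1)%N /\ e = toK K P)).
- by exists 0; rewrite msize0 rmorph0.
- move=> x y [P [sP ->]] [P' [sP' ->]]; exists (P + P'); rewrite rmorphD; split=> //.
  by apply: leq_trans (msizeD_le _ _) _; rewrite geq_max sP.
move=> e _; have [P [sP eP]] := Pf i e; have [P' [sP' eP']] := Ph e j.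
exists (P * P'); rewrite rmorphM -eP -eP' exprD; split; last by ring.
by apply: leq_trans (msizeM_le _ _) _; rewrite ltnS leq_add.
Qed.

Lemma Preg_cmx N D p q r (f : 'M[K]_(p, q)) (A : 'M[C]_(q, r)) :
  Preg N D f -> Preg N D (f *m cmx A).
Proof.
move=> Pf i j; rewrite mxE mulr_sumr.
apply: (big_ind (fun e => exists P, (msize P <= D)%N /\ e = toK K P)).
- by exists 0; rewrite msize0 rmorph0.
- move=> x y [P [sP ->]] [P' [sP' ->]]; exists (P + P'); rewrite rmorphD; split=> //.
  by apply: leq_trans (msizeD_le _ _) _; rewrite geq_max sP.
move=> e _; have [P [sP eP]] := Pf i e.
exists (A e j *: P); rewrite toKZ -eP mxE; split; last by ring.
exact: leq_trans (msizeZ_le _ _) _.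
Qed.

Section Comp.
Variables (d m r : nat) (tau : mx_representation C W d) (sig : mx_representation C W m).
Variables (rho : mx_representation C W r) (G : 'M[K]_(d, m)) (h : 'M[K]_(m, r)).

Lemma flat_comp a b e : flat tau sig b a G -> flat sig rho a e h ->
  flat tau rho b e (G *m h).
Proof.
move=> fG fh xi; have eG := fG xi; have eh := fh xi.
rewrite /Operators.nab dmx_mul.
under eq_bigr => H _ do rewrite mulmxA scalemxAl.
rewrite -mulmx_suml addrAC -mulmxDl -[dmx _ _ + _]/(nab tau b xi G) eG mulmx_suml.
under eq_bigr => H _ do rewrite -scalemxAl -mulmxA scalemxAr.
rewrite -mulmx_sumr addrC -mulmxDr -[dmx _ _ + _]/(nab sig a xi h) eh mulmx_sumr.
by apply: eq_bigr => H _; rewrite -scalemxAr mulmxA.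
Qed.

Lemma equi_comp : equi tau sig G -> equi sig rho h -> equi tau rho (G *m h).
Proof. by move=> eG eh w wW; rewrite act_mulr eG // -mulmxA -[cmx _ *m _]/(act sig w h) eh // mulmxA. Qed.
End Comp.

Section Evaluation.
Variable x0 : 'cV[C]_n.
Hypothesis x0reg : ev x0 delta != 0.

Definition van N p q (f : 'M[K]_(p, q)) := forall i j,
  exists P, deltaK ^+ N * f i j = toK K P /\ ev x0 P = 0.

Definition omnum H xi : {mpoly C[n]} :=
  (alpha H xi : C) *: \prod_(H' <- hyps | H' != H) lform alpha H'.

Lemma omnumE H xi : H \in hyps -> deltaK * om H xi = toK K (omnum H xi).
Proof.
move=> HH; have a0 := aK_neq0 formsP K HH.
rewrite toK_delta (bigD1_seq H) ?hyps_uniq //= /omnum toKZ rmorph_prod /LocalRing.om.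
by rewrite mulrC -mulrA mulKf.
Qed.

(* Along every line through x0 the numerators satisfy a linear ODE which is
   regular at x0. *)
Lemma flat_van_eq0 d q (tau : mx_representation C W d) b N (f : 'M[K]_(d, q)) :
  (forall xi, nab tau b xi f = 0) -> van N f -> f = 0.
Proof.
move=> ff vf; apply/matrixP => i0 j; rewrite mxE.
have dN0 : deltaK ^+ N != 0 by rewrite expf_neq0.
pose P i := sval (boolp.cid (vf i j)).
have PE i : deltaK ^+ N * f i j = toK K (P i) by have [] := svalP (boolp.cid (vf i j)).
have P0 i : ev x0 (P i) = 0 by have [] := svalP (boolp.cid (vf i j)).
clearbody P.
suff Pz : P i0 = 0 by apply: (mulfI dN0); rewrite mulr0 PE Pz rmorph0.
apply: ev_eq0 => x; pose v := x - x0.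
(* Horizontality of f, multiplied by delta^(N + 1), is a system with polynomial coefficients for P =
   delta^N f. *)
pose M : 'M[{mpoly C[n]}]_d := \matrix_(i, l) ((N%:R * pder v delta) *+ (i == l)
  - \sum_(H <- hyps) AH tau b H i l *: omnum H v).
have ode i : delta * pder v (P i) = \sum_l M i l * P l.
  apply: (@toK_inj _ _ K); rewrite rmorphM -dKE -PE rmorph_sum dKM dKX.
  have := congr1 (fun A : 'M[K]_(d, q) => A i j) (ff v).
  rewrite !mxE summxE => /eqP; rewrite addr_eq0 => /eqP ->.
  have -> : \sum_l toK K (M i l * P l) =
      toK K (N%:R * pder v delta) * (deltaK ^+ N * f i j) -
      \sum_l \sum_(H <- hyps) cst (AH tau b H i l) * (deltaK * om H v) * (deltaK ^+ N * f l j).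
    transitivity (\sum_l ((toK K (N%:R * pder v delta) * (deltaK ^+ N * f l j)) *+ (i == l) -
        \sum_(H <- hyps) cst (AH tau b H i l) * (deltaK * om H v) * (deltaK ^+ N * f l j))).
      apply: eq_bigr => l _; rewrite mxE mulrBl rmorphB; congr (_ - _).
        by rewrite PE; case: (i == l); rewrite ?mulr1n ?mulr0n ?mul0r ?rmorph0 // [LHS]rmorphM.
      rewrite rmorphM rmorph_sum mulr_suml !big_seq; apply: eq_bigr => H HH.
      by rewrite toKZ omnumE // PE.
    rewrite sumrB; congr (_ - _).
    rewrite (bigD1 i) //= eqxx mulr1n big1 ?addr0 // => l.
    by rewrite eq_sym => /negPf ->.
  rewrite exchange_big /= rmorphM rmorph_nat -dKE mulrDr; congr (_ + _).
    have eN : N%:R * deltaK ^+ N = N%:R * deltaK ^+ N.-1 * deltaK.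
      by case: (N) => [|N']; rewrite ?mul0r // exprSr mulrA.
    by rewrite [RHS]mulrA [_ * deltaK ^+ N]mulrAC eN; ring.
  rewrite !mulrN; congr (- _); rewrite !mulr_sumr; apply: eq_bigr => H _.
  rewrite !mxE !mulr_sumr; apply: eq_bigr => l _; rewrite !mxE; ring.
have e0 Q : (line x0 v Q).[0] = ev x0 Q by rewrite line_ev scale0r addr0.
have lP : line x0 v (P i0) = 0.
  apply: (@linear_ode_unique C d (line x0 v delta) (map_mx (line x0 v) M)
      (fun i => line x0 v (P i))) => [|i|i]; rewrite ?e0 //.
  rewrite line_der -rmorphM ode rmorph_sum; apply: eq_bigr => l _.
  by rewrite [X in _ = X * _]mxE rmorphM.
have <- : (line x0 v (P i0)).[1] = ev x (P i0) by rewrite line_ev scale1r addrC subrK.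
by rewrite lP horner0.
Qed.

Lemma van0 N p q : van N (0 : 'M[K]_(p, q)).
Proof. by move=> i j; exists 0; rewrite mxE mulr0 !rmorph0. Qed.

Lemma vanD N p q (f h : 'M[K]_(p, q)) : van N f -> van N h -> van N (f + h).
Proof.
move=> vf vh i j; have [P [eP zP]] := vf i j; have [Q [eQ zQ]] := vh i j.
by exists (P + Q); rewrite mxE mulrDr eP eQ !rmorphD /= zP zQ addr0.
Qed.

Lemma vanZ N p q (c : C) (f : 'M[K]_(p, q)) : van N f -> van N (cst c *: f).
Proof.
move=> vf i j; have [P [eP zP]] := vf i j.
by exists (c *: P); rewrite mxE mulrCA eP toKZ evZ zP mulr0.
Qed.

Section Generic.
Variables (d : nat) (tau : mx_representation C W d).
Variables (kap : mult) (k : {vspace 'cV[C]_n} -> nat -> int).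
Hypothesis ikap : invmult rV kap.
Let kC : mult := fun H i => (k H i)%:~R.
Hypothesis ik : invmult rV kC.
Local Notation T s := (dunkl tau (as_ kap s) (bs_ kap k s)).

(** At s = 0 the operators are nabla(k), whose horizontal sections are determined by their value at
    x0; semicontinuity carries this to almost all s. *)
Lemma generic_inj q N D : cofin (fun s : C => forall f : 'M[K]_(d, q), Preg N D f ->
  (forall xi, T s xi f = 0) -> van N f -> f = 0).
Proof.
pose Z xi (f : 'M[K]_(d, q)) := \sum_(H <- hyps) om H xi *: (cmx (AH tau kap H) *m f - RH tau kap H f).
have ZD xi u v : Z xi (u + v) = Z xi u + Z xi v.
  rewrite /Z -big_split; apply: eq_bigr => H _.
  by rewrite mulmxDr RHD opprD addrACA scalerDr.
have ZZ xi c u : Z xi (cst c *: u) = cst c *: Z xi u.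
  rewrite /Z scaler_sumr; apply: eq_bigr => H _.
  by rewrite RHZc -scalemxAr -scalerBr !scalerA mulrC.
have Z0 xi : Z xi 0 = 0 by rewrite -{1}(scale0r 0) -(rmorph0 cst) ZZ rmorph0 scale0r.
have := @semicontK d q N D (fun u v => (forall xi, nab tau kC xi u + Z xi v = 0) /\ van N u).
case.
- by split=> [xi|]; [rewrite nab0 Z0 addr0 | exact: van0].
- move=> u v u' v' [e eu] [e' eu']; split=> [xi|]; last exact: vanD.
  by rewrite nabD ZD addrACA e e' addr0.
- move=> c u v [e eu]; split=> [xi|]; last exact: vanZ.
  by rewrite nabZc ZZ -scalerDr e scaler0.
- move=> G PG [e eu]; apply: (flat_van_eq0 (tau := tau) (b := kC)) eu => xi.
  by have := e xi; rewrite Z0 addr0.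
move=> bad h; exists bad => s /h {}h f Pf Tf vf; apply: h => //; split=> // xi.
rewrite -(Tf xi) /Operators.dunkl -[bs_ kap k s]/(lmult s kap kC) nab_lmult -(addrA (nab tau kC xi f)).
congr (nab tau kC xi f + _); rewrite ZZ /Z !scaler_sumr -sumrB; apply: eq_bigr => H _.
by rewrite RH_scale scalerBr scalerBr !scalerA [om H xi * _]mulrC.
Qed.

End Generic.

End Evaluation.
End Intertwiners.

End Intertwiners.
Import Intertwiners.

(** * Intertwiners for generic parameters *)

Module GenericIntertwiners.

Section Representations.
Variables (C : numClosedFieldType) (gT : finGroupType) (W : {group gT}).

Lemma closed_char'_group : ([pchar C]^').-group%g W.
Proof.
rewrite /pgroup /pnat cardG_gt0; apply/allP => p _.
by rewrite inE /= (pchar_num C).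
Qed.

Lemma irr_dim_gt0 d (tau : mx_representation C W d) : mx_irreducible tau -> (0 < d)%N.
Proof.
case=> _ h _; case: d tau h => // tau.
by rewrite [1%:M]flatmx0 eqxx.
Qed.

Lemma schur_scalar d (tau : mx_representation C W d) (A : 'M[C]_d) : mx_irreducible tau ->
  (forall w, w \in W -> tau w *m A = A *m tau w) -> exists c, A = c%:M.
Proof.
move=> irr cA; have d0 := irr_dim_gt0 irr.
have [c rc] : exists c, root (char_poly A) c.
  by apply/closed_rootP; rewrite size_char_poly eqSS -lt0n.
exists c; apply/eqP; rewrite -subr_eq0; apply: contraTT rc => ne.
rewrite -eigenvalue_root_char; apply/negP => /eigenvalueP[v ev v0].
have : A - c%:M \in unitmx.
  apply: (mx_Schur irr) ne; apply/centgmxP => w wW.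
  by rewrite mulmxBl mulmxBr cA // scalar_mxC.
rewrite -row_free_unit => /row_free_inj inj; case/eqP: v0; apply: inj.
by rewrite mul0mx mulmxBr ev mul_mx_scalar subrr.
Qed.

Lemma irr_intertwiner_row_full p d (rho : mx_representation C W p)
    (sig : mx_representation C W d) (A : 'M[C]_(p, d)) : mx_irreducible sig -> A != 0 ->
  (forall w, w \in W -> rho w *m A = A *m sig w) -> row_full A.
Proof.
move=> [_ _ irr] A0 cA; rewrite -sub1mx -(genmxE A); apply: irr; last 2 first.
- exact: submx1.
- by apply: contra A0; rewrite -!submx0 genmxE.
apply/mxmoduleP => w wW; rewrite (eqmxMr _ (genmxE A)) genmxE -cA //.
exact: submxMl.
Qed.

Lemma irr_intertwiner_row_free p d (rho : mx_representation C W p)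
    (sig : mx_representation C W d) (A : 'M[C]_(p, d)) : mx_irreducible rho -> A != 0 ->
  (forall w, w \in W -> rho w *m A = A *m sig w) -> row_free A.
Proof.
move=> [_ _ irr] A0 cA; rewrite -kermx_eq0; apply: contraNT A0 => k0.
have /submxP[D e] : (1%:M <= kermx A)%MS.
  apply: irr k0; rewrite ?submx1 //; apply/mxmoduleP => w wW.
  by apply/sub_kermxP; rewrite -mulmxA cA // mulmxA mulmx_ker mul0mx.
by rewrite -[A]mul1mx e -[D *m _ *m _]mulmxA mulmx_ker mulmx0.
Qed.

Lemma irr_intertwiner_eq (sT : irrType C W) (i j : sT) (A : 'M[C]_(irr_degree i, irr_degree j)) :
  A != 0 -> (forall w, w \in W -> irr_repr i w *m A = A *m irr_repr j w) -> i = j.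
Proof.
move=> A0 cA; have fu := irr_intertwiner_row_full (socle_irr j) A0 cA.
have fA := irr_intertwiner_row_free (socle_irr i) A0 cA.
have e : irr_degree i = irr_degree j.
  by move: fA fu => /eqP e1 /eqP e2; apply: etrans (esym e1) e2.
rewrite -(irr_reprK_pchar closed_char'_group i) -(irr_reprK_pchar closed_char'_group j).
apply: (irr_comp_rsim_pchar _ closed_char'_group).
exact: MxReprSim e fA cA.
Qed.

(** A simple submodule is split off by Maschke. On row vectors A maps rho onto it; on column
    vectors, where twists act, A embeds the irreducible representation into rho. *)
Lemma irr_quotient (sT : irrType C W) d (rho : mx_representation C W d) : (0 < d)%N ->
  exists (j : sT) (A : 'M[C]_(d, irr_degree j)), row_full A /\
  forall w, w \in W -> rho w *m A = A *m irr_repr j w.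
Proof.
move=> d0; have n1 : 1%:M != 0 :> 'M[C]_d by rewrite -mxrank_eq0 mxrank1 -lt0n.
have [U simU _] := dec_mxsimple_exists (mxmodule1 rho) n1.
have modU := mxsimple_module simU.
have [V modV UV dUV] := mx_Maschke_pchar rho closed_char'_group modU (submx1 U).
have cap0 : (U :&: V)%MS = 0 by apply/mxdirect_addsP.
have irrU : mx_irreducible (submod_repr modU) by apply/submod_mx_irr.
have [B e fB cB] := rsim_irr_comp_pchar sT closed_char'_group irrU.
exists (irr_comp sT (submod_repr modU)).
pose A := in_submod U (proj_mx U V) *m B; exists A.
have cA w : w \in W -> rho w *m A = A *m irr_repr (irr_comp sT (submod_repr modU)) w.
  move=> wW; rewrite /A [LHS]mulmxA -[RHS]mulmxA -cB // [RHS]mulmxA; congr (_ *m B).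
  rewrite -[RHS]in_submodJ; last by rewrite -[proj_mx U V]mul1mx proj_mx_sub.
  have /hom_mxP h : (1%:M <= dom_hom_mx rho (proj_mx U V))%MS.
    by apply: submx_trans (proj_mx_hom cap0 modU modV); rewrite UV.
  have := h w wW; rewrite !mul1mx => <-.
  by rewrite [in LHS]in_submodE [in RHS]in_submodE mulmxA.
split=> //; apply: irr_intertwiner_row_full cA; first exact: socle_irr.
apply/eqP => A0; case: (simU) => _ /eqP U0 _; case: U0.
have p0 : in_submod U (proj_mx U V) = 0.
  by apply: (row_free_inj fB); rewrite mul0mx.
rewrite -(proj_mx_id cap0 (submx_refl U)) -(in_submodK (proj_mx_sub U V U)).
by rewrite in_submodE -mulmxA -in_submodE p0 mulmx0 linear0.
Qed.

End Representations.
Section GenericIntertwiner.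
Variables (C : numClosedFieldType) (gT : finGroupType) (W : {group gT}).
Variables (n : nat) (rV : mx_representation C W n).
Variable alpha : {vspace 'cV[C]_n} -> 'Hom('cV[C]_n, C^o).
Hypothesis faithful : mx_faithful rV.
Hypothesis formsP : is_hyperplane_forms rV alpha.
Variable K : ratfield C n.

Local Notation hyps := (hyperplanes rV).
Local Notation cst := (cst K).
Local Notation wK := (wK rV K).
Local Notation act := (act rV (K := K)).
Local Notation AH tau := (AH rV tau).
Local Notation dunkl tau := (dunkl rV alpha (K := K) tau).
Local Notation cmx := (cmx K).
Local Notation delta := (delta rV alpha).
Local Notation deltaK := (toK K delta).
Local Notation mult := ({vspace 'cV[C]_n} -> nat -> C).

Implicit Types (H : {vspace 'cV[C]_n}) (w g : gT) (x xi : 'cV[C]_n).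
Implicit Types (a b kap l : mult).
Local Notation Preg := (Preg rV alpha (K := K)).
Local Notation flat := (flat rV alpha (K := K)).
Local Notation equi := (equi rV (K := K)).



Let dK0 : deltaK != 0. Proof. exact: (toK_delta_neq0 formsP). Qed.

Definition regB B p q (f : 'M[K]_(p, q)) := forall i j, exists P, deltaK ^+ B * f i j = toK K P.

(** A nonzero numerator delta^B f_{ij} has degree B |A| + c, where |A| is the number of hyperplanes,
    so one D serves all f. If this is not a natural number, all numerators are zero and D = 0 will
    do. *)
Lemma homogeneous_bound B (c : C) : exists D, forall p q (f : 'M[K]_(p, q)),
  emx f = cst c *: f -> regB B f -> Preg B D f.
Proof.
have hom p q (f : 'M[K]_(p, q)) i j P : emx f = cst c *: f -> deltaK ^+ B * f i j = toK K P ->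
    P != 0 -> exists2 k : nat, (B * size hyps)%:R + c = k%:R & msize P = k.+1.
  move=> ef eP P0; apply: (@euler_toK _ _ K _ _ _ P0).
  rewrite -eP eulerM euler_deltaKX.
  have := congr1 (fun A : 'M[K]_(p, q) => A i j) ef; rewrite !mxE => ->.
  by rewrite rmorphD; ring.
have [[k ek]|nk] := boolp.EM (exists k : nat, (B * size hyps)%:R + c = k%:R).
  exists k.+1 => p q f ef rf i j; have [P eP] := rf i j; exists P; split=> //.
  have [->|P0] := eqVneq P 0; first by rewrite msize0.
  have [k' ek' ->] := hom _ _ _ _ _ _ ef eP P0.
  by move: ek'; rewrite ek => /eqP; rewrite eqr_nat => /eqP ->.
exists 0%N => p q f ef rf i j; have [P eP] := rf i j; exists P; split=> //.
have [->|P0] := eqVneq P 0; first by rewrite msize0.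
by have [k' ek' _] := hom _ _ _ _ _ _ ef eP P0; case: nk; exists k'.
Qed.

Lemma regB_act B d q (tau : mx_representation C W d) w (f : 'M[K]_(d, q)) :
  w \in W -> regB B f -> regB B (act tau w f).
Proof.
move=> wW rf i j; rewrite mxE mulr_sumr.
apply: (big_ind (fun e => exists P, e = toK K P)).
- by exists 0; rewrite rmorph0.
- by move=> x y [P ->] [P' ->]; exists (P + P'); rewrite rmorphD.
move=> l _; have [P eP] := rf l j.
have [c0 c00 e] := wK_delta formsP K wW.
exists ((tau w i l * c0^-1 ^+ B) *: subst (rV w^-1%g) P).
have uV := unit_rVV rV wW.
rewrite toKZ -sKE // -eP !mxE [sK _ _ _]rmorphM rmorphXn /= -[sK K _ deltaK]/(wK w deltaK) e.
rewrite rmorphM exprMn -[sK K _ (f l j)]/(wK w (f l j)) rmorphXn fmorphV exprVn.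
set c1 := cst c0 ^+ B; have c10 : c1 != 0 by rewrite expf_neq0 // fmorph_eq0.
by field.
Qed.

Variables (sT : irrType C W) (x0 : 'cV[C]_n).
Hypothesis x0reg : ev x0 delta != 0.
Variables (d : nat) (tau : mx_representation C W d).
Hypothesis irr : mx_irreducible tau.
Variables (kap : mult) (k : {vspace 'cV[C]_n} -> nat -> int).
Hypothesis ikap : invmult rV kap.
Let kC : mult := fun H i => (k H i)%:~R.
Hypothesis ik : invmult rV kC.
Variable B : nat.
Hypothesis kB : forall H i, H \in hyps -> (i < n_ rV H)%N -> ((n_ rV H)%:Z * `|k H i| <= B%:Z)%R.
Local Notation T s := (dunkl tau (as_ kap s) (bs_ kap k s)).

(** W permutes the residues by conjugation, so their sum commutes with tau and Schur's lemma
    applies. *)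
Lemma AH_sum_scalar b : invmult rV b -> exists c, \sum_(H <- hyps) AH tau b H = c%:M.
Proof.
move=> ib; apply: (schur_scalar irr) => w wW; rewrite mulmx_sumr mulmx_suml.
rewrite -[RHS](hmove_sum rV _ wW) !big_seq; apply: eq_bigr => H HH.
exact: AH_conj.
Qed.

(** W acts on the kernel basis G0 by constant matrices R(w), a representation rho. On G0 the
    difference terms become right multiplication by the residues of rho, so T G0 = 0 turns into an
    intertwining relation, which is then restricted to an irreducible constituent of rho. *)
Lemma generic_intertwiner : exists N D, cofin (fun s : C =>
  exists (j : sT) (G : 'M[K]_(d, irr_degree j)), [/\ Preg N D G,
    flat tau (irr_repr j) (bs_ kap k s) (as_ kap s) G, equi tau (irr_repr j) G & row_full G]).
Proof.
have [ckap eckap] := AH_sum_scalar ikap; have [ck eck] := AH_sum_scalar ik.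
(* The Euler eigenvalue of the kernel does not involve s, so the bound D is uniform in s. *)
have [D hD] := homogeneous_bound B (- ck).
have d0 := irr_dim_gt0 irr.
exists B, D.
have := cofinI (generic_kernel faithful formsP K ikap ik kB eckap eck)
  (cofinI (generic_inj formsP K x0reg tau kap k d B D) (generic_inj formsP K x0reg tau kap k 1 B D)).
apply: cofin_imp => s [[G0 [uG0 TG0 eG0 rG0]] [injd inj1]].
have choose q (f : 'M[K]_(d, q)) : regB B f -> exists F : 'M[{mpoly C[n]}]_(d, q),
    forall i j, deltaK ^+ B * f i j = toK K (F i j).
  move=> rf; exists (\matrix_(i, j) sval (boolp.cid (rf i j))) => i j.
  by rewrite mxE; case: (boolp.cid (rf i j)).
have [P eP] := choose _ _ rG0.
pose E : 'M[C]_d := map_mx (ev x0) P.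
have numA q (A : 'M[C]_(d, q)) i j :
    deltaK ^+ B * (G0 *m cmx A) i j = toK K (\sum_l A l j *: P i l).
  rewrite mxE mulr_sumr rmorph_sum; apply: eq_bigr => l _.
  by rewrite mulrA eP toKZ mulrC !mxE.
have evA q (A : 'M[C]_(d, q)) i j : ev x0 (\sum_l A l j *: P i l) = (E *m A) i j.
  by rewrite rmorph_sum [RHS]mxE; apply: eq_bigr => l _; rewrite [LHS]evZ mxE mulrC.
have TA q xi (A : 'M[C]_(d, q)) : T s xi (G0 *m cmx A) = 0.
  by rewrite dunkl_mulr TG0 mul0mx.
have eA q (A : 'M[C]_(d, q)) : emx (G0 *m cmx A) = cst (- ck) *: (G0 *m cmx A).
  rewrite scalemxAl -eG0; apply/matrixP => i j; rewrite !mxE raddf_sum.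
  by apply: eq_bigr => l _; rewrite !mxE /= mulrC eulerZ mulrC.
have rA q (A : 'M[C]_(d, q)) : regB B (G0 *m cmx A).
  by move=> i j; exists (\sum_l A l j *: P i l).
(* A constant combination of the columns of G0 whose numerators vanish at x0 is zero by [inj1]. *)
have uE : E \in unitmx.
  rewrite -unitmx_tr -row_free_unit; apply: inj_row_free => v ev0.
  have E0 : E *m v^T = 0 by apply: trmx_inj; rewrite trmx_mul trmxK trmx0.
  have : G0 *m cmx v^T = 0.
    apply: inj1 => // [|i j]; first exact: hD.
    by exists (\sum_l v^T l j *: P i l); rewrite numA evA E0 mxE.
  move/(congr1 (mulmx (invmx G0))); rewrite mulKmx // mulmx0 => /matrixP c0.
  apply/matrixP => i j; have := c0 j i; rewrite !mxE => /eqP.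
  by rewrite fmorph_eq0 => /eqP.
(* A is chosen so that f and G0 A have the same numerators at x0; [injd] then makes them equal. *)
have secE (f : 'M[K]_d) : (forall xi, T s xi f = 0) -> emx f = cst (- ck) *: f ->
    regB B f -> exists A, f = G0 *m cmx A.
  move=> Tf ef rf; have [F eF] := choose _ _ rf.
  exists (invmx E *m map_mx (ev x0) F); set A := invmx E *m _.
  apply/eqP; rewrite -subr_eq0; apply/eqP.
  have negE : - (G0 *m cmx A) = cst (- 1) *: (G0 *m cmx A) by rewrite rmorphN1 scaleN1r.
  have rfA : regB B (f - G0 *m cmx A).
    move=> i j; have [Q eQ] := rA _ A i j; exists (F i j - Q).
    by rewrite !mxE mulrBr eF rmorphB -eQ !mxE.
  apply: injd.
  - apply: hD rfA.
    by rewrite negE emxD emxZc ef eA scalerDr !scalerA mulrC.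
  - by move=> xi; rewrite negE dunklD dunklZ Tf TA scaler0 addr0.
  move=> i j; exists (F i j - \sum_l A l j *: P i l); split.
    by rewrite [in LHS]mxE [X in _ * (_ + X)]mxE mulrBr eF numA rmorphB.
  by rewrite rmorphB /= evA /A mulKVmx // mxE subrr.
have ia : invmult rV (as_ kap s) by move=> H w i HH wW lt; rewrite /as_ ikap.
have ib : invmult rV (bs_ kap k s).
  by move=> H w i HH wW lt; rewrite /bs_ ia //; congr (_ + _); apply: ik.
have [R RE] : exists R : gT -> 'M[C]_d,
    forall w, w \in W -> act tau w G0 = G0 *m cmx (R w).
  suff h w : exists A : 'M[C]_d, w \in W -> act tau w G0 = G0 *m cmx A.
    by have [R hR] := boolp.choice h; exists R.
  have [wW|nW] := boolP (w \in W); last by exists 0.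
  have [||| A eA'] := secE (act tau w G0); last by exists A.
  - move=> xi; have := act_dunkl formsP tau (rV w^-1%g *m xi) G0 ia ib wW.
    by rewrite TG0 act0 mulmxA -repr_mxM ?groupV // mulgV repr_mx1 mul1mx => <-.
  - by rewrite emx_act // eG0 actZc.
  - exact: regB_act.
have inj (A A' : 'M[C]_d) : G0 *m cmx A = G0 *m cmx A' -> A = A'.
  move/(congr1 (mulmx (invmx G0))); rewrite !mulKmx // => /matrixP e.
  by apply/matrixP => i j; have := e i j; rewrite !mxE => /fmorph_inj.
have Rrepr : mx_repr W R.
  split=> [|w g wW gW]; apply: inj.
    by rewrite -RE // act1 /Operators.cmx map_mx1 mulmx1.
  rewrite -RE ?groupM // actM // RE // act_mulr RE // map_wK_cmx // -mulmxA.
  by rewrite /Operators.cmx map_mxM.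
pose rho := MxRepresentation Rrepr.
have [j [A [fA cA]]] := irr_quotient sT rho d0; exists j, (G0 *m cmx A).
have eG0R : equi tau rho G0 by [].
have fG0R : flat tau rho (bs_ kap k s) (as_ kap s) G0.
  move=> xi; have /eqP := TG0 xi; rewrite subr_eq0 => /eqP ->.
  apply: eq_bigr => H _; congr (_ *: _); rewrite AHE /Operators.cmx raddf_sum mulmx_sumr.
  apply: eq_bigr => w wH; have wW := pt_stab_sub wH.
  by rewrite RE //= map_mxZ scalemxAr.
split.
- exact: Preg_cmx (hD _ _ _ eG0 rG0).
- apply: (flat_comp fG0R) => xi; rewrite /Operators.nab.
  have -> : dmx xi (cmx A) = 0 by apply/matrixP => i l; rewrite !mxE dK_cst.
  rewrite add0r; apply: eq_bigr => H _; rewrite /Operators.cmx -!map_mxM; congr (_ *: map_mx _ _).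
  rewrite !AHE mulmx_suml mulmx_sumr; apply: eq_bigr => w wH.
  by rewrite -scalemxAl -scalemxAr -cA ?(pt_stab_sub wH).
- apply: (equi_comp eG0R) => w wW.
  by rewrite /Operators.act map_wK_cmx // /Operators.cmx -!map_mxM -cA.
have fG0 : row_full G0 by rewrite row_full_unit.
by rewrite /row_full (eqmxMfull _ fG0) -[_ == _]/(row_full _) row_full_map.
Qed.

End GenericIntertwiner.

End GenericIntertwiners.
Import GenericIntertwiners.

(** * Twists: existence, uniqueness and composition *)

Module Twists.

Section Twists.
Variables (C : numClosedFieldType) (gT : finGroupType) (W : {group gT}).
Variables (n : nat) (rV : mx_representation C W n).
Variable alpha : {vspace 'cV[C]_n} -> 'Hom('cV[C]_n, C^o).
Hypothesis faithful : mx_faithful rV.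
Hypothesis formsP : is_hyperplane_forms rV alpha.
Variable K : ratfield C n.

Local Notation hyps := (hyperplanes rV).
Local Notation cst := (cst K).
Local Notation om := (om alpha K).
Local Notation nab tau := (nab rV alpha (K := K) tau).
Local Notation AH tau := (AH rV tau).
Local Notation cmx := (cmx K).
Local Notation delta := (delta rV alpha).
Local Notation deltaK := (toK K delta).
Local Notation mult := ({vspace 'cV[C]_n} -> nat -> C).

Implicit Types (H : {vspace 'cV[C]_n}) (w g : gT) (x xi : 'cV[C]_n).
Implicit Types (kap : mult).
Local Notation Preg := (Preg rV alpha (K := K)).
Local Notation flat := (flat rV alpha (K := K)).
Local Notation equi := (equi rV (K := K)).
Local Notation lmult := (@lmult C n).



Let dK0 : deltaK != 0. Proof. exact: (toK_delta_neq0 formsP). Qed.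

Local Notation regB := (regB rV alpha (K := K)).
Local Notation kC k := (fun H i => (k H i)%:~R : C).

Lemma regB_up B B' p q (f : 'M[K]_(p, q)) : regB B f -> regB (B' + B) f.
Proof.
move=> rf i j; have [P eP] := rf i j; exists (delta ^+ B' * P).
by rewrite rmorphM -eP rmorphXn exprD mulrA.
Qed.

Lemma Preg_regB N D p q (f : 'M[K]_(p, q)) : Preg N D f -> regB N f.
Proof. by move=> Pf i j; have [P [_ eP]] := Pf i j; exists P. Qed.

(** The constant vectors killed by G form a subrepresentation of sig, which is not everything
    because G is nonzero; irreducibility makes it zero. *)
Lemma equi_inj d m (tau : mx_representation C W d) (sig : mx_representation C W m)
    (G : 'M[K]_(d, m)) : mx_irreducible sig -> equi tau sig G -> G != 0 ->
  forall v : 'cV[C]_m, G *m cmx v = 0 -> v = 0.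
Proof.
move=> irr eG G0.
have [p [A [PA sA]]] := span_pred (fun v : 'rV[C]_m => G *m cmx v^T = 0).
have GA : G *m cmx A^T = 0.
  apply/matrixP => i j; have /matrixP/(_ i 0) := PA j; rewrite !mxE => e; rewrite -[RHS]e.
  by apply: eq_bigr => l _; rewrite !mxE.
pose N := kermx A^T.
have modN : mxmodule sig N.
  apply/mxmoduleP => w wW; apply/sub_kermxP.
  have /submxP[X eX] : (A *m (sig w)^T <= A)%MS.
    apply/row_subP => i; apply: sA; rewrite row_mul trmx_mul trmxK.
    have e : cmx (sig w *m (row i A)^T) = cmx (sig w) *m cmx (row i A)^T by rewrite /Operators.cmx map_mxM.
    rewrite e mulmxA -eG // -(map_wK_cmx rV K (row i A)^T wW) -act_mulr PA.
    by rewrite act0.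
  have {}eX : sig w *m A^T = A^T *m X^T by apply: trmx_inj; rewrite !trmx_mul !trmxK.
  by rewrite -mulmxA eX mulmxA mulmx_ker mul0mx.
have [N0|N0] := eqVneq N 0; last first.
  have fN : (1%:M <= N)%MS by case: irr => _ _; apply=> //; apply: submx1.
  have A0 : A = 0.
    have /sub_kermxP : (1%:M <= kermx A^T)%MS by [].
    by rewrite mul1mx => /(congr1 trmx); rewrite trmxK trmx0.
  move=> v Gv; have := sA v^T; rewrite trmxK => /(_ Gv)/submxP[D e].
  by apply: trmx_inj; rewrite e A0 mulmx0 trmx0.
case/eqP: G0.
have /row_freeP[X eX] : row_free A^T by rewrite -kermx_eq0 -/N N0.
have e1 : cmx A^T *m cmx X = 1%:M by rewrite /Operators.cmx -map_mxM eX map_mx1.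
by rewrite -[G]mulmx1 -e1 mulmxA GA mul0mx.
Qed.

Lemma exists_bound (k : {vspace 'cV[C]_n} -> nat -> int) : exists B : nat,
  forall H i, H \in hyps -> (i < n_ rV H)%N -> ((n_ rV H)%:Z * `|k H i| <= B%:Z)%R.
Proof.
exists (\sum_(H <- hyps) \sum_(i < n_ rV H) n_ rV H * `|k H i|%N)%N => H i HH lt.
rewrite -abszE -PoszM lez_nat (bigD1_seq H) ?hyps_uniq //= (bigD1 (Ordinal lt)) //=.
by rewrite -!addnA leq_addr.
Qed.

Section AtPoint.
Variable x0 : 'cV[C]_n.
Hypothesis x0reg : ev x0 delta != 0.

(** Horizontal sections are determined by their value at x0, so the numerators E of G at x0 have
    rank m. If m = d, E is invertible and any section can be matched at x0 by a constant combination
    of columns of G. *)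
Lemma flat_basis d m (tau : mx_representation C W d) b N (G : 'M[K]_(d, m)) :
  (forall xi, nab tau b xi G = 0) -> regB N G ->
  (forall v : 'cV[C]_m, G *m cmx v = 0 -> v = 0) ->
  (m <= d)%N /\ (m = d -> row_free G /\
    forall q (f : 'M[K]_(d, q)) N', (forall xi, nab tau b xi f = 0) -> regB N' f ->
    exists A, f = G *m cmx A).
Proof.
move=> fG rG Ginj.
have choose N1 q (f : 'M[K]_(d, q)) : regB N1 f -> exists F : 'M[{mpoly C[n]}]_(d, q),
    forall i j, deltaK ^+ N1 * f i j = toK K (F i j).
  move=> rf; exists (\matrix_(i, j) sval (boolp.cid (rf i j))) => i j.
  by rewrite mxE; case: (boolp.cid (rf i j)).
have [P eP] := choose _ _ _ rG.
pose E : 'M[C]_(d, m) := map_mx (ev x0) P.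
have numA q (A : 'M[C]_(m, q)) i j :
    deltaK ^+ N * (G *m cmx A) i j = toK K (\sum_l A l j *: P i l).
  rewrite mxE mulr_sumr rmorph_sum; apply: eq_bigr => l _.
  by rewrite mulrA eP toKZ mulrC !mxE.
have evA q (A : 'M[C]_(m, q)) i j : ev x0 (\sum_l A l j *: P i l) = (E *m A) i j.
  by rewrite rmorph_sum [RHS]mxE; apply: eq_bigr => l _; rewrite [LHS]evZ mxE mulrC.
have nA q xi (A : 'M[C]_(m, q)) : nab tau b xi (G *m cmx A) = 0.
  have dA : dmx xi (cmx A) = 0 by apply/matrixP => i j; rewrite !mxE dK_cst.
  rewrite /Operators.nab dmx_mul dA mulmx0 addr0.
  under eq_bigr => H _ do rewrite mulmxA scalemxAl.
  by rewrite -mulmx_suml -mulmxDl -[_ + _]/(nab tau b xi G) fG mul0mx.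
have fE : row_free E^T.
  apply: inj_row_free => v ev0.
  have E0 : E *m v^T = 0 by apply: trmx_inj; rewrite trmx_mul trmxK trmx0.
  apply: trmx_inj; rewrite trmx0; apply: Ginj.
  apply: (flat_van_eq0 formsP x0reg (b := b) (N := N) (fun xi => nA _ xi v^T)) => i j.
  by exists (\sum_l v^T l j *: P i l); rewrite numA evA E0 mxE.
have rE : \rank E = m by rewrite -mxrank_tr; apply/eqP.
split=> [|md]; first by rewrite -rE rank_leq_row.
have /row_freeP[E' EE] : row_free E by rewrite /row_free rE md.
split.
  have uG : G *m cmx E' \in unitmx.
    rewrite unitmxE unitfE.
    pose PE : 'M[{mpoly C[n]}]_d := \matrix_(i, j) \sum_l E' l j *: P i l.
    have : \det (map_mx (toK K) PE) != 0.
      rewrite det_map_mx toK_eq0; apply/eqP => d0.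
      have := congr1 (ev x0) d0; rewrite -det_map_mx rmorph0.
      have -> : map_mx (ev x0) PE = 1%:M.
        by rewrite -EE; apply/matrixP => i j; rewrite mxE [PE i j]mxE evA.
      by rewrite det1 => /eqP; rewrite oner_eq0.
    apply: contraNneq => d0.
    have -> : map_mx (toK K) PE = deltaK ^+ N *: (G *m cmx E').
      by apply/matrixP => i j; rewrite mxE [PE i j]mxE -numA [RHS]mxE.
    by rewrite detZ d0 mulr0.
  by apply/row_freeP; exists (cmx E' *m invmx (G *m cmx E')); rewrite mulmxA mulmxV.
move=> q f N' ff rf.
have [F eF] := choose _ _ _ (regB_up N rf).
(* The numerators F are taken with exponent N + N' and those of G with exponent N; c corrects the
   factor delta(x0)^N'. *)
pose c := ev x0 delta ^- N'.
exists (E' *m (c *: map_mx (ev x0) F)); set A := E' *m _.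
apply/eqP; rewrite -subr_eq0; apply/eqP.
apply: (flat_van_eq0 formsP x0reg (tau := tau) (b := b) (N := (N + N')%N)) => [xi|i j].
  by rewrite nabB ff nA subrr.
exists (F i j - delta ^+ N' * \sum_l A l j *: P i l); split.
  rewrite [in LHS]mxE [X in _ * (_ + X)]mxE mulrBr eF rmorphB rmorphM -numA rmorphXn exprD.
  by rewrite mulrA [deltaK ^+ N' * _]mulrC.
rewrite rmorphB rmorphM rmorphXn /= evA /A mulmxA EE mul1mx !mxE /c mulrA mulfV ?mul1r ?subrr //.
by rewrite expf_neq0.
Qed.

End AtPoint.

Lemma regular_point : exists x, ev x delta != 0.
Proof.
apply: boolp.contrapT => nx; have := delta_neq0 formsP; case/eqP; apply: ev_eq0 => x.
by apply/eqP; apply: contraT => ne; case: nx; exists x.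
Qed.

Local Notation mult0 := (fun _ _ => 0 : C).

Lemma AH_mult0 d (tau : mx_representation C W d) H : AH tau mult0 H = 0.
Proof. by rewrite /Operators.AH big1 // => i _; rewrite mulr0 scale0r. Qed.

Lemma flat0 d m (tau : mx_representation C W d) (sig : mx_representation C W m) b
    (G : 'M[K]_(d, m)) : flat tau sig b mult0 G <-> forall xi, nab tau b xi G = 0.
Proof.
have e xi : \sum_(H <- hyps) om H xi *: (G *m cmx (AH sig mult0 H)) = 0.
  by rewrite big1 // => H _; rewrite AH_mult0 /Operators.cmx map_mx0 mulmx0 scaler0.
by split=> h xi; have := h xi; rewrite e.
Qed.

(** For the zero multiplicity the identity matrix is a horizontal basis, to which [flat_basis]
    applies. *)
Lemma flat_constant N d m (tau : mx_representation C W d) (sig : mx_representation C W m)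
    (G : 'M[K]_(d, m)) : regB N G -> flat tau sig mult0 mult0 G -> exists A, G = cmx A.
Proof.
move=> rG /flat0 fG; have [x0 x0reg] := regular_point.
have f1 xi : nab tau mult0 xi (1%:M : 'M[K]_d) = 0.
  rewrite /Operators.nab big1 => [|H _]; last first.
    by rewrite AH_mult0 /Operators.cmx map_mx0 mul0mx scaler0.
  by rewrite addr0; apply/matrixP => i j; rewrite !mxE -(rmorph_nat cst) dK_cst.
have r1 : regB 0 (1%:M : 'M[K]_d).
  by move=> i j; exists (i == j)%:R; rewrite expr0 mul1r mxE rmorph_nat.
have [|_ /(_ erefl)[_ h]] := flat_basis x0reg f1 r1.
  move=> v; rewrite mul1mx => /matrixP e; apply/matrixP => i j.
  by have := e i j; rewrite !mxE => /eqP; rewrite fmorph_eq0 => /eqP.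
by have [A] := h _ G N fG rG; rewrite mul1mx; exists A.
Qed.

Variable sT : irrType C W.
Implicit Types (i j l : sT) (k : {vspace 'cV[C]_n} -> nat -> int).
Local Notation Int i j := (fun N D b a G => [/\ Preg N D G,
  flat (irr_repr i) (irr_repr j) b a G & equi (irr_repr i) (irr_repr j) G]).

Definition twist k i j := exists N D G, Int i j N D (kC k) mult0 G /\ G != 0.

Lemma constant_irr i j N D G : Int i j N D mult0 mult0 G -> G != 0 -> i = j.
Proof.
move=> [PG fG eG] G0; have [A eA] := flat_constant (Preg_regB PG) fG.
have A0 : A != 0.
  by apply: contraNneq G0 => A0; rewrite eA A0 /Operators.cmx map_mx0.
apply: (irr_intertwiner_eq A0) => w wW; have := eG w wW.
rewrite eA /Operators.act map_wK_cmx // /Operators.cmx -!map_mxM => /matrixP e.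
by apply/matrixP => a b; have := e a b; rewrite !mxE => /fmorph_inj.
Qed.

(** With equal degrees G is a basis of sections, so the second twist is G A with A constant, and
    equivariance makes A an intertwiner of irreducible representations. *)
Lemma twist_uniq_dim k i j j' : irr_degree j = irr_degree i ->
  twist k i j -> twist k i j' -> j = j'.
Proof.
move=> dj [N [D [G [[PG /flat0 fG eG] G0]]]] [N' [D' [F [[PF /flat0 fF eF] F0]]]].
have [x0 x0reg] := regular_point; have Ginj := equi_inj (socle_irr j) eG G0.
have [_ /(_ dj)[_ h]] := flat_basis x0reg fG (Preg_regB PG) Ginj.
have [A eA] := h _ F N' fF (Preg_regB PF).
have A0 : A != 0.
  by apply: contraNneq F0 => A0; rewrite eA A0 /Operators.cmx map_mx0 mulmx0.
apply: (irr_intertwiner_eq A0) => w wW.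
have e : G *m cmx (irr_repr j w *m A) = G *m cmx (A *m irr_repr j' w).
  have := eF w wW; rewrite eA act_mulr map_wK_cmx // eG //.
  by rewrite -(mulmxA G) -(mulmxA G) /Operators.cmx !map_mxM.
apply/eqP; rewrite -subr_eq0; apply/eqP/matrixP => a b.
have /Ginj/matrixP/(_ a 0) : G *m cmx (col b (irr_repr j w *m A - A *m irr_repr j' w)) = 0.
  by rewrite colE /Operators.cmx map_mxM map_mxB mulmxA mulmxBr e subrr mul0mx.
by move: (_ - _) => X; rewrite !mxE.
Qed.

Lemma cofin_reflect (P : C -> Prop) : cofin P -> cofin (fun s => P (1 - s)).
Proof.
move=> [bad h]; exists [seq 1 - t | t <- bad] => s nb; apply: h.
by apply: contra nb => sb; apply/mapP; exists (1 - s); rewrite // opprB addrC subrK.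
Qed.

Lemma cofin_irr (P : sT -> C -> Prop) : (forall j, cofin (P j)) -> cofin (fun s => forall j, P j s).
Proof.
move=> h; apply: cofin_imp (cofin_all (r := enum sT) (fun j _ => h j)) => s hs j.
by apply: hs; rewrite mem_enum.
Qed.

Lemma multE (b b' : mult) : (forall H e, b H e = b' H e) -> b = b'.
Proof. by move=> h; apply: boolp.funext => H; apply: boolp.funext => e. Qed.

Lemma row_full_neq0 p q (G : 'M[K]_(p, q)) : (0 < q)%N -> row_full G -> G != 0.
Proof. by rewrite -mxrank_eq0 /row_full => q0 /eqP ->; rewrite -lt0n. Qed.

(* A generic intertwiner from (j, - s k) to (i, (1 - s) k), composed with one
   from (l, (1 - s) k) to (j, - s k), deforms to a constant intertwiner. *)
Lemma generic_dim k i : invmult rV (kC k) -> exists N D, cofin (fun s : C =>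
  exists j G, [/\ irr_degree j = irr_degree i, G != 0 &
    Int i j N D (lmult s (fun H e => - (k H e)%:~R) (kC k))
                (lmult s (fun H e => - (k H e)%:~R) mult0) G]).
Proof.
move=> ik; pose kN : mult := fun H e => - (k H e)%:~R.
pose mk H e : int := - k H e.
have ikN : invmult rV kN by move=> H w e HH wW lt; rewrite /kN ik.
have imk : invmult rV (kC mk) by move=> H w e HH wW lt; rewrite /mk !rmorphN /= ik.
have [x0 x0reg] := regular_point.
have [B kB] := exists_bound k; have [B' kB'] := exists_bound mk.
have [N [D A1]] := generic_intertwiner faithful formsP K sT x0reg (socle_irr i) ikN ik kB.
exists N, D.
have A3 j : cofin (fun s => forall G, Int i j N D (bs_ kN k s) (as_ kN s) G ->
    row_full G -> irr_degree j = irr_degree i).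
  have [N' [D' A2]] :=
    generic_intertwiner faithful formsP K sT x0reg (socle_irr j) ik imk kB'.
  (* At t = 0 both multiplicities vanish, so F is constant and l = i; semicontinuity extends this to
     almost all t. *)
  have A4 l : cofin (fun t => forall F, Int i l (N + N')%N (D + D').+1
      (lmult t (kC k) mult0) (lmult t (kC k) mult0) F -> F != 0 -> l = i).
    have [->|li] := eqVneq l i; first exact: cofin_true.
    apply: cofin_imp (semicont_flat (tau := irr_repr i) (sig := irr_repr l) (K := K)
      (N := (N + N')%N) (D := (D + D').+1) (k := mult0) (l := mult0) formsP (kC k) _).
      by move=> t h F [PF fF eF]; rewrite (h F PF fF eF) eqxx.
    move=> F PF fF eF; apply/eqP; apply: contraNT li => F0.
    by rewrite (@constant_irr i l (N + N')%N (D + D').+1 F).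
  (* The intertwiners F end at (j, t k - k); t = 1 - s matches this with the source (j, - s k) of
     G. *)
  apply: cofin_imp (cofin_reflect (cofinI A2 (cofin_irr A4))).
  move=> s [[l [F [PF fF eF rF]]] hl] G [PG fG eG] rG.
  have li : l = i.
    apply: (hl l (G *m F)); last first.
      apply: row_full_neq0; first exact: irr_dim_gt0 (socle_irr l).
      by rewrite /row_full (eqmxMfull _ rG) -[_ == _]/(row_full F).
    split; first exact: Preg_mul.
    - have e1 : lmult (1 - s) (kC k) mult0 = bs_ kN k s.
        by apply: multE => H e; rewrite /Intertwiners.lmult /bs_ /as_ /kN; ring.
      have e2 : lmult (1 - s) (kC k) mult0 = as_ (kC k) (1 - s).
        by apply: multE => H e; rewrite /Intertwiners.lmult /as_; ring.
      rewrite {1}e1 e2; apply: (flat_comp fG).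
      have -> : as_ kN s = bs_ (kC k) mk (1 - s); last exact: fF.
      by apply: multE => H e; rewrite /bs_ /as_ /kN /mk rmorphN; ring.
    - exact: equi_comp eG eF.
  (* The full rank of G bounds the degree of j by that of i; the full rank of F, where l = i, gives
     the converse. *)
  apply/eqP; rewrite eqn_leq; apply/andP; split.
    by have := rank_leq_row G; rewrite (eqP rG).
  by have := rank_leq_row F; rewrite (eqP rF) li.
apply: cofin_imp (cofinI A1 (cofin_irr A3)) => s [[j [G [PG fG eG rG]]] h].
exists j, G; split.
- by apply: (h j G).
- by apply: row_full_neq0 rG; apply: irr_dim_gt0 (socle_irr j).
split=> //; have -> : lmult s kN (kC k) = bs_ kN k s by [].
have -> : lmult s kN mult0 = as_ kN s by apply: multE => H e; rewrite /Intertwiners.lmult addr0.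
by [].
Qed.

(** Specialises [generic_dim] at s = 0: if there were no such twist, semicontinuity would exclude
    intertwiners within the bounds N and D for almost all s. *)
Lemma twist_exists k i : invmult rV (kC k) ->
  exists j, irr_degree j = irr_degree i /\ twist k i j.
Proof.
move=> ik; have [N [D h]] := generic_dim i ik.
apply: boolp.contrapT => nex.
have h2 j : cofin (fun s : C => forall G, irr_degree j = irr_degree i ->
    Int i j N D (lmult s (fun H e => - (k H e)%:~R) (kC k))
                (lmult s (fun H e => - (k H e)%:~R) mult0) G -> G = 0).
  have [dj|nd] := eqVneq (irr_degree j) (irr_degree i); last first.
    by apply: cofin_true => s G e; rewrite e eqxx in nd.
  apply: cofin_imp (semicont_flat (tau := irr_repr i) (sig := irr_repr j) (K := K)
    (N := N) (D := D) (k := kC k) (l := mult0) formsP (fun H e => - (k H e)%:~R) _).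
    by move=> t ht F _ [PF fF eF]; apply: ht.
  move=> F PF fF eF; apply/eqP; apply: contraT => F0; case: nex.
  by exists j; split=> //; exists N, D, F.
have [s [[j [G [dj G0 IG]]] hs]] := cofin_ex (cofinI h (cofin_irr h2)).
by rewrite (hs j G dj IG) eqxx in G0.
Qed.

Lemma twist_dim k i j : invmult rV (kC k) -> twist k i j -> irr_degree j = irr_degree i.
Proof.
move=> ik tj; have [j0 [d0 t0]] := twist_exists i ik.
by rewrite -(twist_uniq_dim d0 t0 tj).
Qed.

Lemma twist_uniq k i j j' : invmult rV (kC k) -> twist k i j -> twist k i j' -> j = j'.
Proof. by move=> ik tj; apply: twist_uniq_dim (tj); apply: twist_dim tj. Qed.

Lemma kC_addmult k k' : kC (addmult k k') = (fun H e => (k H e)%:~R + (k' H e)%:~R).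
Proof. by apply: multE => H e; rewrite /addmult rmorphD. Qed.

(* The generic intertwiners over the line k' + s k specialise at s = 1. *)
Lemma twist_comp k k' i j l : invmult rV (kC k) -> invmult rV (kC k') ->
  twist k' i j -> twist k j l -> twist (addmult k k') i l.
Proof.
move=> ik ik' tij tjl; have [x0 x0reg] := regular_point; have [B kB'] := exists_bound k'.
have [N [D A1]] := generic_intertwiner faithful formsP K sT x0reg (socle_irr i) ik ik' kB'.
(* At s = 0 such a G is a twist of i for k', so m = j by uniqueness; hence the generic intertwiners
   start from j as well. *)
have h1 m : cofin (fun s : C => forall G : 'M[K]_(irr_degree i, irr_degree m),
    Int i m N D (bs_ (kC k) k' s) (as_ (kC k) s) G -> G != 0 -> m = j).
  have [->|mj] := eqVneq m j; first exact: cofin_true.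
  apply: cofin_imp (semicont_flat (tau := irr_repr i) (sig := irr_repr m) (K := K)
    (N := N) (D := D) (k := kC k') (l := mult0) formsP (kC k) _).
    move=> s h G [PG fG eG]; rewrite (h G PG) ?eqxx //.
    have -> : lmult s (kC k) mult0 = as_ (kC k) s by apply: multE => H e; rewrite /Intertwiners.lmult addr0.
    exact: fG.
  move=> F PF fF eF; apply/eqP; apply: contraNT mj => F0; apply/eqP.
  by apply: (twist_uniq ik' _ tij); exists N, D, F.
have [G [[PG fG eG] G0]] : exists G : 'M[K]_(irr_degree i, irr_degree j),
    Int i j N D (kC (addmult k k')) (kC k) G /\ G != 0.
  apply: boolp.contrapT => nex.
  have inj F : Preg N D F -> flat (irr_repr i) (irr_repr j) (kC (addmult k k')) (kC k) F ->
      equi (irr_repr i) (irr_repr j) F -> F = 0.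
    move=> PF fF eF; apply/eqP; apply: contraT => F0; case: nex; by exists F.
  (* [semicont_flat] is centred at zero, so the line is reparametrised by t = s - 1 and the generic
     conditions are shifted. *)
  have h2 := semicont_flat formsP (kC k) inj.
  have [t [[m [F [PF fF eF rF]]] [hm ht]]] := cofin_ex (cofinI (cofin_shift A1)
    (cofinI (cofin_shift (cofin_irr h1)) h2)).
  have F0 : F != 0 by apply: row_full_neq0 rF; apply: irr_dim_gt0 (socle_irr m).
  have mj := hm m F (And3 PF fF eF) F0; move: F PF fF eF rF F0; rewrite mj => F PF fF eF _.
  rewrite (ht F PF _ eF) ?eqxx //.
  have -> : lmult t (kC k) (kC (addmult k k')) = bs_ (kC k) k' (t + 1).
    by apply: multE => H e; rewrite kC_addmult /Intertwiners.lmult /bs_ /as_; ring.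
  have -> : lmult t (kC k) (kC k) = as_ (kC k) (t + 1).
    by apply: multE => H e; rewrite /Intertwiners.lmult /as_; ring.
  exact: fF.
have djl := twist_dim ik tjl.
have [N' [D' [F [[PF fF eF] F0]]]] := tjl.
have fF' := (flat0 _ (irr_repr l) _ _).1 fF.
(* By [djl] the twist F is square, hence invertible over K, so that G F is nonzero. *)
have [_ /(_ djl)[rF _]] := flat_basis x0reg fF' (Preg_regB PF) (equi_inj (socle_irr l) eF F0).
exists (N + N')%N, (D + D').+1, (G *m F); split; last first.
  by apply: contra G0 => /eqP e; apply/eqP; apply: (row_free_inj rF); rewrite e mul0mx.
split; [exact: Preg_mul | exact: flat_comp fG fF | exact: equi_comp eG eF].
Qed.

Lemma twist0 k i : (forall H e, k H e = 0) -> twist k i i.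
Proof.
move=> k0; have e0 : kC k = mult0 by apply: multE => H e; rewrite k0.
exists 0%N, 1%N, 1%:M; split; last first.
  by rewrite -mxrank_eq0 mxrank1 -lt0n; apply: irr_dim_gt0 (socle_irr i).
split.
- move=> a b; exists (a == b)%:R; rewrite expr0 mul1r mxE rmorph_nat; split=> //.
  by case: (a == b); rewrite ?msize1 ?msize0.
- rewrite e0; apply/flat0 => xi; rewrite /Operators.nab big1 => [|H _]; last first.
    by rewrite AH_mult0 /Operators.cmx map_mx0 mul0mx scaler0.
  by rewrite addr0; apply/matrixP => a b; rewrite !mxE -(rmorph_nat cst) dK_cst.
by move=> w wW; rewrite mul1mx /Operators.act map_mx1 mulmx1.
Qed.
End Twists.

End Twists.
Import Twists.

(** * From twists over K to solutions on V_reg *)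

Module Solutions.

Section Solutions.
Variables (C : numClosedFieldType) (gT : finGroupType) (W : {group gT}).
Variables (n : nat) (rV : mx_representation C W n).
Variable alpha : {vspace 'cV[C]_n} -> 'Hom('cV[C]_n, C^o).
Hypothesis faithful : mx_faithful rV.
Hypothesis formsP : is_hyperplane_forms rV alpha.
Variable K : ratfield C n.

Local Notation hyps := (hyperplanes rV).
Local Notation cst := (cst K).
Local Notation om := (om alpha K).
Local Notation wK := (wK rV K).
Local Notation act := (act rV (K := K)).
Local Notation nab tau := (nab rV alpha (K := K) tau).
Local Notation AH tau := (AH rV tau).
Local Notation cmx := (cmx K).
Local Notation delta := (delta rV alpha).
Local Notation deltaK := (toK K delta).
Local Notation mult := ({vspace 'cV[C]_n} -> nat -> C).

Implicit Types (H : {vspace 'cV[C]_n}) (w g : gT) (x xi : 'cV[C]_n).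
Implicit Types (kap : mult).



Let dK0 : deltaK != 0. Proof. exact: (toK_delta_neq0 formsP). Qed.

Local Notation regB := (regB rV alpha (K := K)).
Local Notation kC k := (fun H i => (k H i)%:~R : C).


Lemma ev_delta x : ev x delta = \prod_(H <- hyps) (alpha H x : C).
Proof. by rewrite rmorph_prod; apply: eq_bigr => H _; apply: meval_lform. Qed.

Lemma VregE x : (x \in Vreg rV) = (ev x delta != 0).
Proof.
rewrite ev_delta prodf_seq_neq0; apply: eq_in_all => H HH /=.
by rewrite (mem_hyp formsP).
Qed.

Lemma ev_subst x A P : ev x (subst A P) = ev (A *m x) P.
Proof. exact: meval_subst. Qed.

Lemma Vreg_act w x : w \in W -> x \in Vreg rV -> rV w^-1%g *m x \in Vreg rV.
Proof.
move=> wW; rewrite !VregE -ev_subst => x0.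
have [c c0 e] := wK_delta formsP K wW.
have -> : subst (rV w^-1%g) delta = c *: delta.
  by apply: (@toK_inj _ _ K); rewrite toKZ -e /LocalRing.wK sKE // unit_rVV.
by rewrite evZ mulf_neq0.
Qed.

(** The value of f at x as a relation, witnessed by any fraction whose denominator is nonzero at x;
    no fraction has to be preferred, and [isval_uniq] makes the value well defined. *)
Definition isval x (f : K) (c : C) :=
  exists P Q, [/\ ev x Q != 0, f * toK K Q = toK K P & c * ev x Q = ev x P].

Lemma isval_uniq x f c c' : isval x f c -> isval x f c' -> c = c'.
Proof.
move=> [P [Q [Q0 eP ec]]] [P' [Q' [Q0' eP' ec']]].
have e : P * Q' = P' * Q.
  by apply: (@toK_inj _ _ K); rewrite !rmorphM -eP -eP' mulrAC.
apply: (mulIf (mulf_neq0 Q0 Q0')).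
have := congr1 (ev x) e; rewrite !rmorphM /= -ec -ec' => e'.
by rewrite mulrA e'; ring.
Qed.

Lemma isval_toK x P : isval x (toK K P) (ev x P).
Proof. by exists P, 1; rewrite !rmorph1 !mulr1 oner_neq0. Qed.

Lemma isval_cst x c : isval x (cst c) c.
Proof. by have := isval_toK x c%:MP; rewrite evC. Qed.

Lemma isvalD x f c f' c' : isval x f c -> isval x f' c' -> isval x (f + f') (c + c').
Proof.
move=> [P [Q [Q0 eP ec]]] [P' [Q' [Q0' eP' ec']]].
exists (P * Q' + P' * Q), (Q * Q'); rewrite !rmorphD !rmorphM /= -eP -eP' -ec -ec'.
by split; [rewrite mulf_neq0 | ring | ring].
Qed.

Lemma isvalM x f c f' c' : isval x f c -> isval x f' c' -> isval x (f * f') (c * c').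
Proof.
move=> [P [Q [Q0 eP ec]]] [P' [Q' [Q0' eP' ec']]].
exists (P * P'), (Q * Q'); rewrite !rmorphM /= -eP -eP' -ec -ec'.
by split; [rewrite mulf_neq0 | ring | ring].
Qed.

Lemma isval_sum x (I : Type) (r : seq I) (F : I -> K) (G : I -> C) :
  (forall i, isval x (F i) (G i)) -> isval x (\sum_(i <- r) F i) (\sum_(i <- r) G i).
Proof.
move=> h; apply: (big_ind2 (isval x)) => //; last by move=> *; apply: isvalD.
by rewrite -(rmorph0 cst); apply: isval_cst.
Qed.

Lemma isval_sum_in x (I : eqType) (r : seq I) (F : I -> K) (G : I -> C) :
  (forall i, i \in r -> isval x (F i) (G i)) ->
  isval x (\sum_(i <- r) F i) (\sum_(i <- r) G i).
Proof.
move=> h; rewrite big_seq [X in isval x _ X]big_seq.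
apply: (big_ind2 (isval x)) => //; last by move=> *; apply: isvalD.
by rewrite -(rmorph0 cst); apply: isval_cst.
Qed.

Lemma isvalV x f c : c != 0 -> isval x f c -> isval x f^-1 c^-1.
Proof.
move=> c0 [P [Q [Q0 eP ec]]].
have P0 : ev x P != 0 by rewrite -ec mulf_neq0.
have f0 : f != 0.
  apply: contraNneq P0 => f0; move: eP; rewrite f0 mul0r => /esym/eqP.
  by rewrite toK_eq0 => /eqP ->; rewrite rmorph0.
by exists Q, P; split=> //; rewrite -?eP -?ec mulKf.
Qed.

Lemma isval_wK x w f c : w \in W -> isval (rV w^-1%g *m x) f c -> isval x (wK w f) c.
Proof.
move=> wW [P [Q [Q0 eP ec]]]; exists (subst (rV w^-1%g) P), (subst (rV w^-1%g) Q).
by rewrite !ev_subst -(sKE K) ?unit_rVV // -(sKE K) ?unit_rVV // -eP rmorphM.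
Qed.

(** For a numerator P of f, delta P vanishes everywhere: on V_reg by hypothesis, elsewhere through
    the factor delta. *)
Lemma isval_eq0 f : Lreg rV alpha f -> (forall x, x \in Vreg rV -> isval x f 0) -> f = 0.
Proof.
move=> [N [P eP]] h.
have : delta * P = 0.
  apply: ev_eq0 => x; rewrite rmorphM /=.
  have [->|x0] := eqVneq (ev x delta) 0; first by rewrite mul0r.
  have xV : x \in Vreg rV by rewrite VregE.
  have := isvalM (isval_toK x (delta ^+ N)) (h x xV).
  rewrite rmorphXn eP mulr0 => /(isval_uniq (isval_toK x P)) ->.
  by rewrite mulr0.
move/eqP; rewrite mulf_eq0 (negPf (delta_neq0 formsP)) /= => /eqP P0.
move/eqP: eP; rewrite P0 rmorph0 mulf_eq0 expf_eq0.
by rewrite (negPf (toK_delta_neq0 formsP K)) andbF => /eqP.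
Qed.

Section Vector.
Variables (d : nat) (tau : mx_representation C W d).
Implicit Types (f : 'cV[K]_d) (y : 'cV[C]_n -> 'cV[C]_d).

Definition represents f y := forall x, x \in Vreg rV -> forall j, isval x (f j 0) (y x j 0).

Lemma isval_frac x N (f : K) P : x \in Vreg rV -> deltaK ^+ N * f = toK K P ->
  isval x f (ev x P / ev x delta ^+ N).
Proof.
rewrite VregE => x0 eP; have x0N : ev x delta ^+ N != 0 by rewrite expf_neq0.
by exists P, (delta ^+ N); rewrite !rmorphXn /= divfK // mulrC.
Qed.

Lemma represents_uniq f y y' : represents f y -> represents f y' ->
  {in Vreg rV, y =1 y'}.
Proof.
move=> h h' x xV; apply/matrixP => j i; rewrite ord1.
exact: isval_uniq (h x xV j) (h' x xV j).
Qed.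

Lemma represents_regular f y N : regB N f -> represents f y -> regular_on_Vreg rV alpha y.
Proof.
move=> rf h j; have [P eP] := rf j 0; exists P, N => x xV.
by rewrite -ev_delta; apply: isval_uniq (h x xV j) (isval_frac xV eP).
Qed.

Lemma regular_represents y : regular_on_Vreg rV alpha y -> exists N f, regB N f /\ represents f y.
Proof.
move=> h; have [P hP] := boolp.choice h; have [N hN] := boolp.choice hP.
pose M := (\sum_j N j)%N; pose f : 'cV[K]_d := \col_j (toK K (P j) / deltaK ^+ N j).
have fE j : deltaK ^+ N j * f j 0 = toK K (P j) by rewrite mxE mulrC divfK // expf_neq0.
exists M, f; split=> [j i|x xV j].
  rewrite ord1 /M (bigD1 j) //= addnC exprD -mulrA fE -rmorphXn -rmorphM.
  by exists (delta ^+ (\sum_(i0 < d | i0 != j) N i0) * P j).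
by rewrite (hN j x xV) -ev_delta; apply: isval_frac.
Qed.

Lemma represents_derive f y N xi x : regB N f -> represents f y -> x \in Vreg rV ->
  forall j, isval x (dK K xi (f j 0)) (dir_der y x xi j 0).
Proof.
(* The exponent is raised to 1 + N so that a nonzero value of q, the restriction of delta^(1 + N) to
   the line, means lying in V_reg; exponent 0 would say nothing. *)
move=> /(regB_up 1) rf h xV j; have x0 := xV; rewrite VregE in x0.
have [P eP] : exists P : 'I_d -> {mpoly C[n]}, forall j, deltaK ^+ (1 + N) * f j 0 = toK K (P j).
  by have [P hP] := boolp.choice (fun j => rf j 0); exists P.
pose q := line x xi (delta ^+ (1 + N)).
have q0 : q.[0] = ev x delta ^+ (1 + N).
  by rewrite line_ev scale0r addr0 rmorphXn.
have -> : dir_der y x xi = \col_j (((line x xi (P j))^`().[0] * q.[0]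
    - (line x xi (P j)).[0] * q^`().[0]) / q.[0] ^+ 2).
  apply: derive_rational => [|t]; first by rewrite q0 expf_neq0.
  rewrite line_ev rmorphXn expf_eq0 /= => xt; apply/matrixP => l i; rewrite ord1 mxE line_ev.
  have xtV : x + t *: xi \in Vreg rV by rewrite VregE.
  by rewrite (isval_uniq (h _ xtV l) (isval_frac xtV (eP l))).
rewrite mxE !line_der !line_ev scale0r addr0.
have e : deltaK ^+ (1 + N) ^+ 2 * dK K xi (f j 0) = toK K (pder xi (P j) * delta ^+ (1 + N)
    - P j * pder xi (delta ^+ (1 + N))).
  rewrite rmorphB !rmorphM -!dKE -eP dKM rmorphXn; ring.
have := isval_frac (N := 2 * (1 + N)) xV; rewrite mulnC exprM => /(_ _ _ e).
by rewrite rmorphB !rmorphM /= rmorphXn exprM.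
Qed.

Lemma isval_om x H xi : x \in Vreg rV -> H \in hyps ->
  isval x (om H xi) ((alpha H xi : C) / (alpha H x : C)).
Proof.
move=> xV HH; apply: isvalM; first exact: isval_cst.
apply: isvalV; last by rewrite -meval_lform; apply: isval_toK.
by move/allP: xV => /(_ H HH); rewrite (mem_hyp formsP).
Qed.

Lemma isval_nab k f y N xi x : regB N f -> represents f y -> x \in Vreg rV ->
  forall j, isval x (nab tau (kC k) xi f j 0)
    ((dir_der y x xi + \sum_(H <- hyps) ((alpha H xi : C) / (alpha H x : C)) *:
       \sum_(i < n_ rV H) ((n_ rV H)%:R * (k H i)%:~R) *: (e_ rV tau H i *m y x)) j 0).
Proof.
move=> rf h xV j; rewrite !mxE !summxE; apply: isvalD.
  exact: (represents_derive xi rf h xV).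
apply: isval_sum_in => H HH; rewrite !mxE; apply: isvalM; first exact: isval_om.
have -> : (\sum_(i < n_ rV H) ((n_ rV H)%:R * (k H i)%:~R) *: (e_ rV tau H i *m y x)) j 0 =
    (AH tau (kC k) H *m y x) j 0.
  rewrite /Operators.AH mulmx_suml; congr (fun_of_matrix _ j 0).
  by apply: eq_bigr => i _; rewrite scalemxAl.
rewrite mxE; apply: isval_sum => l; apply: isvalM; last exact: h.
by rewrite mxE; apply: isval_cst.
Qed.

Lemma Lreg_regB N p q (h : 'M[K]_(p, q)) : regB N h -> forall i j, Lreg rV alpha (h i j).
Proof. by move=> rh i j; have [P eP] := rh i j; exists N, P. Qed.

(** The system at the points of V_reg consists of the values of nabla f, and a regular function is
    determined by its values on V_reg. *)
Lemma KZ_flat k f y N : regB N f -> represents f y ->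
  KZ_solution rV alpha tau k y <-> forall xi, nab tau (kC k) xi f = 0.
Proof.
move=> rf h; rewrite KZ_solutionE; split=> [[_ kz] xi|fl].
  apply/matrixP => j i; rewrite ord1 [RHS]mxE; apply: isval_eq0 => [|x xV].
    rewrite !mxE summxE; apply: LregD; first by apply: Lreg_dK; apply: Lreg_regB rf _ _.
    rewrite big_seq; apply: Lreg_sum => H HH; rewrite !mxE; apply: LregM.
      exact: Lreg_om.
    apply: Lreg_sum => l _; apply: LregM; last exact: Lreg_regB rf _ _.
    by rewrite mxE; apply: Lreg_cst.
  by have := isval_nab k xi rf h xV j; rewrite kz // [X in isval _ _ X]mxE.
split=> [|xi x xV]; first exact: represents_regular rf h.
apply/matrixP => j i; rewrite ord1 [RHS]mxE.
have := isval_nab k xi rf h xV j; rewrite fl [X in isval _ X _]mxE => h1.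
by apply: isval_uniq h1 _; rewrite -(rmorph0 cst); apply: isval_cst.
Qed.

Lemma represents_act f y w : w \in W -> represents f y ->
  represents (act tau w f) (act_sol rV tau w y).
Proof.
move=> wW h x xV j; rewrite mxE /act_sol mxE; apply: isval_sum => l.
apply: isvalM; first by rewrite mxE; apply: isval_cst.
by rewrite mxE; apply: isval_wK => //; apply: h; apply: Vreg_act.
Qed.

Lemma represents_eq f f' y N N' : regB N f -> regB N' f' -> represents f y ->
  represents f' y -> f = f'.
Proof.
move=> rf rf' h h'; apply/matrixP => j i; rewrite ord1; apply/eqP; rewrite -subr_eq0; apply/eqP.
apply: isval_eq0 => [|x xV].
  by apply: LregD; [|apply: LregN]; apply: Lreg_regB; eassumption.
have e : 0 = y x j 0 + (- 1) * y x j 0 by rewrite mulN1r subrr.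
rewrite e; apply: isvalD; first exact: h.
rewrite -[- f' j 0]mulN1r; apply: isvalM; last exact: h'.
by rewrite -(rmorphN1 cst); apply: isval_cst.
Qed.

Lemma exists_represents f N : regB N f -> exists y, represents f y.
Proof.
move=> rf; have [P hP] := boolp.choice (fun j => rf j 0).
exists (fun x => \col_j (ev x (P j) / ev x delta ^+ N)) => x xV j.
by rewrite mxE; apply: isval_frac.
Qed.

End Vector.

Variable sT : irrType C W.
Implicit Types (i j : sT) (k : {vspace 'cV[C]_n} -> nat -> int).
Local Notation twist := (twist rV alpha K).

(** Phi sends v to the function that G v represents. Since the degrees agree, the columns of G are a
    basis of all regular solutions, which gives surjectivity. *)
Lemma twist_KZ_iso k i j : invmult rV (kC k) -> twist k i j ->
  exists Phi, KZ_iso rV alpha (irr_repr i) k (irr_repr j) Phi.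
Proof.
move=> ik tij; have dij := twist_dim faithful formsP ik tij.
have [N [D [G [[PG fG eG] G0]]]] := tij; have [x0 x0reg] := regular_point formsP.
have rG := Preg_regB PG; have {}fG := (flat0 _ _ _ _ _ _).1 fG.
have Ginj := equi_inj (socle_irr j) eG G0.
have [_ /(_ dij)[_ Gsurj]] := flat_basis formsP x0reg fG rG Ginj.
pose F v : 'cV[K]_(irr_degree i) := G *m cmx v.
have rF v : regB N (F v).
  exact: (Preg_regB (Preg_cmx v PG)).
have nF v xi : nab (irr_repr i) (kC k) xi (F v) = 0.
  have dA : dmx xi (cmx v) = 0 by apply/matrixP => a b; rewrite !mxE dK_cst.
  rewrite /Operators.nab dmx_mul dA mulmx0 addr0.
  under eq_bigr => H _ do rewrite mulmxA scalemxAl.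
  by rewrite -mulmx_suml -mulmxDl -[_ + _]/(nab (irr_repr i) (kC k) xi G) fG mul0mx.
have [Phi hPhi] := boolp.choice (fun v => exists_represents (rF v)).
exists Phi; split.
- by move=> v; apply/(KZ_flat _ _ (rF v) (hPhi v)).
- move=> a u v; apply: (represents_uniq (hPhi _)) => x xV l.
  have -> : F (a *: u + v) l 0 = cst a * F u l 0 + F v l 0.
    by rewrite /F /Operators.cmx map_mxD map_mxZ mulmxDr -scalemxAr mxE [X in X + _]mxE.
  rewrite [X in isval _ _ X]mxE [X in isval _ _ (X + _)]mxE.
  by apply: isvalD; [apply: isvalM; [exact: isval_cst |]|]; apply: hPhi.
- move=> v v0; apply: Ginj; apply: (represents_eq (rF v) (N' := 0%N) _ (hPhi v)).
    by move=> a b; exists 0; rewrite mxE mulr0 rmorph0.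
  move=> x xV l; rewrite v0 // !mxE -(rmorph0 cst); exact: isval_cst.
- move=> y /KZ_solutionE-KZy.
  have [N' [f [rf hf]]] := regular_represents KZy.1.
  have [A eA] := Gsurj _ f N' ((KZ_flat _ _ rf hf).1 ((KZ_solutionE _ _ _ _ _).2 KZy)) rf.
  by exists A; apply: represents_uniq hf _; rewrite eA; apply: hPhi.
move=> w v wW; apply: (represents_uniq (hPhi _)).
have -> : F (irr_repr j w *m v) = act (irr_repr i) w (F v).
  by rewrite /F act_mulr eG // map_wK_cmx // -mulmxA /Operators.cmx map_mxM.
exact: represents_act.
Qed.

(** Psi in the coordinates given by Phi is a constant matrix A; equivariance makes A an intertwiner,
    nonzero because Psi is injective. *)
Lemma KZ_iso_uniq k i j j' Phi Psi : KZ_iso rV alpha (irr_repr i) k (irr_repr j) Phi ->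
  KZ_iso rV alpha (irr_repr i) k (irr_repr j') Psi -> j = j'.
Proof.
move=> [_ lin inj surj eqv] [sol' lin' inj' _ eqv'].
have Phi0 : {in Vreg rV, forall x, Phi 0 x = 0}.
  move=> x xV; have := lin 1 0 0 x xV; rewrite scale1r addr0 scale1r => /eqP.
  by rewrite -{1}[Phi 0 x]addr0 (inj_eq (addrI _)) eq_sym => /eqP.
have Psi0 : {in Vreg rV, forall x, Psi 0 x = 0}.
  move=> x xV; have := lin' 1 0 0 x xV; rewrite scale1r addr0 scale1r => /eqP.
  by rewrite -{1}[Psi 0 x]addr0 (inj_eq (addrI _)) eq_sym => /eqP.
have [a ha] := boolp.choice (fun l => surj _ (sol' (delta_mx l 0))).
pose A : 'M[C]_(irr_degree j, irr_degree j') := \matrix_(b, l) a l b 0.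
have colA l : A *m delta_mx l 0 = a l.
  by rewrite -colE; apply/matrixP => b c; rewrite !mxE ord1.
have PsiA u : {in Vreg rV, Psi u =1 Phi (A *m u)}.
  have -> : u = \sum_l u l 0 *: delta_mx l 0.
    by rewrite {1}[u]matrix_sum_delta; apply: eq_bigr => l _; rewrite big_ord1.
  elim: (index_enum _) => [|l r IH] x xV; first by rewrite !big_nil mulmx0 Phi0 // Psi0.
  by rewrite big_cons lin' // mulmxDr -scalemxAr lin // colA ha // IH.
have cA w : w \in W -> irr_repr j w *m A = A *m irr_repr j' w.
  move=> wW; apply/eqP; rewrite -subr_eq0; apply/eqP/matrixP => b l.
  have -> : (irr_repr j w *m A - A *m irr_repr j' w) =
      (-1) *: (A *m irr_repr j' w) + irr_repr j w *m A by rewrite scaleN1r addrC.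
  have : ((-1) *: (A *m irr_repr j' w) + irr_repr j w *m A) *m delta_mx l 0 = 0 :> 'cV_ _.
    apply: inj => x xV; rewrite mulmxDl -scalemxAl lin // -(mulmxA A) -(mulmxA (irr_repr j w)).
    rewrite -PsiA // eqv' // eqv // /act_sol PsiA ?Vreg_act //.
    by rewrite scaleN1r addNr.
  by move: (_ + _) => X; rewrite -colE => /matrixP/(_ b 0); rewrite !mxE.
have A0 : A != 0.
  apply/eqP => A0; have j0 := irr_dim_gt0 (socle_irr j').
  have : delta_mx (Ordinal j0) 0 = 0 :> 'cV[C]_(irr_degree j').
    by apply: inj' => x xV; rewrite PsiA // A0 mul0mx Phi0.
  by move/matrixP/(_ (Ordinal j0) 0)/eqP; rewrite !mxE !eqxx oner_eq0.
exact: (irr_intertwiner_eq A0 cA).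
Qed.

Lemma kzE k i j : invmult rV (kC k) -> twist k i j -> kz rV alpha k i = j.
Proof.
move=> ik tij; have [Phi hPhi] := twist_KZ_iso ik tij.
rewrite /kz; case: pickP => [j' /boolp.asboolP[Psi hPsi]|/(_ j)].
  exact: KZ_iso_uniq hPsi hPhi.
by move/boolp.asboolP; case; exists Phi.
Qed.

Lemma integral_invmult k : integral_multiplicity rV k -> invmult rV (kC k).
Proof. by move=> ik H w e HH wW lt; rewrite /Hyperplanes.hmove ik. Qed.

Theorem kz_twist k : integral_multiplicity rV k -> forall i, twist k i (kz rV alpha k i).
Proof.
move=> /integral_invmult ik i; have [j [_ tij]] := twist_exists faithful formsP K i ik.
by rewrite (kzE ik tij).
Qed.

Theorem kz_comp k k' : integral_multiplicity rV k -> integral_multiplicity rV k' ->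
  forall i, kz rV alpha k (kz rV alpha k' i) = kz rV alpha (addmult k k') i.
Proof.
move=> mk mk' i; have ik := integral_invmult mk; have ik' := integral_invmult mk'.
apply/esym/kzE.
  by move=> H w e HH wW lt; rewrite /addmult mk // mk'.
by apply: (twist_comp faithful formsP ik ik'); apply: kz_twist.
Qed.

Theorem kz_bij k : integral_multiplicity rV k -> bijective (fun i => kz rV alpha k i).
Proof.
move=> mk; pose mN : {vspace 'cV[C]_n} -> nat -> int := fun H e => - k H e.
have iN : integral_multiplicity rV mN by move=> H w e HH wW lt; rewrite /mN mk.
have id0 m i : (forall H e, m H e = 0) -> kz rV alpha m i = i.
  move=> m0; apply: kzE; last exact: twist0.
  by move=> H w e HH wW lt; rewrite !m0.
exists (fun i => kz rV alpha mN i) => i; rewrite kz_comp // id0 // => H e.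
  by rewrite /addmult addNr.
by rewrite /addmult addrN.
Qed.

End Solutions.

End Solutions.

End KZ.

Theorem corollary7p12 (R : realType) (gT : finGroupType) (W : {group gT})
    (n : nat) (rV : mx_representation R[i] W n)
    (alpha : {vspace 'cV[R[i]]_n} -> 'Hom('cV[R[i]]_n, R[i]^o))
    (sT : irrType R[i] W) :
  complex_reflection_group rV ->
  is_hyperplane_forms rV alpha ->
  (forall k, integral_multiplicity rV k ->
     bijective (fun tau : sT => kz rV alpha k tau)) /\
  (forall k k', integral_multiplicity rV k -> integral_multiplicity rV k' ->
     forall tau : sT,
       kz rV alpha k (kz rV alpha k' tau) = kz rV alpha (addmult k k') tau).
Proof.
move=> [faithful _] formsP; pose K := KZ.RationalFunctions.ratfield_exists R[i] n.
split=> [k|k k']; first exact: (KZ.Solutions.kz_bij faithful formsP K).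
exact: (KZ.Solutions.kz_comp faithful formsP K).
Qed.
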